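(* Let $\Omega$ be a smooth bounded convex domain in $\mathbb{C}^n$ with no analytic disks in the boundary $b\Omega$, and let $\psi\in C(\overline{\Omega})$. Then the essential norm of the Toeplitz operator $T_\psi$ on the Bergman space $A^2(\Omega)$ satisfies $\|T_\psi\|_e=\|\psi\|_{L^\infty(b\Omega)}$.
   Context: ''Smooth'' means $C^\infty$-smooth boundary. $\mathbb{D}$ is the open unit disk in $\mathbb{C}$. A set $X\subset\mathbb{C}^n$ is said to have an analytic disk if there exists a nonconstant holomorphic mapping $f:\mathbb{D}\to\mathbb{C}^n$ with $f(\mathbb{D})\subset X$. The Bergman space $A^2(\Omega)$ is the closed subspace of $L^2(\Omega)$ (Lebesgue measure) consisting of holomorphic functions; $P:L^2(\Omega)\to A^2(\Omega)$ is the orthogonal (Bergman) projection, and $T_\psi:A^2(\Omega)\to A^2(\Omega)$ is $T_\psi f=P(\psi f)$. The essential norm of a bounded linear operator $T:X\to Y$ between Banach spaces is $\|T\|_e=\inf\{\|T-S\|: S:X\to Y\text{ is a compact linear operator}\}$. For $\psi\in C(\overline{\Omega})$, $\|\psi\|_{L^\infty(b\Omega)}=\sup\{|\psi(z)|:z\in b\Omega\}$. *)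

(* Defs.v *)
From HB Require Import structures.
From mathcomp Require Import all_boot all_order all_algebra.
From mathcomp Require Import all_classical all_reals all_analysis.
From mathcomp Require Import measurable_realfun complex ring lra.
Set Implicit Arguments. Unset Strict Implicit. Unset Printing Implicit Defensive.
Import Order.TTheory GRing.Theory Num.Theory.
Import numFieldNormedType.Exports.
Import ComplexField.Normc.
Local Open Scope classical_set_scope.
Local Open Scope complex_scope.
Local Open Scope ring_scope.

(* [R[i]] is a normed module over itself, so that [differentiable] for maps
   between normed [R[i]]-modules means complex differentiable. *)
HB.instance Definition _ (R : realType) := NormedModule.copy R[i] R[i]^o.

Definition tuple_cons (T : Type) (n : nat) (p : T * n.-tuple T) : n.+1.-tuple T :=
  [tuple of p.1 :: p.2].

Lemma measurable_tuple_cons d (T : measurableType d) n :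
  measurable_fun [set: T * n.-tuple T] (@tuple_cons T n).
Proof. exact: measurable_cons. Qed.

(* The canonical sigma-finite structure of [mu \x nu] found by inference is the
   one for subprobabilities, so sigma-finiteness is restated here. *)
Lemma product_sigma_finite d1 d2 (T1 : measurableType d1) (T2 : measurableType d2)
    (R : realType) (mu : {sigma_finite_measure set T1 -> \bar R})
    (nu : {sigma_finite_measure set T2 -> \bar R}) :
  sigma_finite setT (mu \x nu)%E.
Proof.
have /sigma_finiteP[F [TF ndF Foo]] := sigma_finiteT mu.
have /sigma_finiteP[G [TG ndG Goo]] := sigma_finiteT nu.
exists (fun n => F n `*` G n).
  rewrite -setXTT TF TG predeqE => -[x y]; split.
    move=> [/= [n _ Fnx] [k _ Gky]]; exists (maxn n k) => //; split.
    - by move: x Fnx; exact/subsetPset/ndF/leq_maxl.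
    - by move: y Gky; exact/subsetPset/ndG/leq_maxr.
  by move=> [n _ []/= ? ?]; split; exists n.
move=> k; have [? ?] := Foo k; have [? ?] := Goo k.
split; first exact: measurableX.
by rewrite product_measure1E// lte_mul_pinfty// ge0_fin_numE.
Qed.

Section tuple_cons_measure.
Context d (T : measurableType d) (R : realType) (n : nat).
Variables (mu : {sigma_finite_measure set T -> \bar R})
  (nu : {sigma_finite_measure set (n.-tuple T) -> \bar R}).

Definition tuple_cons_measure : set (n.+1.-tuple T) -> \bar R :=
  pushforward (mu \x nu)%E (@tuple_cons T n).

Let m : {measure set (n.+1.-tuple T) -> \bar R} :=
  measure_function_pushforward__canonical__measure_function_Measure (mu \x nu)%E (@measurable_tuple_cons _ T n).
HB.instance Definition _ :=
  isMeasure.Build _ _ _ tuple_cons_measure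
    (measure0 m) (measure_ge0 m) (@measure_semi_sigma_additive _ _ _ m).

Let tuple_cons_sigma_finite : sigma_finite setT tuple_cons_measure.
Proof.
have [F TF Foo] := product_sigma_finite mu nu.
exists (fun k => @tuple_cons T n @` F k).
  rewrite -image_bigcup -TF; apply/esym/seteqP; split => // t _.
  exists (thead t, [tuple of behead t]) => //.
  by rewrite [RHS]tuple_eta.
have inj : injective (@tuple_cons T n).
  move=> [a s] [b t] /(congr1 val) /= [-> st]; congr pair; exact: val_inj.
move=> k; have [mF F_oo] := Foo k.
have pre (A : set (T * n.-tuple T)) : @tuple_cons T n @^-1` (@tuple_cons T n @` A) = A.
  apply/seteqP; split => [x [y Ay] /inj <-//|x Ax]; by exists x.
split; last by rewrite /tuple_cons_measure /pushforward pre.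
set g := fun t : n.+1.-tuple T => (thead t, [tuple of behead t]).
suff -> : @tuple_cons T n @` F k = g @^-1` F k.
  rewrite -[X in measurable X]setTI.
  have : measurable_fun [set: n.+1.-tuple T] g.
    apply/measurable_fun_pairP; split; first exact: measurable_tnth.
    exact: measurable_behead.
  by apply.
apply/seteqP; split => [_ [p Fp <-]|t Ft]; last first.
  by exists (g t) => //; rewrite [RHS]tuple_eta.
have -> : (g @^-1` F k) (tuple_cons p) = F k (g (tuple_cons p)) by [].
suff -> : g (tuple_cons p) = p by [].
by apply: inj; rewrite [RHS]tuple_eta.
Qed.

HB.instance Definition _ :=
  @Measure_isSigmaFinite.Build _ _ _ tuple_cons_measure tuple_cons_sigma_finite.
End tuple_cons_measure.

Section tuple_measure.
Context d (T : measurableType d) (R : realType).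
Variable mu : {sigma_finite_measure set T -> \bar R}.
(* The n-fold product measure; [tuple_measureE] gives its value on boxes. *)
Fixpoint tuple_measure (n : nat) : {sigma_finite_measure set (n.-tuple T) -> \bar R} :=
  if n is m.+1 then tuple_cons_measure mu (tuple_measure m)
  else \d_[tuple].

Lemma tuple_measureE n (A : 'I_n -> set T) : (forall i, measurable (A i)) ->
  tuple_measure n [set t | forall i, A i (tnth t i)] = (\prod_(i < n) mu (A i))%E.
Proof.
elim: n A => [|n IH] A mA.
  rewrite big_ord0 /= diracE (_ : _ \in _ = true)//.
  by apply/mem_set => -[].
rewrite big_ord_recl -(IH (fun i => A (lift ord0 i)))//=.
rewrite -product_measure1E//; last first.
  rewrite (_ : mkset _ = \bigcap_(i in [set: 'I_n])
      ((fun t => tnth t i) @^-1` A (lift ord0 i))); last first.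
    by apply/seteqP; split => [t H i _|t H i]; [exact: H|exact: (H i)].
  apply: fin_bigcap_measurable => // i _.
  by rewrite -[X in measurable X]setTI; have := @measurable_tnth _ T n i; apply.
rewrite /tuple_cons_measure /pushforward; congr (_ _).
apply/seteqP; split => [[a t] /= H|[a t] /= [a0 H] i].
  split => /=; first exact: (H ord0).
  by move=> i; have := H (lift ord0 i); rewrite tnthS.
by case: (unliftP ord0 i) => [j ->|->] //; rewrite tnthS.
Qed.
End tuple_measure.

Definition plane_measure (R : realType) : set (R * R) -> \bar R :=
  (@lebesgue_measure R \x @lebesgue_measure R)%E.
HB.instance Definition _ (R : realType) :=
  isMeasure.Build _ _ _ (@plane_measure R)
    (measure0 (@lebesgue_measure R \x @lebesgue_measure R)%E)
    (measure_ge0 (@lebesgue_measure R \x @lebesgue_measure R)%E)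
    (@measure_semi_sigma_additive _ _ _ (@lebesgue_measure R \x @lebesgue_measure R)%E).
HB.instance Definition _ (R : realType) :=
  @Measure_isSigmaFinite.Build _ _ _ (@plane_measure R)
    (product_sigma_finite (@lebesgue_measure R) (@lebesgue_measure R)).

(* The Borel sigma-algebra of C^n. *)
HB.instance Definition _ (R : realType) n :=
  @isMeasurable.Build (sigma_display (@open 'rV[R[i]]_n)) 'rV[R[i]]_n <<s @open 'rV[R[i]]_n >>
  (@sigma_algebra0 _ setT _) (@sigma_algebraC _ _) (@sigma_algebra_bigcup _ setT _).

(* The standard identification (R^2)^n = C^n. *)
Definition complex_coords (R : realType) n (t : n.-tuple (R * R)) : 'rV[R[i]]_n :=
  \row_i ((tnth t i).1 +i* (tnth t i).2).

Section complex_lebesgue.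
Variables (R : realType) (n : nat).
Implicit Types (t : n.-tuple (R * R)).

Definition coord_box t (e : R) := [set s : n.-tuple (R * R) | forall i,
   (`](tnth t i).1 - e, (tnth t i).1 + e[%classic `*`
    `](tnth t i).2 - e, (tnth t i).2 + e[%classic) (tnth s i)].

Lemma measurable_coord_box t e : measurable (coord_box t e).
Proof.
rewrite (_ : coord_box t e = \bigcap_(i in [set: 'I_n]) ((fun s => tnth s i) @^-1`
  (`](tnth t i).1 - e, (tnth t i).1 + e[%classic `*`
    `](tnth t i).2 - e, (tnth t i).2 + e[%classic))); last first.
  by apply/seteqP; split => [s H i _|s H i]; [exact: H|exact: (H i)].
apply: fin_bigcap_measurable => // i _.
rewrite -[X in measurable X]setTI.
have := @measurable_tnth _ (R * R)%type n i; apply => //.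
exact: measurableX.
Qed.

Lemma nbhs_box (U : set 'rV[R[i]]_n) t : open U -> U (complex_coords t) ->
  exists2 e : R, 0 < e & coord_box t e `<=` @complex_coords R n @^-1` U.
Proof.
move=> oU Ut; have /nbhs_ballP[e /= e0 eU] := open_nbhs_nbhs (conj oU Ut).
have eR : e = (complex.Re e)%:C.
  by rewrite RRe_real// ger0_real// ltW.
have e0' : 0 < complex.Re e by rewrite eR ltcR in e0.
exists (complex.Re e / 2); first by rewrite divr_gt0.
move=> s st; apply: eU; split => // i j; rewrite ord1 !mxE.
rewrite /ball/= eR normc_def ltcR.
have /= [] := st j; rewrite !in_itv/= => /andP[a1 a2] /andP[b1 b2].
set x := (tnth t j).1 in a1 a2 *; set x' := (tnth s j).1 in a1 a2 *.
set y := (tnth t j).2 in b1 b2 *; set y' := (tnth s j).2 in b1 b2 *.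
rewrite -(@ger0_norm _ (complex.Re e)) ?ltW// -sqrtr_sqr.
rewrite ltr_sqrt ?exprn_gt0//; nra.
Qed.

Let ratbox (q : n.-tuple (rat * rat)) (k : nat) :=
  coord_box [tuple (ratr (tnth q i).1 : R, ratr (tnth q i).2 : R) | i < n] k.+1%:R^-1.

Let open_preimage_ratbox (U : set 'rV[R[i]]_n) : open U ->
  @complex_coords R n @^-1` U =
  \bigcup_k \bigcup_(q in [set q | ratbox q k `<=` @complex_coords R n @^-1` U])
    ratbox q k.
Proof.
move=> oU; apply/seteqP; split => [t Ut|t [k _ [q + qt]]]; last by apply.
have [e e0 eU] := nbhs_box oU Ut.
have [k] := ltr_add_invr (y := 0) (x := e / 2) ltac:(by rewrite divr_gt0).
rewrite add0r => ke; set d := _^-1 in ke.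
have k0 : 0 < d :> R by rewrite /d invr_gt0.
have dense (x : R) : exists r : rat, `|x - ratr r| < d.
  have lt : x - d < x + d by rewrite ltrBlDr -addrA ltrDl addr_gt0.
  have [r] := @rat_in_itvoo R _ _ lt.
  rewrite in_itv/= => /andP[a b]; exists r; rewrite ltr_norml; lra.
have /choice [qq hq] : forall i, exists r : rat * rat,
  `|(tnth t i).1 - ratr r.1| < d /\ `|(tnth t i).2 - ratr r.2| < d.
  move=> i; have [r hr] := dense (tnth t i).1; have [s hs] := dense (tnth t i).2.
  by exists (r, s).
exists k => //; exists [tuple qq i | i < n] => /=.
  move=> s sb; apply: eU => i; have [] := sb i; rewrite !tnth_mktuple /= !in_itv /= -/d.
  have [] := hq i; rewrite !ltr_norml => /andP[? ?] /andP[? ?] /andP[? ?] /andP[? ?].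
  by split; apply/andP; split; lra.
move=> i; rewrite !tnth_mktuple; have [] := hq i; rewrite !ltr_norml.
by move=> /andP[? ?] /andP[? ?]; split; rewrite /= in_itv /= -/d; apply/andP; split; lra.
Qed.

Lemma measurable_complex_coords : measurable_fun setT (@complex_coords R n).
Proof.
apply: (measurability (@open 'rV[R[i]]_n)) => //.
move=> _ [U oU <-]; rewrite setTI (open_preimage_ratbox oU).
apply: bigcup_measurable => k _.
rewrite bigcup_mkcond; apply: countable_bigcupT_measurable => [|q].
  exact: countableP.
by case: ifP => // _; exact: measurable_coord_box.
Qed.

(* Lebesgue measure of R^(2n), transported to C^n. *)
Definition complex_lebesgue : set 'rV[R[i]]_n -> \bar R :=
  pushforward (tuple_measure (@plane_measure R) n) (@complex_coords R n).

Let m : {measure set 'rV[R[i]]_n -> \bar R} :=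
  measure_function_pushforward__canonical__measure_function_Measure
    (tuple_measure (@plane_measure R) n) measurable_complex_coords.

HB.instance Definition _ :=
  isMeasure.Build _ _ _ complex_lebesgue
    (measure0 m) (measure_ge0 m) (@measure_semi_sigma_additive _ _ _ m).

Lemma complex_lebesgue_open_gt0 (U : set 'rV[R[i]]_n) :
  open U -> U !=set0 -> (0 < complex_lebesgue U)%E.
Proof.
move=> oU [z Uz].
have [t tz] : exists t, complex_coords t = z.
  exists [tuple (complex.Re (z ord0 i), complex.Im (z ord0 i)) | i < n].
  by apply/rowP => i; rewrite mxE tnth_mktuple/=; case: (z ord0 i).
have [e e0 eU] := nbhs_box oU (ltac:(by rewrite tz) : U (complex_coords t)).
apply: (@lt_le_trans _ _ (tuple_measure (@plane_measure R) n (coord_box t e))); last first.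
  apply: le_measure; rewrite ?inE//; first exact: measurable_coord_box.
  rewrite -[X in measurable X]setTI; apply: measurable_complex_coords => //.
  exact: sub_sigma_algebra.
pose A (i : 'I_n) := `](tnth t i).1 - e, (tnth t i).1 + e[%classic `*`
    `](tnth t i).2 - e, (tnth t i).2 + e[%classic.
rewrite [X in (0 < X)%E](_ : _ = (\prod_(i < n) plane_measure (A i))%E); last first.
  by rewrite -tuple_measureE// => i; exact: measurableX.
move: e0 => e0'; apply: (big_ind (fun x => (0 < x)%E)) => //; first by move=> x y x0 y0; exact: mule_gt0.
move=> i _; rewrite /plane_measure/= product_measure1E//=.
rewrite !lebesgue_measure_itv/= !lte_fin !ltrBlDr -!addrA !ltrDl !addr_gt0//.
by rewrite mule_gt0// lte_fin; lra.
Qed.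

End complex_lebesgue.

Definition holomorphic_on (R : realType) (V W : normedModType R[i])
    (U : set V) (f : V -> W) :=
  forall z, U z -> differentiable f z.

Section bergman.
Variables (R : realType) (n : nat).
Local Notation Cn := 'rV[R[i]]_n.

Record domain := Domain {
  domain_set :> set Cn;
  domain_open : open domain_set;
  domain_neq0 : domain_set !=set0;
  domain_connected : connected domain_set }.

Definition square_integrable (U : set Cn) (f : Cn -> R[i]) :=
  [/\ measurable_fun U (fun z => complex.Re (f z)),
      measurable_fun U (fun z => complex.Im (f z)) &
      (\int[@complex_lebesgue R n]_(z in U) (normc (f z) ^+ 2)%:E < +oo)%E].

Definition L2dot (U : set Cn) (f g : Cn -> R[i]) : R[i] :=
  (\int[@complex_lebesgue R n]_(z in U) complex.Re (f z * (g z)^*)) +i*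
  (\int[@complex_lebesgue R n]_(z in U) complex.Im (f z * (g z)^*)).

Definition L2norm (U : set Cn) (f : Cn -> R[i]) : R :=
  Num.sqrt (\int[@complex_lebesgue R n]_(z in U) (normc (f z) ^+ 2)).

Variable Omega : domain.
Local Notation mu := (@complex_lebesgue R n).

(* Functions are total, so an element of A^2(Omega) is represented by its
   extension by zero outside Omega; this makes the representative unique. *)
Definition bergman_set : set (Cn -> R[i]) := [set f |
  [/\ holomorphic_on Omega f, square_integrable Omega f &
      forall z, ~ domain_set Omega z -> f z = 0]].

Definition bergman_pred : {pred Cn -> R[i]} := mem bergman_set.

Lemma domain_measurable : measurable (Omega : set Cn).
Proof. by apply: sub_sigma_algebra; exact: domain_open. Qed.

Lemma measurable_normc (U : set Cn) f : square_integrable U f ->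
  measurable_fun U (fun z => normc (f z)).
Proof.
move=> [mRe mIm _].
rewrite (_ : (fun _ => _) = (fun z => Num.sqrt (complex.Re (f z) ^+ 2 + complex.Im (f z) ^+ 2))).
  apply: (@measurableT_comp _ _ _ _ _ _ (@Num.sqrt R)).
    by apply: continuous_measurable_fun; exact: sqrt_continuous.
  by apply: measurable_funD; apply: measurable_funX.
by apply/funext => z; case: (f z).
Qed.

Lemma sqr_normcE (z : R[i]) : normc z ^+ 2 = complex.Re z ^+ 2 + complex.Im z ^+ 2.
Proof. by case: z => a b; rewrite /= sqr_sqrtr// addr_ge0// sqr_ge0. Qed.

Lemma norm_normc (z : R[i]) : `|z| = (normc z)%:C.
Proof. by case: z => a b; rewrite normc_def. Qed.

Lemma square_integrableD (f g : Cn -> R[i]) : square_integrable Omega f ->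
  square_integrable Omega g -> square_integrable Omega (f + g).
Proof.
move=> If Ig; have mf := measurable_normc If; have mg := measurable_normc Ig.
move: If Ig => [Rf If ff] [Rg Ig fg].
have mR : measurable_fun Omega (fun z => complex.Re ((f + g) z)).
  rewrite (_ : (fun _ => _) = (fun z => complex.Re (f z) + complex.Re (g z))).
    exact: measurable_funD.
  by apply/funext => z; rewrite fctE; case: (f z); case: (g z).
have mI : measurable_fun Omega (fun z => complex.Im ((f + g) z)).
  rewrite (_ : (fun _ => _) = (fun z => complex.Im (f z) + complex.Im (g z))).
    exact: measurable_funD.
  by apply/funext => z; rewrite fctE; case: (f z); case: (g z).
split => //.
have md := domain_measurable.
apply: (@le_lt_trans _ _ (\int[mu]_(z in Omega) (2 * (normc (f z) ^+ 2) + 2 * (normc (g z) ^+ 2))%:E)%E).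
  apply: ge0_le_integral => //=.
  - by move=> z _; rewrite lee_fin sqr_ge0.
  - apply/measurable_EFinP; under eq_fun do rewrite sqr_normcE.
    by apply: measurable_funD; apply: measurable_funX.
  - apply/measurable_EFinP; apply: measurable_funD; apply: measurable_funM => //; exact: measurable_funX.
  - move=> z _; rewrite lee_fin !sqr_normcE fctE.
    case: (f z) => a b; case: (g z) => c d /=.
    have := sqr_ge0 (a - c); have := sqr_ge0 (b - d); nra.
under eq_integral do rewrite EFinD.
rewrite ge0_integralD//=; first last.
  - by apply/measurable_EFinP; apply: measurable_funM => //; exact: measurable_funX.
  - by move=> z _; rewrite lee_fin mulr_ge0// sqr_ge0.
  - by apply/measurable_EFinP; apply: measurable_funM => //; exact: measurable_funX.
  - by move=> z _; rewrite lee_fin mulr_ge0// sqr_ge0.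
under eq_integral do rewrite EFinM.
under [X in (_ + X)%E]eq_integral do rewrite EFinM.
have m2 (h : Cn -> R) : measurable_fun Omega h ->
    measurable_fun Omega (fun z => (h z ^+ 2)%:E).
  by move=> mh; apply/measurable_EFinP; exact: measurable_funX.
have s2 (h : Cn -> R) z : domain_set Omega z -> (0 <= (h z ^+ 2)%:E)%E.
  by move=> _; rewrite lee_fin sqr_ge0.
rewrite (ge0_integralZl mu md (m2 _ mf) (s2 _))//.
rewrite (ge0_integralZl mu md (m2 _ mg) (s2 _))//.
by rewrite lte_add_pinfty// lte_mul_pinfty.
Qed.

Lemma square_integrableZ (a : R[i]) (f : Cn -> R[i]) : square_integrable Omega f ->
  square_integrable Omega (a *: f).
Proof.
move=> If; have mf := measurable_normc If; move: If => [Rf If ff].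
have md := domain_measurable.
split.
- rewrite (_ : (fun _ => _) = (fun z => complex.Re a * complex.Re (f z) - complex.Im a * complex.Im (f z))).
    by apply: measurable_funB; apply: measurable_funM.
  by apply/funext => z; rewrite fctE /GRing.scale/=; case: (f z); case: a.
- rewrite (_ : (fun _ => _) = (fun z => complex.Re a * complex.Im (f z) + complex.Im a * complex.Re (f z))).
    by apply: measurable_funD; apply: measurable_funM.
  by apply/funext => z; rewrite fctE /GRing.scale/=; case: (f z); case: a.
under eq_integral.
  move=> z _; rewrite fctE [a *: _]/(a * f z) normcM exprMn EFinM; over.
rewrite ge0_integralZl//=; first by rewrite lte_mul_pinfty// lee_fin sqr_ge0.
- by apply/measurable_EFinP; exact: measurable_funX.
- by move=> z _; rewrite lee_fin sqr_ge0.
by rewrite lee_fin sqr_ge0.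
Qed.

Lemma bergman_submod_closed : submod_closed bergman_pred.
Proof.
split.
  rewrite inE; split.
  - by move=> z _; exact: (differentiable_cst (0 : R[i])).
  - split; [exact: measurable_cst|exact: measurable_cst|].
    rewrite integral0_eq ?ltry// => z _.
    by rewrite [X in normc X](_ : _ = 0)// normc0 expr0n.
  - by [].
move=> a f g; rewrite !inE => -[hf If f0] [hg Ig g0]; split.
- move=> z Oz; apply: differentiableD; last by exact: hg.
  by apply: differentiableZ; exact: hf.
- by apply: square_integrableD => //; exact: square_integrableZ.
- by move=> z Oz; rewrite !fctE f0// g0// scaler0 addr0.
Qed.

HB.instance Definition _ :=
  GRing.isSubmodClosed.Build _ _ bergman_pred bergman_submod_closed.

Record bergman := Bergman {
  bergman_fun :> Cn -> R[i]; bergmanP : bergman_fun \in bergman_pred }.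

HB.instance Definition _ := [isSub of bergman for bergman_fun].
HB.instance Definition _ := [Choice of bergman by <:].
HB.instance Definition _ := [SubChoice_isSubLmodule of bergman by <:].

Definition bergman_norm (f : bergman) : R[i] := (L2norm Omega f)%:C.

Lemma measurable_normc_bergman (f : bergman) : measurable_fun setT (fun z => normc (f z)).
Proof.
have [_ If f0] := set_mem (bergmanP f).
rewrite (_ : (fun _ => _) = (fun z => normc (f z)) \_ Omega).
  by apply/(measurable_restrictT _ domain_measurable); exact: measurable_normc.
apply/funext => z; rewrite patchE; case: ifPn => // /negP zO.
by rewrite f0 ?normc0// => Oz; apply: zO; rewrite inE.
Qed.

Lemma bergman_norm_Lnorm (f : bergman) :
  Lnorm mu 2%:E (EFin \o (fun z => normc (f z))) = (L2norm Omega f)%:E.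
Proof.
have [_ [_ _ fin] f0] := set_mem (bergmanP f).
rewrite unlock /Lnorm.
rewrite (_ : (\int[mu]_x _)%E = (\int[mu]_(z in Omega) (normc (f z) ^+ 2)%:E)%E).
  rewrite /L2norm /Rintegral -powR12_sqrt; last first.
    by apply/fine_ge0/integral_ge0 => z _; rewrite lee_fin sqr_ge0.
  rewrite -poweR_EFin fineK// ge0_fin_numE//.
  by apply/integral_ge0 => z _; rewrite lee_fin sqr_ge0.
rewrite [RHS]integral_mkcond; apply: eq_integral => z _.
rewrite patchE; case: ifPn => zO /=.
  by rewrite powR_mulrn// ger0_norm// ; case: (f z) => ? ? /=; rewrite sqrtr_ge0.
rewrite f0; last by move=> Oz; move: zO; rewrite mem_set.
by rewrite normc0 normr0 powR0.
Qed.

Lemma bergman_normD (f g : bergman) : bergman_norm (f + g) <= bergman_norm f + bergman_norm g.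
Proof.
rewrite /bergman_norm -rmorphD lecR -lee_fin EFinD -!bergman_norm_Lnorm.
apply: (le_trans _ (minkowski_EFin mu (measurable_normc_bergman f) (measurable_normc_bergman g) (ler1n _ 2))).
rewrite unlock /Lnorm; apply: gt0_ler_poweR => //.
- by rewrite in_itv/= leey andbT integral_ge0// => z _; rewrite lee_fin powR_ge0.
- by rewrite in_itv/= leey andbT integral_ge0// => z _; rewrite lee_fin powR_ge0.
have c0 (x : R[i]) : 0 <= normc x by case: x => a b; rewrite /= sqrtr_ge0.
have mpow : measurable_fun setT (fun x : R => `|x| `^ 2).
  by apply: (@measurableT_comp _ _ _ _ _ _ (@powR R ^~ 2)) => //; exact: measurable_powR.
apply: ge0_le_integral => //=.
- apply/measurable_EFinP.
  exact: (measurableT_comp mpow (measurable_normc_bergman (f + g))).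
- apply/measurable_EFinP.
  exact: (measurableT_comp mpow (measurable_funD (measurable_normc_bergman f) (measurable_normc_bergman g))).
move=> z _; rewrite lee_fin ge0_ler_powR// ?nnegrE// !ger0_norm ?addr_ge0//.
exact: le_normcD.
Qed.

Lemma bergman_normZ (a : R[i]) (f : bergman) : bergman_norm (a *: f) = `|a| * bergman_norm f.
Proof.
rewrite /bergman_norm normc_def -rmorphM; congr (_%:C).
rewrite /L2norm -sqrtrM ?addr_ge0 ?sqr_ge0// -sqr_normcE; congr Num.sqrt.
have [_ If f0] := set_mem (bergmanP f).
rewrite /Rintegral -[normc a ^+ 2]/(fine (normc a ^+ 2)%:E) -fineM//; last first.
  case: If => _ _ fin; rewrite ge0_fin_numE// integral_ge0// => z _.
  by rewrite lee_fin sqr_ge0.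
congr fine; rewrite -ge0_integralZl//=.
- by apply: eq_integral => z _; rewrite [X in normc X](_ : _ = a * f z)// normcM exprMn.
- exact: domain_measurable.
- by apply/measurable_EFinP; apply: measurable_funX; exact: measurable_normc.
- by move=> z _; rewrite lee_fin sqr_ge0.
- by rewrite lee_fin sqr_ge0.
Qed.

Lemma bergman_norm0 (f : bergman) : bergman_norm f = 0 -> f = 0.
Proof.
have [hf [mR mI fin] f0] := set_mem (bergmanP f).
move=> /(congr1 (@complex.Re R))/= nf.
have int0 : (\int[mu]_(z in Omega) (normc (f z) ^+ 2)%:E = 0)%E.
  have i0 : (0 <= \int[mu]_(z in Omega) (normc (f z) ^+ 2)%:E)%E.
    by rewrite integral_ge0// => z _; rewrite lee_fin sqr_ge0.
  rewrite -[LHS]fineK ?ge0_fin_numE//; congr EFin.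
  apply/eqP; rewrite eq_le fine_ge0// andbT -sqrtr_eq0; exact/eqP.
apply/val_inj/funext => z; apply: contrapT => /eqP; rewrite [val 0 z](_ : _ = 0)// => fz0.
have Oz : domain_set Omega z by apply: contrapT => /f0 fz; move/eqP: fz0; apply.
have cont : forall z, domain_set Omega z -> {for z, continuous (f : Cn -> R[i])}.
  by move=> w Ow; apply: differentiable_continuous; exact: hf.
pose e := normc (f z) / 2.
have nfz0 : 0 < normc (f z) by rewrite -ltcR -[X in _ < X]norm_normc normr_gt0.
have e0 : 0 < e by rewrite divr_gt0.
have : nbhs z [set w | domain_set Omega w /\ `|f w| > e%:C].
  apply: filterI; first by apply: open_nbhs_nbhs; split=> //; exact: domain_open.
  have := @cvgr_norm_gt _ _ _ _ _ _ _ (cont _ Oz); apply.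
  by rewrite norm_normc ltcR /e ltr_pdivrMr// ltr_pMr// ltr1n.
rewrite nbhsE => -[U [oU Uz] UO].
have mU : measurable U by exact: sub_sigma_algebra.
have : ((e ^+ 2)%:E * mu U <= 0)%E.
  rewrite -int0 -integral_cst//.
  apply: (@le_trans _ _ (\int[mu]_(z in U) (normc (f z) ^+ 2)%:E)%E).
    apply: ge0_le_integral => //=.
    - by move=> w _; rewrite lee_fin sqr_ge0.
    - apply/measurable_EFinP; apply: measurable_funX.
      by apply: measurable_funTS; exact: measurable_normc_bergman.
    move=> w /UO[_]; rewrite norm_normc ltcR => fw.
    by rewrite lee_fin ler_pXn2r// ?nnegrE ltW// (lt_trans e0).
  apply: ge0_subset_integral => //.
  - exact: domain_measurable.
  - by apply/measurable_EFinP; apply: measurable_funX; exact: measurable_normc.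
  - by move=> w _; rewrite lee_fin sqr_ge0.
  - by move=> w /UO[].
apply/negP; rewrite -ltNge mule_gt0// ?lte_fin ?exprn_gt0//.
by apply: complex_lebesgue_open_gt0 => //; exists z.
Qed.

HB.instance Definition _ :=
  Lmodule_isNormed.Build R[i] bergman bergman_normD bergman_normZ bergman_norm0.

(* Orthogonal projection of L^2(Omega) onto A^2(Omega): for square integrable
   [g], the unique [h] in A^2(Omega) such that [g - h] is orthogonal to
   A^2(Omega). Since A^2(Omega) is closed in L^2(Omega) such an [h] exists, and
   the default value of [xget] is not used. *)
Definition bergman_proj (g : Cn -> R[i]) : bergman :=
  xget (0 : bergman) [set h : bergman | forall k : bergman,
    L2dot Omega (fun z => g z - bergman_fun h z) (bergman_fun k) = 0].

Definition toeplitz (psi : Cn -> R[i]) (f : bergman) : bergman :=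
  bergman_proj (fun z => psi z * bergman_fun f z).

End bergman.

Section essential_norm.
Variables (R : realType) (X Y : normedModType R[i]).

(* Norms in a normed [R[i]]-module are nonnegative real elements of [R[i]],
   hence the real parts. *)
Definition operator_norm (T : X -> Y) : \bar R :=
  ereal_sup [set (complex.Re `|T x|)%:E | x in [set x : X | `|x| <= 1]].

Definition compact_operator (S : {linear X -> Y}) : Prop :=
  precompact (S @` [set x : X | `|x| <= 1]).

Definition essential_norm (T : X -> Y) : \bar R :=
  ereal_inf [set operator_norm (fun x => T x - S x) |
    S in [set S : {linear X -> Y} | compact_operator S]].

End essential_norm.

Section boundary.
Variables (R : realType) (n : nat).
Local Notation Cn := 'rV[R[i]]_n.

Definition boundary (A : set Cn) : set Cn := closure A `\` A°.

Definition unit_disk : set R[i] := [set z | `|z| < 1].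

Definition has_analytic_disk (X : set Cn) : Prop :=
  exists f : R[i] -> Cn,
    [/\ holomorphic_on unit_disk f,
        exists z w, [/\ unit_disk z, unit_disk w & f z <> f w] &
        f @` unit_disk `<=` X].

(* Derivative of [rho] at [p] in the direction [v], C^n being regarded as a real
   vector space. *)
Definition real_derive (v : Cn) (rho : Cn -> R) (p : Cn) : R :=
  derive1 (fun t : R => rho (p + t%:C *: v)) 0.

(* C^infinity on an open set: all iterated directional derivatives exist and are
   continuous. *)
Definition smooth_on (U : set Cn) (rho : Cn -> R) : Prop :=
  forall (vs : seq Cn) (p : Cn), U p ->
    let g := foldr real_derive rho vs in
    {for p, continuous g} /\
    forall v, derivable (fun t : R => g (p + t%:C *: v)) 0 1.

(* Near each boundary point, [A] is the sublevel set of a smooth function with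
   nonvanishing gradient. *)
Definition has_smooth_boundary (A : set Cn) : Prop :=
  forall p, boundary A p -> exists (U : set Cn) (rho : Cn -> R),
    [/\ open U, U p, smooth_on U rho,
        forall q, U q -> exists v, real_derive v rho q <> 0 &
        forall q, U q -> (A q <-> rho q < 0)].

Definition sup_norm (X : set Cn) (psi : Cn -> R[i]) : \bar R :=
  ereal_sup [set (normc (psi z))%:E | z in X].

End boundary.

(* Main.v *)
(** Upper bound: cut [psi] as [psi1 + psi2], where [psi1] is supported on the
    compact set [K] of points of [Omega] at which [|psi|] is at least [M + e/2],
    [M] bounding [|psi|] on the boundary. By the mean value inequality, point
    evaluations are bounded and equicontinuous on [K], so projecting onto the span
    of finitely many evaluation functionals makes [T_psi1] norm-close to a finite
    rank operator, while [T_psi2] has norm at most [M + e/2].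

    Lower bound: if [q] is a closest point of the closure to an exterior point,
    with supporting functional [l], then the face [Re l = 0] is convex and lies
    in the boundary. Since it contains no complex disk, it is totally real: in
    suitable linear coordinates its points have real coordinates [c_j], so
    [Q = \sum_j c_j ^ 2] is a holomorphic polynomial which is positive on the
    face except at [q]. By compactness, [1 + t (N l - Q)], for [N] large and [t]
    small, has modulus at most some [r < 1] on the closure away from [q] and is
    [1] at [q]. Its normalized powers concentrate their mass at [q]: they make
    [<T_psi f, f>] tend to [psi q] and [<S f, f>] to [0] for compact [S].
    Such points [q] are dense in the boundary. *)

Require Import Defs.
From HB Require Import structures.
From mathcomp Require Import all_boot all_order all_algebra.
From mathcomp Require Import all_classical all_reals all_analysis.
From mathcomp Require Import measurable_realfun complex ring lra.
Set Implicit Arguments. Unset Strict Implicit. Unset Printing Implicit Defensive.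
Import Order.TTheory GRing.Theory Num.Theory.
Import numFieldNormedType.Exports.
Import ComplexField.Normc.
Local Open Scope classical_set_scope.
Local Open Scope complex_scope.
Local Open Scope ring_scope.

(** * Cauchy's integral formula and estimates on complex lines *)

(** Holomorphy is given only as complex differentiability at each point, with no continuity of the
    derivative, so the analysis starts from Goursat's bisection argument. Contours are boundaries of
    rectangles: their sides are intervals carrying Lebesgue measure, and Tonelli's theorem can
    choose them well. Several variables enter through restriction to complex lines and through
    products of planar bounds; no constant has to be sharp. Completeness of the Bergman space comes
    before any statement on [toeplitz]: without it the set that defines [bergman_proj] could be
    empty and the default value [0] would be returned. Weak convergence is never formulated. For
    compact [S] the image of the unit ball has a finite net; each of its members has little mass
    near the boundary point [q], the test function has little mass elsewhere, and splitting the
    inner product into these two regions makes it small. The function raised to powers may have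
    modulus above 1 close to [q]: only its growth at [q] relative to its size away from [q]
    matters. *)

Section complex_basics.
Variable R : realType.
Implicit Types z w : R[i].
Local Notation Re := complex.Re.
Local Notation Im := complex.Im.

Lemma cReD z w : Re (z + w) = Re z + Re w. Proof. by case: z; case: w. Qed.
Lemma cImD z w : Im (z + w) = Im z + Im w. Proof. by case: z; case: w. Qed.
Lemma cReN z : Re (- z) = - Re z. Proof. by case: z. Qed.
Lemma cImN z : Im (- z) = - Im z. Proof. by case: z. Qed.
Lemma cReB z w : Re (z - w) = Re z - Re w. Proof. by rewrite cReD cReN. Qed.
Lemma cImB z w : Im (z - w) = Im z - Im w. Proof. by rewrite cImD cImN. Qed.
Lemma cReM z w : Re (z * w) = Re z * Re w - Im z * Im w.
Proof. by case: z; case: w. Qed.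
Lemma cImM z w : Im (z * w) = Re z * Im w + Im z * Re w.
Proof. by case: z; case: w. Qed.
Lemma complexReIm z : z = Re z +i* Im z. Proof. by case: z. Qed.

Lemma normc_ge0 z : 0 <= normc z. Proof. by case: z => a b; exact: sqrtr_ge0. Qed.
Lemma normc_real (x : R) : normc x%:C = `|x|.
Proof. by rewrite /= expr0n addr0 sqrtr_sqr. Qed.
Lemma normcB z w : normc (z - w) = normc (w - z).
Proof. by rewrite -normcN opprB. Qed.
Lemma normc_conj z : normc z^* = normc z.
Proof. by case: z => a b /=; rewrite sqrrN. Qed.
Lemma le_normcB z w : normc z - normc w <= normc (z - w).
Proof. by rewrite lerBlDr -{1}(subrK w z) le_normcD. Qed.
Lemma Re_le_normc z : `|Re z| <= normc z.
Proof. by case: z => a b /=; rewrite -sqrtr_sqr ler_wsqrtr// lerDl sqr_ge0. Qed.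
Lemma Im_le_normc z : `|Im z| <= normc z.
Proof. by case: z => a b /=; rewrite -sqrtr_sqr ler_wsqrtr// lerDr sqr_ge0. Qed.
Lemma normc_le_ReIm z : normc z <= `|Re z| + `|Im z|.
Proof.
rewrite (_ : normc z = normc ((Re z)%:C + 'i * (Im z)%:C)); last first.
  by rewrite [in LHS](complexE z).
apply: (le_trans (le_normcD _ _)).
by rewrite normcM !normc_real /= expr0n expr1n add0r sqrtr1 mul1r.
Qed.
Lemma normc_eq0 z : (normc z == 0) = (z == 0).
Proof. by apply/eqP/eqP => [/eq0_normc//|->]; rewrite normc0. Qed.
Lemma normc_gt0 z : (0 < normc z) = (z != 0).
Proof. by rewrite lt_def normc_eq0 normc_ge0 andbT. Qed.

Lemma conj_normc z : z * z^* = (normc z ^+ 2)%:C.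
Proof. by rewrite -sqr_normc norm_normc -rmorphXn. Qed.

(** A ball of [R[i]] has its radius in [R[i]], but a positive element there is real. Passing to the
    real radius [Re e] lets all later estimates be made in [R]. *)
Lemma nbhs_normcP z (A : set R[i]) :
  nbhs z A <-> exists2 d : R, 0 < d & forall w, normc (w - z) < d -> A w.
Proof.
split=> [/nbhs_ballP[e /= e0 eA]|[d d0 dA]].
  have eE : e = (Re e)%:C by rewrite RRe_real// ger0_real// ltW.
  exists (Re e); first by rewrite -ltcR -eE.
  by move=> w wz; apply: eA; rewrite /ball/= eE norm_normc ltcR normcB.
apply/nbhs_ballP; exists d%:C => /=; first by rewrite ltcR.
by move=> w; rewrite /ball/= norm_normc ltcR normcB; exact: dA.
Qed.

(** The difference quotient is multiplied out, so that [w = z] needs no exception and the error can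
    be bounded directly along a contour. *)
Definition complex_derivative (g : R[i] -> R[i]) (z a : R[i]) :=
  forall e : R, 0 < e -> exists2 d : R, 0 < d & forall w, normc (w - z) < d ->
    normc (g w - g z - a * (w - z)) <= e * normc (w - z).

Definition complex_derivable g z := exists a, complex_derivative g z a.

Lemma differentiable_complex_derivative (g : R[i] -> R[i]) z :
  differentiable g z -> complex_derivative g z ('d g z 1).
Proof.
move=> /diff_locallyP[_ /eqaddoP dg] e e0.
have eC : 0 < e%:C by rewrite ltcR.
have /nbhs_normcP[d d0 dP] := dg _ eC.
exists d => // w wz; have := dP (w - z); rewrite subr0 => /(_ wz).
rewrite !fctE /= subrK !norm_normc -rmorphM/= lecR; congr (normc _ <= _).
have -> : 'd g z (w - z) = 'd g z 1 * (w - z).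
  by rewrite -[X in 'd g z X]mulr1 [LHS]linearZ_LR mulrC.
by rewrite opprD addrA.
Qed.

Lemma differentiable_complex_line (V : normedModType R[i]) (f : V -> R[i]) (x v : V) z :
  differentiable f (x + z *: v) -> differentiable (fun w : R[i] => f (x + w *: v)) z.
Proof.
by move=> df; apply: (@differentiable_comp _ _ _ _ (fun w : R[i] => x + w *: v) f).
Qed.

Lemma differentiable_inv (f : R[i] -> R[i]) z : differentiable f z -> f z != 0 ->
  differentiable (fun w => (f w)^-1) z.
Proof. by move=> df fz; apply: differentiableV. Qed.

Lemma differentiable_mul (f g : R[i] -> R[i]) z : differentiable f z -> differentiable g z ->
  differentiable (fun w => f w * g w) z.
Proof. by move=> df dg; exact: differentiableM. Qed.

End complex_basics.

(** * Integrals of complex-valued functions over an interval *)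

Section complex_integral.
Variable R : realType.
Local Notation Re := complex.Re.
Local Notation Im := complex.Im.
Local Notation leb := (@lebesgue_measure R).
Implicit Types (h k : R -> R[i]) (a b c : R).

Definition continuous_on_itv h a b :=
  {within `[a, b], continuous (fun x => Re (h x))} /\
  {within `[a, b], continuous (fun x => Im (h x))}.

Definition cint a b h : R[i] :=
  (\int[leb]_(x in `[a, b]) Re (h x)) +i* (\int[leb]_(x in `[a, b]) Im (h x)).

Lemma continuous_on_itvW h a b :
  (forall x, a <= x <= b -> forall e : R, 0 < e -> exists2 d : R, 0 < d &
     forall y, a <= y <= b -> `|y - x| < d -> normc (h y - h x) < e) ->
  continuous_on_itv h a b.
Proof.
have W (f : R -> R) : (forall x, a <= x <= b -> forall e : R, 0 < e -> exists2 d : R, 0 < d &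
      forall y, a <= y <= b -> `|y - x| < d -> `|f y - f x| < e) ->
    {within `[a, b], continuous f}.
  move=> fc; apply/subspace_continuousP => x; rewrite /= in_itv/= => xab.
  apply/cvgrPdist_lt => e e0; have [d d0 fd] := fc x xab e e0.
  rewrite near_withinE; apply/nbhs_ballP; exists d => //= y; rewrite /ball/= => xy.
  by rewrite in_itv/= => yab; rewrite distrC; apply: fd => //; rewrite distrC.
move=> hc; split; apply: W => x xab e e0; have [d d0 hd] := hc x xab e e0; exists d => // y yab yx.
  by rewrite -cReB (le_lt_trans (Re_le_normc _))//; exact: hd.
by rewrite -cImB (le_lt_trans (Im_le_normc _))//; exact: hd.
Qed.

Lemma continuous_itv_integrable (f : R -> R) a b :
  {within `[a, b], continuous f} -> leb.-integrable `[a, b] (EFin \o f).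
Proof. by move=> cf; apply: continuous_compact_integrable => //; exact: segment_compact. Qed.

Lemma cintD h k a b : continuous_on_itv h a b -> continuous_on_itv k a b ->
  cint a b (fun x => h x + k x) = cint a b h + cint a b k.
Proof.
move=> [h1 h2] [k1 k2]; rewrite /cint.
under eq_Rintegral do rewrite cReD.
under [in X in _ +i* X]eq_Rintegral do rewrite cImD.
by rewrite !RintegralD//; exact: continuous_itv_integrable.
Qed.

Lemma cintZ (u : R[i]) h a b : continuous_on_itv h a b ->
  cint a b (fun x => u * h x) = u * cint a b h.
Proof.
move=> [h1 h2]; rewrite /cint.
have i1 := continuous_itv_integrable h1; have i2 := continuous_itv_integrable h2.
have iZ (f : R -> R) r : leb.-integrable `[a, b] (EFin \o f) ->
    leb.-integrable `[a, b] (EFin \o (fun x => r * f x)).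
  by move=> fi; rewrite (_ : EFin \o _ = (fun x => r%:E * (EFin \o f) x)%E)//; exact: integrableZl.
under eq_Rintegral do rewrite cReM.
under [in X in _ +i* X]eq_Rintegral do rewrite cImM.
rewrite RintegralB ?RintegralD ?RintegralZl//; try exact: iZ.
by rewrite [RHS]complexReIm cReM cImM.
Qed.

Lemma cint_split h a b c : a <= c -> c <= b -> continuous_on_itv h a b ->
  cint a b h = cint a c h + cint c b h.
Proof.
move=> ac cb [h1 h2].
have S (f : R -> R) : {within `[a, b], continuous f} ->
    \int[leb]_(x in `[a, b]) f x = \int[leb]_(x in `[a, c]) f x + \int[leb]_(x in `[c, b]) f x.
  move=> cf; have fi := continuous_itv_integrable cf.
  rewrite -[LHS](subrK (\int[leb]_(x in `[a, c]) f x)) addrC; congr (_ + _).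
  rewrite Rintegral_itvB ?bnd_simp//.
  rewrite Rintegral_itv_obnd_cbnd//; apply: integrableS fi => //.
  by apply: subset_itv; rewrite bnd_simp.
by rewrite /cint !S.
Qed.

(** The factor 2 comes from bounding the modulus of the integral by the sum of its real and
    imaginary parts. The right-hand side is an extended real integral, to be compared with the
    slices that Tonelli's theorem provides. *)
Lemma normc_cint_le_integral h (phi : R -> R) a b (K : R) : continuous_on_itv h a b ->
  0 <= K -> measurable_fun `[a, b] phi ->
  (forall x, a <= x <= b -> 0 <= phi x /\ normc (h x) <= K * phi x) ->
  ((normc (cint a b h))%:E <= (2 * K)%:E * \int[leb]_(x in `[a, b]) (phi x)%:E)%E.
Proof.
move=> [h1 h2] K0 mphi hphi.
have S (f : R -> R) : {within `[a, b], continuous f} ->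
    (forall x, a <= x <= b -> `|f x| <= K * phi x) ->
    (`|\int[leb]_(x in `[a, b]) f x|%:E <= K%:E * \int[leb]_(x in `[a, b]) (phi x)%:E)%E.
  move=> cf fM; have fi := continuous_itv_integrable cf.
  rewrite EFin_normr_Rintegral//.
  have mf : measurable_fun `[a, b] (EFin \o f) by case/integrableP: fi.
  apply: le_trans; first by apply: (le_abse_integral leb _ mf); exact: measurable_itv.
  rewrite -ge0_integralZl//; first last.
  - by move=> x; rewrite /= in_itv/= lee_fin => /hphi[].
  - exact/measurable_EFinP.
  apply: ge0_le_integral => //.
  - exact: measurableT_comp.
  - by apply: measurable_funeM; exact/measurable_EFinP.
have A := S _ h1 (fun x xab => le_trans (Re_le_normc _) (hphi x xab).2).
have B := S _ h2 (fun x xab => le_trans (Im_le_normc _) (hphi x xab).2).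
apply: (@le_trans _ _ (`|Re (cint a b h)|%:E + `|Im (cint a b h)|%:E)%E).
  by rewrite -EFinD lee_fin normc_le_ReIm.
apply: (le_trans (leeD A B)).
by rewrite EFinM -muleA mule_natl mule2n.
Qed.

Lemma normc_cint_le h a b (M : R) : a <= b -> continuous_on_itv h a b ->
  (forall x, a <= x <= b -> normc (h x) <= M) ->
  normc (cint a b h) <= 2 * M * (b - a).
Proof.
move=> ab [h1 h2] hM; apply: (le_trans (normc_le_ReIm _)) => /=.
have S (f : R -> R) : {within `[a, b], continuous f} ->
    (forall x, a <= x <= b -> `|f x| <= M) ->
    `|\int[leb]_(x in `[a, b]) f x| <= M * (b - a).
  move=> cf fM; have fi := continuous_itv_integrable cf.
  apply: (le_trans (le_normr_Rintegral _ fi)) => //.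
  apply: (@le_trans _ _ (\int[leb]_(x in `[a, b]) M)); last first.
    rewrite Rintegral_cst//= lebesgue_measure_itv/= lte_fin.
    by case: ltP => [_|ba]//=; rewrite (@le_anti _ _ a b) ?ab// subrr.
  apply: le_Rintegral => //.
  - exact: (integrable_norm fi).
  - by apply: continuous_itv_integrable; apply: continuous_subspaceT => x; exact: cvg_cst.
have A := S _ h1 (fun x xab => le_trans (Re_le_normc _) (hM x xab)).
have B := S _ h2 (fun x xab => le_trans (Im_le_normc _) (hM x xab)).
by rewrite -mulrA mulr_natl mulr2n lerD.
Qed.

End complex_integral.

(** * Compactness by bisection of rectangles *)

Section bisection.
Variable R : realType.

Lemma halving_lt (C e : R) : 0 < e -> exists k : nat, C / 2 ^+ k < e.
Proof.
move=> e0; exists (Num.truncn (`|C| / e)).+1.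
rewrite ltr_pdivrMr ?exprn_gt0// -ltr_pdivrMl//.
apply: (@le_lt_trans _ _ (`|C| / e)); first by rewrite mulrC ler_wpM2r ?ler_norm// invr_ge0 ltW.
have := truncnS_gt (`|C| / e) => /lt_trans; apply.
by rewrite -natrX ltr_nat ltn_expl.
Qed.


(** A failure of [P] descends from a rectangle to one of its quarters. The resulting nested
    rectangles shrink to a point, where the local hypothesis gives a contradiction. *)
Lemma rectangle_bisection (P : R -> R -> R -> R -> Prop) (a0 b0 c0 d0 : R) :
  a0 <= b0 -> c0 <= d0 ->
  (forall a b c d, a0 <= a -> a <= b -> b <= b0 -> c0 <= c -> c <= d -> d <= d0 ->
    let m := (a + b) / 2 in let n := (c + d) / 2 in
    P a m c n -> P m b c n -> P a m n d -> P m b n d -> P a b c d) ->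
  (forall x y, a0 <= x <= b0 -> c0 <= y <= d0 -> exists2 e : R, 0 < e &
    forall a b c d, a0 <= a -> a <= x <= b -> b <= b0 -> c0 <= c -> c <= y <= d -> d <= d0 ->
      b - a < e -> d - c < e -> P a b c d) ->
  P a0 b0 c0 d0.
Proof.
move=> ab0 cd0 her loc; apply: contrapT => nP.
pose bad (q : R * R * (R * R)) :=
  [/\ a0 <= q.1.1, q.1.1 <= q.1.2, q.1.2 <= b0 & c0 <= q.2.1] /\
  [/\ q.2.1 <= q.2.2, q.2.2 <= d0 & ~ P q.1.1 q.1.2 q.2.1 q.2.2].
pose sub (q q' : R * R * (R * R)) :=
  [/\ q.1.1 <= q'.1.1, q'.1.2 <= q.1.2, q.2.1 <= q'.2.1 & q'.2.2 <= q.2.2] /\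
  [/\ q'.1.2 - q'.1.1 = (q.1.2 - q.1.1) / 2 & q'.2.2 - q'.2.1 = (q.2.2 - q.2.1) / 2].
have /choice[nxt hn] : forall q, exists q', bad q -> bad q' /\ sub q q'.
  move=> [[a b] [c d]]; have [bq|nb] := pselect (bad ((a, b), (c, d))); last by exists ((a, b), (c, d)).
  have [[/= aa ab bb cc] [cd dd nPq]] := bq.
  pose m := (a + b) / 2; pose n := (c + d) / 2.
  have [am mb] : a <= m /\ m <= b by rewrite /m; split; lra.
  have [cn nd] : c <= n /\ n <= d by rewrite /n; split; lra.
  have [m1 m2] : m - a = (b - a) / 2 /\ b - m = (b - a) / 2 by rewrite /m; split; field.
  have [n1 n2] : n - c = (d - c) / 2 /\ d - n = (d - c) / 2 by rewrite /n; split; field.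
  have [am' mb'] : a0 <= m /\ m <= b0 by split; [exact: le_trans am|exact: le_trans bb].
  have [cn' nd'] : c0 <= n /\ n <= d0 by split; [exact: le_trans cn|exact: le_trans dd].
  have [h|] := pselect (P a m c n); last first.
    by move=> h; exists ((a, m), (c, n)) => _; split; split; split.
  have [h'|] := pselect (P m b c n); last first.
    by move=> ?; exists ((m, b), (c, n)) => _; split; split; split.
  have [h''|] := pselect (P a m n d); last first.
    by move=> ?; exists ((a, m), (n, d)) => _; split; split; split.
  have [h'''|] := pselect (P m b n d); last first.
    by move=> ?; exists ((m, b), (n, d)) => _; split; split; split.
  by exfalso; apply: nPq; apply: her.
pose Q k := iter k nxt ((a0, b0), (c0, d0)).
have badQ k : bad (Q k).
  by elim: k => [|k IH]; [split; split|have [] := hn _ IH].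
have subQ k : sub (Q k) (Q k.+1) by have [] := hn _ (badQ k).
have mono k j : [/\ (Q k).1.1 <= (Q (k + j)%N).1.1, (Q (k + j)%N).1.2 <= (Q k).1.2,
    (Q k).2.1 <= (Q (k + j)%N).2.1 & (Q (k + j)%N).2.2 <= (Q k).2.2].
  elim: j => [|j [i1 i2 i3 i4]]; first by rewrite addn0; split.
  rewrite addnS; have [[s1 s2 s3 s4] _] := subQ (k + j)%N; split.
  - exact: le_trans s1.
  - exact: le_trans i2.
  - exact: le_trans s3.
  - exact: le_trans i4.
have sz k : (Q k).1.2 - (Q k).1.1 = (b0 - a0) / 2 ^+ k /\ (Q k).2.2 - (Q k).2.1 = (d0 - c0) / 2 ^+ k.
  elim: k => [|k [i1 i2]]; first by rewrite !expr0 !divr1.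
  have [_ [-> ->]] := subQ k; rewrite i1 i2 exprSr invfM !mulrA; split=> //.
have cross k j : (Q k).1.1 <= (Q j).1.2 /\ (Q k).2.1 <= (Q j).2.2.
  have [[_ b1 _ _] [b2 _ _]] := badQ (k + j)%N.
  have [m1 _ m3 _] := mono k j; have [_ m2 _ m4] := mono j k; rewrite addnC in m2 m4.
  by split; [apply: le_trans m1 _; apply: le_trans m2|apply: le_trans m3 _; apply: le_trans m4].
(* By [cross] every left end is below every right end, so these suprema give a point common to all
   the rectangles. *)
pose x := sup (range (fun k => (Q k).1.1)); pose y := sup (range (fun k => (Q k).2.1)).
have xin k : (Q k).1.1 <= x <= (Q k).1.2.
  apply/andP; split.
    apply: ub_le_sup; last by exists k.
    by exists (Q 0).1.2 => _ [j _ <-]; have [] := cross j 0.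
  by apply: ge_sup; [exists (Q 0).1.1; exists 0|move=> _ [j _ <-]; have [] := cross j k].
have yin k : (Q k).2.1 <= y <= (Q k).2.2.
  apply/andP; split.
    apply: ub_le_sup; last by exists k.
    by exists (Q 0).2.2 => _ [j _ <-]; have [] := cross j 0.
  by apply: ge_sup; [exists (Q 0).2.1; exists 0|move=> _ [j _ <-]; have [] := cross j k].
have [e e0 he] := loc x y (xin 0) (yin 0).
have [k hk] := halving_lt (Num.max (b0 - a0) (d0 - c0)) e0.
have k2 : 0 < (2 ^+ k)^-1 :> R by rewrite invr_gt0 exprn_gt0.
have [[b1 b2 b3 b4] [b5 b6 b7]] := badQ k; have [s1 s2] := sz k.
apply: b7; apply: he => //.
  by rewrite s1 (le_lt_trans _ hk)// ler_pM2r// le_max lexx.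
by rewrite s2 (le_lt_trans _ hk)// ler_pM2r// le_max lexx orbT.
Qed.

End bisection.

(** * Contour integrals over rectangles and Goursat's theorem *)

Section rectangle_integral.
Variable R : realType.
Local Notation Re := complex.Re.
Local Notation Im := complex.Im.
Implicit Types (f g : R[i] -> R[i]) (a b c d : R).

Definition rect a b c d := [set z : R[i] | a <= Re z <= b /\ c <= Im z <= d].

Lemma rect_sub a b c d a' b' c' d' z : a <= a' -> b' <= b -> c <= c' -> d' <= d ->
  rect a' b' c' d' z -> rect a b c d z.
Proof.
move=> h1 h2 h3 h4 [/andP[z1 z2] /andP[z3 z4]]; split; apply/andP; split.
- exact: le_trans z1.
- exact: le_trans h2.
- exact: le_trans z3.
- exact: le_trans h4.
Qed.


(* Counterclockwise integral along the boundary of the rectangle. *)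
Definition rint a b c d g : R[i] :=
  cint a b (fun x => g (x +i* c)) - cint a b (fun x => g (x +i* d)) +
  'i * (cint c d (fun y => g (b +i* y)) - cint c d (fun y => g (a +i* y))).

Lemma continuous_normcP g z : {for z, continuous g} <->
  forall e : R, 0 < e -> exists2 d : R, 0 < d & forall w, normc (w - z) < d -> normc (g w - g z) < e.
Proof.
split=> [gc e e0|gc A /nbhs_normcP[e e0 eA]].
  have /gc/nbhs_normcP[d d0 dP] : nbhs (g z) [set w | normc (w - g z) < e].
    by apply/nbhs_normcP; exists e.
  by exists d.
have [d d0 dP] := gc e e0.
by apply/nbhs_normcP; exists d => // w /dP wz; exact: eA.
Qed.

Lemma continuous_hline g a b c : (forall x, a <= x <= b -> {for x +i* c, continuous g}) ->
  continuous_on_itv (fun x => g (x +i* c)) a b.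
Proof.
move=> gc; apply: continuous_on_itvW => x xab e e0.
have /continuous_normcP/(_ _ e0)[d d0 dP] := gc _ xab.
exists d => // y yab yx; apply: dP.
by rewrite (_ : _ - _ = (y - x)%:C) ?normc_real//; apply/eqP; rewrite eq_complex /= subrr !eqxx.
Qed.

Lemma continuous_vline g a c d : (forall y, c <= y <= d -> {for a +i* y, continuous g}) ->
  continuous_on_itv (fun y => g (a +i* y)) c d.
Proof.
move=> gc; apply: continuous_on_itvW => x xab e e0.
have /continuous_normcP/(_ _ e0)[r r0 dP] := gc _ xab.
exists r => // y yab yx; apply: dP.
by rewrite (_ : _ - _ = 0 +i* (y - x)) /= ?expr0n ?add0r ?sqrtr_sqr//; apply/eqP; rewrite eq_complex /= subrr !eqxx.
Qed.

Definition continuous_frame g a b c d :=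
  [/\ continuous_on_itv (fun x => g (x +i* c)) a b, continuous_on_itv (fun x => g (x +i* d)) a b,
      continuous_on_itv (fun y => g (b +i* y)) c d & continuous_on_itv (fun y => g (a +i* y)) c d].

Lemma continuous_frameW g a b c d : a <= b -> c <= d ->
  (forall z, rect a b c d z -> {for z, continuous g}) -> continuous_frame g a b c d.
Proof.
by move=> ab cd gc; split; [apply: continuous_hline|apply: continuous_hline|
  apply: continuous_vline|apply: continuous_vline] => x xab; apply: gc;
  split => //=; rewrite ?lexx ?ab ?cd.
Qed.

Lemma rintD f g a b c d : continuous_frame f a b c d -> continuous_frame g a b c d ->
  rint a b c d (fun z => f z + g z) = rint a b c d f + rint a b c d g.
Proof. by move=> [? ? ? ?] [? ? ? ?]; rewrite /rint !cintD//; ring. Qed.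

Lemma rintZ u g a b c d : continuous_frame g a b c d ->
  rint a b c d (fun z => u * g z) = u * rint a b c d g.
Proof. by move=> [? ? ? ?]; rewrite /rint !cintZ//; ring. Qed.

(** The integral along the cut occurs with both signs and cancels as a number. Additivity is used on
    the two horizontal sides only, where continuity is assumed. *)
Lemma rint_hsplit g a b c d m : a <= m <= b -> c <= d ->
  (forall z, rect a b c d z -> Im z = c \/ Im z = d -> {for z, continuous g}) ->
  rint a b c d g = rint a m c d g + rint m b c d g.
Proof.
move=> /andP[am mb] cd gc; rewrite /rint.
rewrite (cint_split am mb); last first.
  by apply: continuous_hline => x xab; apply: gc; [split=> //=; rewrite lexx|left].
rewrite [cint a b _](cint_split am mb); last first.
  by apply: continuous_hline => x xab; apply: gc; [split=> //=; rewrite lexx cd|right].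
by ring.
Qed.

Lemma rint_vsplit g a b c d m : a <= b -> c <= m <= d ->
  (forall z, rect a b c d z -> Re z = a \/ Re z = b -> {for z, continuous g}) ->
  rint a b c d g = rint a b c m g + rint a b m d g.
Proof.
move=> ab /andP[cm md] gc; rewrite /rint.
rewrite [cint c d (fun y => g (b +i* y))](cint_split cm md); last first.
  by apply: continuous_vline => x xab; apply: gc; [split=> //=; rewrite lexx ab|right].
rewrite [cint c d _](cint_split cm md); last first.
  by apply: continuous_vline => x xab; apply: gc; [split=> //=; rewrite lexx ab|left].
by ring.
Qed.

Lemma normc_i : normc ('i : R[i]) = 1.
Proof. by rewrite /= expr0n expr1n add0r sqrtr1. Qed.

(** The constant 4 is the factor 2 of [normc_cint_le] times another 2, because [(b - a) + (d - c)]
    is half the perimeter. *)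
Lemma normc_rint_le g a b c d (M : R) : a <= b -> c <= d -> continuous_frame g a b c d ->
  (forall z, rect a b c d z -> [|| Re z == a, Re z == b, Im z == c | Im z == d] -> normc (g z) <= M) ->
  normc (rint a b c d g) <= 4 * M * ((b - a) + (d - c)).
Proof.
move=> ab cd [c1 c2 c3 c4] gM.
have M1 : normc (cint a b (fun x => g (x +i* c))) <= 2 * M * (b - a).
  by apply: normc_cint_le => // x xab; apply: gM; [split=> //=; rewrite lexx|rewrite /= eqxx !orbT].
have M2 : normc (cint a b (fun x => g (x +i* d))) <= 2 * M * (b - a).
  by apply: normc_cint_le => // x xab; apply: gM; [split=> //=; rewrite lexx cd|rewrite /= eqxx !orbT].
have M3 : normc (cint c d (fun y => g (b +i* y))) <= 2 * M * (d - c).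
  by apply: normc_cint_le => // x xab; apply: gM; [split=> //=; rewrite lexx ab|rewrite /= eqxx !orbT].
have M4 : normc (cint c d (fun y => g (a +i* y))) <= 2 * M * (d - c).
  by apply: normc_cint_le => // x xab; apply: gM; [split=> //=; rewrite lexx ab|rewrite /= eqxx].
rewrite /rint; apply: (le_trans (le_normcD _ _)); rewrite normcM normc_i mul1r.
apply: (@le_trans _ _ ((2 * M * (b - a) + 2 * M * (b - a)) + (2 * M * (d - c) + 2 * M * (d - c)))).
  by apply: lerD; apply: (le_trans (le_normcD _ _)); rewrite normcN lerD.
by rewrite le_eqVlt; apply/orP; left; apply/eqP; ring.
Qed.

Lemma cint_cst u a b : a <= b -> cint a b (fun=> u) = u * (b - a)%:C.
Proof.
move=> ab; rewrite /cint !Rintegral_cst//= lebesgue_measure_itv/= lte_fin.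
rewrite [RHS]complexReIm cReM cImM /= mulr0 subr0 mulr0 add0r.
by case: ltP => [_|ba]//=; rewrite (@le_anti _ _ a b) ?ab// subrr.
Qed.

(** The integrand differs by [v * 'i * (c - d)] between the horizontal sides and by [v * (b - a)]
    between the vertical ones; multiplied by the lengths [b - a] and [d - c], and by ['i] in the
    second case, these contributions cancel. *)
Lemma rint_affine u v a b c d : a <= b -> c <= d -> rint a b c d (fun z => u + v * z) = 0.
Proof.
move=> ab cd; rewrite /rint.
have cont (h : R -> R[i]) p q : (exists s t : R[i], h = fun x => s + t * x%:C) -> continuous_on_itv h p q.
  move=> [s [t ->]]; apply: continuous_on_itvW => x xpq e e0.
  exists (e / (normc t + 1)) => [|y ypq yx]; first by rewrite divr_gt0// ltr_wpDl// normc_ge0.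
  rewrite (_ : _ - _ = t * (y - x)%:C); last by rewrite rmorphB/=; ring.
  rewrite normcM normc_real (@le_lt_trans _ _ ((normc t + 1) * `|y - x|))//.
    by rewrite ler_wpM2r// lerDl.
  by rewrite -ltr_pdivlMl 1?mulrC// ltr_wpDl// normc_ge0.
have cont1 (p q : R) : continuous_on_itv (fun x : R => x%:C) p q.
  by apply: cont; exists 0, 1; apply/funext => x; rewrite add0r mul1r.
have contc (s : R[i]) (p q : R) : continuous_on_itv (fun=> s) p q.
  by apply: cont; exists s, 0; apply/funext => x; rewrite mul0r addr0.
have contv (s : R[i]) (p q : R) : continuous_on_itv (fun x : R => s * x%:C) p q.
  by apply: cont; exists 0, s; apply/funext => x; rewrite add0r.
have H (y : R) : cint a b (fun x => u + v * (x +i* y)) = (u + v * (0 +i* y)) * (b - a)%:C + v * cint a b (fun x : R => x%:C).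
  rewrite (_ : (fun _ => _) = (fun x => (u + v * (0 +i* y)) + v * x%:C)).
    by rewrite cintD// cintZ// cint_cst.
  apply/funext => x; rewrite -addrA -mulrDr; congr (_ + _ * _).
  by apply/eqP; rewrite eq_complex/= add0r addr0 !eqxx.
have V (x : R) : cint c d (fun y => u + v * (x +i* y)) = (u + v * x%:C) * (d - c)%:C + v * 'i * cint c d (fun x : R => x%:C).
  rewrite (_ : (fun _ => _) = (fun y => (u + v * x%:C) + v * 'i * y%:C)).
    by rewrite cintD// cintZ// cint_cst.
  apply/funext => y; rewrite -addrA -mulrA -mulrDr; congr (_ + _ * _).
  by rewrite -(complexE (x +i* y)).
rewrite !H !V.
have E y : 0 +i* y = 'i * y%:C :> R[i] by apply/eqP; rewrite eq_complex/= !mul0r !mul1r subrr add0r !eqxx.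
by rewrite !E !rmorphB/=; ring.
Qed.

(** The bound proved by bisection is quadratic in half the perimeter: each quarter has a quarter of
    it, so the four quarters add up exactly. Near a point the affine part of [g] integrates to zero,
    and the remainder is a small multiple of the size of the rectangle, on a contour of that same
    size. *)
Theorem goursat g a b c d : a <= b -> c <= d ->
  (forall z, rect a b c d z -> differentiable g z) -> rint a b c d g = 0.
Proof.
move=> ab cd dg.
have cg z : rect a b c d z -> {for z, continuous g}.
  by move=> /dg; exact: differentiable_continuous.
have sub a' b' c' d' z : a <= a' -> b' <= b -> c <= c' -> d' <= d -> rect a' b' c' d' z -> rect a b c d z.
  move=> aa bb cc dd [/andP[h1 h2] /andP[h3 h4]]; split; apply/andP; split.
  - exact: le_trans h1.
  - exact: le_trans bb.
  - exact: le_trans h3.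
  - exact: le_trans dd.
suff S (e : R) : 0 < e -> normc (rint a b c d g) <= e * ((b - a) + (d - c)) ^+ 2.
  apply/eqP; rewrite -normc_eq0 eq_le normc_ge0 andbT; apply/ler_addgt0Pr => e e0; rewrite add0r.
  pose L := ((b - a) + (d - c)) ^+ 2 + 1.
  have L0 : 0 < L by rewrite ltr_wpDl// sqr_ge0.
  have := S (e / L) (divr_gt0 e0 L0); move/le_trans; apply.
  by rewrite mulrAC ler_pdivrMr// ler_wpM2l ?(ltW e0)// lerDl.
move=> e0.
apply: (@rectangle_bisection R (fun a b c d => normc (rint a b c d g) <= e * ((b - a) + (d - c)) ^+ 2) a b c d) => //.
  move=> a' b' c' d' aa ab' bb cc cd' dd m n.
  have [am mb] : a' <= m <= b' /\ c' <= n <= d' by rewrite /m /n; split; lra.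
  move=> P1 P2 P3 P4.
  have cg' z : rect a' b' c' d' z -> {for z, continuous g} by move=> /(sub _ _ _ _ _ aa bb cc dd)/cg.
  rewrite (rint_hsplit am)//; last by move=> z + _; exact: cg'.
  move/andP: am => [am1 am2]; move/andP: (mb) => [mb1 mb2].
  rewrite (@rint_vsplit _ a' m c' d' n)//; last first.
    by move=> z + _ => zr; apply: cg'; case: zr => /andP[z1 z2] zz; split=> //; rewrite z1 (le_trans z2).
  rewrite (@rint_vsplit _ m b' c' d' n)//; last first.
    by move=> z + _ => zr; apply: cg'; case: zr => /andP[z1 z2] zz; split=> //; rewrite z2 (le_trans _ z1).
  have T (x y z t : R[i]) : normc (x + y + (z + t)) <= normc x + normc y + (normc z + normc t).
    by apply: (le_trans (le_normcD _ _)); apply: lerD; exact: le_normcD.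
  apply: (le_trans (T _ _ _ _)).
  apply: (le_trans (lerD (lerD P1 P3) (lerD P2 P4))).
  by rewrite le_eqVlt; apply/orP; left; apply/eqP; rewrite /m /n; field.
move=> x y xab ycd.
have zr : rect a b c d (x +i* y) by [].
have [u dz] : complex_derivable g (x +i* y).
  by eexists; exact: (differentiable_complex_derivative (dg _ zr)).
(* The divisor 4 absorbs the constant of [normc_rint_le]. *)
have e4 : 0 < e / 4 by rewrite divr_gt0.
have [r r0 hr] := dz _ e4.
exists (r / 2) => [|a' b' c' d' aa xab' bb cc ycd' dd bar dcr]; first by rewrite divr_gt0.
have [ab' cd'] : a' <= b' /\ c' <= d' by split; lra.
pose E z := g z - (g (x +i* y) + u * (z - (x +i* y))).
have gE : g = (fun z => E z + ((g (x +i* y) - u * (x +i* y)) + u * z)).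
  by apply/funext => z; rewrite /E; ring.
have ca z : {for z, continuous (fun z : R[i] => (g (x +i* y) - u * (x +i* y)) + u * z)}.
  by apply: differentiable_continuous; apply: differentiableD => //; exact: (differentiable_mul (differentiable_cst u z) _).
have cE z : rect a' b' c' d' z -> {for z, continuous E}.
  move=> zr'; have -> : E = (fun z => g z - ((g (x +i* y) - u * (x +i* y)) + u * z)).
    by apply/funext => w; rewrite /E; ring.
  by apply: continuousB; [exact/cg/(sub _ _ _ _ _ aa bb cc dd)|exact: ca].
rewrite gE rintD//; [|exact: continuous_frameW|exact: (continuous_frameW _ _ (fun z _ => ca z))].
rewrite rint_affine// addr0.
apply: (@le_trans _ _ (4 * (e / 4 * ((b' - a') + (d' - c'))) * ((b' - a') + (d' - c')))); last first.
  by rewrite le_eqVlt; apply/orP; left; apply/eqP; field.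
apply: normc_rint_le => //; first exact: continuous_frameW.
move=> z [/andP[z1 z2] /andP[z3 z4]] _.
have nz : normc (z - (x +i* y)) <= (b' - a') + (d' - c').
  apply: (le_trans (normc_le_ReIm _)); rewrite cReB cImB /=.
  by apply: lerD; rewrite ler_norml; lra.
rewrite /E opprD addrA (le_trans (hr _ _))//; first by rewrite (le_lt_trans nz)//; lra.
by rewrite ler_wpM2l// ltW.
Qed.

End rectangle_integral.

(** * Cauchy's formula for rectangles *)

Section cauchy_formula.
Variable R : realType.
Local Notation Re := complex.Re.
Local Notation Im := complex.Im.
Local Notation leb := (@lebesgue_measure R).
Implicit Types (f g h : R[i] -> R[i]) (a b c d t x y : R).

Lemma continuous_frame_bd g a b c d : a <= b -> c <= d ->
  (forall z, rect a b c d z -> [|| Re z == a, Re z == b, Im z == c | Im z == d] ->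
    {for z, continuous g}) -> continuous_frame g a b c d.
Proof.
by move=> ab cd gc; split; [apply: continuous_hline|apply: continuous_hline|
  apply: continuous_vline|apply: continuous_vline] => x xab; apply: gc;
  (try by split => //=; rewrite ?lexx ?ab ?cd); rewrite /= eqxx ?orbT.
Qed.

(** This is [2 * pi] times the Poisson kernel of the half-plane. It appears as the difference of the
    Cauchy kernel between opposite sides of the square of half-width [t] about the pole, up to a
    factor ['i] for the horizontal sides. *)
Let poisson x t (s : R) := 2 * t / ((s - x) ^+ 2 + t ^+ 2).

Let poisson_continuous x t : 0 < t -> continuous (poisson x t).
Proof.
move=> t0 s; apply: cvgM; first exact: cvg_cst.
apply: cvgV.
  by rewrite gt_eqF// ltr_wpDl ?sqr_ge0// exprn_gt0.
apply: cvgD; last exact: cvg_cst.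
by rewrite expr2 -[X in X @ _]/(fun s => (s - x) * (s - x)); apply: cvgM; apply: cvgB => //; exact: cvg_cst.
Qed.

(** The primitive [2 * atan ((s - x) / t)] runs from [- pi / 2] to [pi / 2], since the quotient is
    -1 and 1 at the ends. *)
Let Rintegral_poisson x t : 0 < t ->
  \int[leb]_(s in `[x - t, x + t]) poisson x t s = pi.
Proof.
move=> t0.
pose F (s : R) := 2 * atan ((s - x) / t).
have dF (s : R) : is_derive s (1 : R) F (poisson x t s).
  rewrite /F; apply: is_derive_eq.
  rewrite /poisson /GRing.scale/=.
  have n0 : (s - x) ^+ 2 + t ^+ 2 != 0 by rewrite gt_eqF// ltr_wpDl ?sqr_ge0// exprn_gt0.
  by field; rewrite n0 gt_eqF.
rewrite /Rintegral (@continuous_FTC2 _ _ F); first last.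
- by move=> s _; rewrite derive1E derive_val.
- split.
  + by move=> s _; apply: ex_derive.
  + apply: cvg_at_right_filter; apply: differentiable_continuous; apply/derivable1_diffP; exact: ex_derive.
  + apply: cvg_at_left_filter; apply: differentiable_continuous; apply/derivable1_diffP; exact: ex_derive.
- apply: continuous_subspaceT; exact: poisson_continuous.
- by rewrite ltrBlDr -addrA ltrDl addr_gt0.
rewrite /= /F (_ : (x + t - x) / t = 1); last by field; rewrite gt_eqF.
rewrite (_ : (x - t - x) / t = - 1); last by field; rewrite gt_eqF.
by rewrite atanN atan1; field.
Qed.

Let cint_real (phi : R -> R) a b : cint a b (fun s => (phi s)%:C) = (\int[leb]_(s in `[a, b]) phi s)%:C.
Proof.
rewrite /cint/=; congr (_ +i* _).
by rewrite /Rintegral integral0_eq.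
Qed.

Lemma cintB (h k : R -> R[i]) a b : continuous_on_itv h a b -> continuous_on_itv k a b ->
  cint a b h - cint a b k = cint a b (fun s => h s - k s).
Proof.
move=> [h1 h2] [k1 k2]; rewrite /cint.
under [in RHS]eq_Rintegral do rewrite cReB.
under [in X in _ = _ +i* X]eq_Rintegral do rewrite cImB.
by rewrite !RintegralB//; exact: continuous_itv_integrable.
Qed.

Lemma continuous_kernel (z w : R[i]) : w != z -> {for w, continuous (fun z' => (z' - z)^-1)}.
Proof.
move=> wz; apply: differentiable_continuous; apply: differentiable_inv; last by rewrite subr_eq0.
exact: differentiableB.
Qed.

Let square_frame_neq x y t (w : R[i]) : 0 < t ->
  [|| Re w == x - t, Re w == x + t, Im w == y - t | Im w == y + t] -> w != x +i* y.
Proof.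
move=> t0; have L (u : R) : u - t < u /\ u < u + t by rewrite ltrBlDr !ltrDl.
have [x1 x2] := L x; have [y1 y2] := L y.
apply: contraTneq => -> /=.
by rewrite (gt_eqF x1) (lt_eqF x2) (gt_eqF y1) (lt_eqF y2).
Qed.

Lemma rint_kernel_square x y t : 0 < t ->
  rint (x - t) (x + t) (y - t) (y + t) (fun w => (w - (x +i* y))^-1) = 'i * (2 * pi)%:C.
Proof.
move=> t0.
have xt : x - t <= x + t by rewrite lerBlDr -addrA lerDl addr_ge0 ?ltW.
have yt : y - t <= y + t by rewrite lerBlDr -addrA lerDl addr_ge0 ?ltW.
have [c1 c2 c3 c4] : continuous_frame (fun w => (w - (x +i* y))^-1) (x - t) (x + t) (y - t) (y + t).
  apply: continuous_frame_bd => // z _ zb; apply: continuous_kernel.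
  exact: square_frame_neq zb.
rewrite /rint cintB// cintB//.
have n0 s : s ^+ 2 + t ^+ 2 != 0 by rewrite gt_eqF// ltr_wpDl ?sqr_ge0// exprn_gt0.
have n0' s : t ^+ 2 + s ^+ 2 != 0 by rewrite addrC.
have E1 s : ((s +i* (y - t)) - (x +i* y))^-1 - ((s +i* (y + t)) - (x +i* y))^-1 = 'i * (poisson x t s)%:C.
  apply/eqP; rewrite eq_complex/= /poisson; apply/andP; split; apply/eqP;
    rewrite !(addrC y) !addrK ?sqrrN; field; exact: n0.
have E2 s : (((x + t) +i* s) - (x +i* y))^-1 - (((x - t) +i* s) - (x +i* y))^-1 = (poisson y t s)%:C.
  apply/eqP; rewrite eq_complex/= /poisson; apply/andP; split; apply/eqP;
    rewrite !(addrC x) !addrK ?sqrrN; field; rewrite ?n0 ?n0'//.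
under [in X in cint _ _ X]eq_fun do rewrite E1.
under [in X in _ + 'i * cint _ _ X]eq_fun do rewrite E2.
have cp u v : continuous_on_itv (fun s => (poisson u t s)%:C) (v - t) (v + t).
  split; first by apply: continuous_subspaceT; exact: poisson_continuous.
  by apply: continuous_subspaceT => w; exact: cvg_cst.
rewrite cintZ// !cint_real !Rintegral_poisson//.
by rewrite -mulrDr -rmorphD/= mulr_natl mulr2n.
Qed.

(** Four cuts along the sides of the square split off four rectangles that avoid the pole, and
    Goursat's theorem makes their integrals vanish. *)
Lemma rint_shrink h a b c d x y t : 0 < t -> a <= x - t -> x + t <= b -> c <= y - t -> y + t <= d ->
  (forall z, rect a b c d z -> z != x +i* y -> differentiable h z) ->
  rint a b c d h = rint (x - t) (x + t) (y - t) (y + t) h.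
Proof.
move=> t0 ax xb cy yd dh.
have xt : x - t < x + t by rewrite ltrBlDr -addrA ltrDl addr_gt0.
have yt : y - t < y + t by rewrite ltrBlDr -addrA ltrDl addr_gt0.
have [xt1 xt2] : x - t < x /\ x < x + t by rewrite ltrBlDr !ltrDl.
have [yt1 yt2] : y - t < y /\ y < y + t by rewrite ltrBlDr !ltrDl.
have ch z : rect a b c d z -> z != x +i* y -> {for z, continuous h}.
  by move=> zr zn; apply: differentiable_continuous; exact: dh.
have NE z : (complex.Im z != y) || (complex.Re z != x) -> z != x +i* y.
  by move=> H; apply: contraTneq H => ->; rewrite /= !eqxx.
have [axt xtb] : a <= x + t /\ x - t <= b.
  by split; [exact: le_trans ax (ltW xt)|exact: le_trans (ltW xt) xb].
have [cyt ytd] : c <= y + t /\ y - t <= d.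
  by split; [exact: le_trans cy (ltW yt)|exact: le_trans (ltW yt) yd].
have cd : c <= d by exact: le_trans cyt yd.
have n1 : c != y by rewrite lt_eqF// (le_lt_trans cy).
have n2 : d != y by rewrite gt_eqF// (lt_le_trans yt2).
have n3 : x - t != x by rewrite lt_eqF.
have n4 : x + t != x by rewrite gt_eqF.
have Z a' b' c' d' : a <= a' -> a' <= b' -> b' <= b -> c <= c' -> c' <= d' -> d' <= d ->
    (forall z, rect a' b' c' d' z -> z != x +i* y) -> rint a' b' c' d' h = 0.
  move=> h1 h2 h3 h4 h5 h6 N; apply: goursat h2 h5 _ => z zr.
  exact: dh (rect_sub h1 h3 h4 h6 zr) (N z zr).
have xx : a <= x - t <= b by rewrite ax.
rewrite (rint_hsplit xx cd); last first.
  move=> z zr zi; apply: (ch _ zr); apply: NE.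
  by case: zi => ->; rewrite ?n1 ?n2.
rewrite (Z a (x - t) c d (lexx a) ax xtb (lexx c) cd (lexx d)) ?add0r; last first.
  move=> z [/andP[_ z1] _]; apply: NE; apply/orP; right.
  by rewrite lt_eqF// (le_lt_trans z1).
have xx' : x - t <= x + t <= b by rewrite (ltW xt).
rewrite (rint_hsplit xx' cd); last first.
  move=> z zr zi; apply: (ch _ (rect_sub ax (lexx b) (lexx c) (lexx d) zr)); apply: NE.
  by case: zi => ->; rewrite ?n1 ?n2.
rewrite [X in _ + X](Z (x + t) b c d axt xb (lexx b) (lexx c) cd (lexx d)) ?addr0; last first.
  move=> z [/andP[z1 _] _]; apply: NE; apply/orP; right.
  by rewrite gt_eqF// (lt_le_trans xt2).
have yy : c <= y - t <= d by rewrite cy.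
rewrite (rint_vsplit (ltW xt) yy); last first.
  move=> z zr zi; apply: (ch _ (rect_sub ax xb (lexx c) (lexx d) zr)); apply: NE.
  by case: zi => ->; rewrite ?n3 ?n4 orbT.
rewrite (Z (x - t) (x + t) c (y - t) ax (ltW xt) xb (lexx c) cy ytd) ?add0r; last first.
  move=> z [_ /andP[_ z1]]; apply: NE; apply/orP; left.
  by rewrite lt_eqF// (le_lt_trans z1).
have yy' : y - t <= y + t <= d by rewrite (ltW yt).
rewrite (rint_vsplit (ltW xt) yy'); last first.
  move=> z zr zi; apply: (ch _ (rect_sub ax xb cy (lexx d) zr)); apply: NE.
  by case: zi => ->; rewrite ?n3 ?n4 orbT.
rewrite [X in _ + X](Z (x - t) (x + t) (y + t) d ax (ltW xt) xb cyt yd (lexx d)) ?addr0//.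
move=> z [_ /andP[z1 _]]; apply: NE; apply/orP; left.
by rewrite gt_eqF// (lt_le_trans yt2).
Qed.

Theorem cauchy_formula g a b c d z : a < Re z < b -> c < Im z < d ->
  (forall w, rect a b c d w -> differentiable g w) ->
  rint a b c d (fun w => g w * (w - z)^-1) = g z * ('i * (2 * pi)%:C).
Proof.
case: z => x y /= /andP[ax xb] /andP[cy yd] dg; set z := x +i* y.
have zr : rect a b c d z by split => /=; lra.
have dk w : w != z -> differentiable (fun w => (w - z)^-1) w.
  move=> wz; apply: differentiable_inv; last by rewrite subr_eq0.
  exact: differentiableB.
pose k w := (g w - g z) * (w - z)^-1.
have ddk w : rect a b c d w -> w != z -> differentiable k w.
  move=> wr wz; apply: differentiable_mul; last exact: dk.
  by apply: differentiableB => //; exact: dg.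
have fr w : rect a b c d w -> [|| Re w == a, Re w == b, Im w == c | Im w == d] -> w != z.
  by move=> _; apply: contraTneq => -> /=; rewrite (gt_eqF ax) (lt_eqF xb) (gt_eqF cy) (lt_eqF yd).
have ab : a <= b by lra.
have cd : c <= d by lra.
have rk0 : rint a b c d k = 0.
  have [u du] : complex_derivable g z by eexists; exact: differentiable_complex_derivative (dg z zr).
  have [r r0 hr] := du 1 ltr01.
  apply/eqP; rewrite -normc_eq0 eq_le normc_ge0 andbT; apply/ler_addgt0Pr => e e0; rewrite add0r.
  pose M := normc u + 1.
  have M0 : 0 < M by rewrite ltr_wpDl// normc_ge0.
  (* [t < r / 2] keeps the square inside the ball where [M] bounds [k]; [16 * M * t] is [4 * M]
     times [4 * t], half the perimeter of the square. *)
  have : exists2 t, 0 < t & [/\ t <= x - a, t <= b - x, t <= y - c, t <= d - y & t < r / 2 /\ 16 * M * t <= e].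
    exists (Num.min (Num.min (Num.min (x - a) (b - x)) (Num.min (y - c) (d - y))) (Num.min (r / 4) (e / (16 * M)))).
      by rewrite !lt_min !subr_gt0 ax xb cy yd !divr_gt0// mulr_gt0.
    set t := Num.min _ _.
    have : t <= t by [].
    rewrite {2}/t !le_min => /andP[/andP[/andP[-> ->] /andP[-> ->]] /andP[t1 t2]]; split => //; split.
      by apply: (le_lt_trans t1); lra.
    by rewrite mulrC -ler_pdivlMr// mulr_gt0.
  move=> [t t0 [t1 t2 t3 t4 [t5 t6]]].
  have T1 : a <= x - t by rewrite lerBrDl -lerBrDr.
  have T2 : x + t <= b by rewrite -lerBrDl.
  have T3 : c <= y - t by rewrite lerBrDl -lerBrDr.
  have T4 : y + t <= d by rewrite -lerBrDl.
  rewrite (rint_shrink t0 T1 T2 T3 T4 ddk).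
  have fr' w : [|| Re w == x - t, Re w == x + t, Im w == y - t | Im w == y + t] -> w != z.
    exact: square_frame_neq.
  have sub w : rect (x - t) (x + t) (y - t) (y + t) w -> rect a b c d w.
    exact: rect_sub T1 T2 T3 T4.
  apply: le_trans t6.
  rewrite (_ : 16 * M * t = 4 * M * ((x + t - (x - t)) + (y + t - (y - t)))); last by ring.
  apply: normc_rint_le; [lra|lra| |].
    apply: continuous_frame_bd; [lra|lra|move=> w wr wb].
    by apply: differentiable_continuous; apply: ddk; [exact: sub|exact: fr'].
  move=> w wr wb; have wz := fr' _ wb.
  have wz0 : 0 < normc (w - z) by rewrite normc_gt0 subr_eq0.
  rewrite /k normcM normcV ler_pdivrMr//.
  have := hr w; rewrite mul1r => hw.
  rewrite -[g w - g z](subrK (u * (w - z))) (le_trans (le_normcD _ _))//.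
  rewrite /M mulrDl mul1r addrC normcM lerD// hw//.
  apply: (le_lt_trans (normc_le_ReIm _)); rewrite cReB cImB /=.
  by case: wr => /andP[w1 w2] /andP[w3 w4]; rewrite (splitr r); clear -w1 w2 w3 w4 t5;
    apply: ltr_leD; rewrite ?ltr_norml ?ler_norml; lra.
have -> : (fun w => g w * (w - z)^-1) = (fun w => k w + g z * (w - z)^-1).
  by apply/funext => w; rewrite /k mulrBl subrK.
have fk : continuous_frame (fun w => (w - z)^-1) a b c d.
  by apply: (continuous_frame_bd ab cd) => w wr /(fr _ wr); exact: continuous_kernel.
rewrite rintD; last 2 first.
- by apply: (continuous_frame_bd ab cd) => w wr wb; apply: differentiable_continuous; apply: ddk => //; exact: fr wb.
- apply: (continuous_frame_bd ab cd) => w wr wb; apply: differentiable_continuous.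
  apply: differentiable_mul; last by apply: dk; exact: fr wb.
  exact: differentiable_cst.
rewrite rk0 add0r rintZ//; congr (_ * _).
pose t := Num.min (Num.min (x - a) (b - x)) (Num.min (y - c) (d - y)).
have t0 : 0 < t by rewrite !lt_min !subr_gt0 ax xb cy yd.
have : t <= t by [].
rewrite {2}/t !le_min => /andP[/andP[t1 t2] /andP[t3 t4]].
have T1 : a <= x - t by lra.
have T2 : x + t <= b by lra.
have T3 : c <= y - t by lra.
have T4 : y + t <= d by lra.
rewrite (rint_shrink t0 T1 T2 T3 T4 (fun w _ => dk w)).
exact: (rint_kernel_square x y t0).
Qed.

End cauchy_formula.

(** * Cauchy estimates on a square *)

Section cauchy_estimates.
Variable R : realType.
Local Notation Re := complex.Re.
Local Notation Im := complex.Im.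
Implicit Types (g : R[i] -> R[i]) (s M : R).

Let kappa : R[i] := 'i * (2 * pi)%:C.

Lemma normc_kappa_ge1 : 1 <= normc kappa.
Proof.
rewrite normcM normc_i mul1r normc_real ger0_norm ?mulr_ge0 ?pi_ge0//.
by have := @pi_ge2 R; lra.
Qed.

Lemma kappa_neq0 : kappa != 0.
Proof. by rewrite -normc_gt0 (lt_le_trans _ normc_kappa_ge1). Qed.

Let normc_divk u : normc (u / kappa) <= normc u.
Proof.
rewrite normcM normcV ler_pdivrMr ?(lt_le_trans _ normc_kappa_ge1)//.
by rewrite ler_peMr ?normc_ge0// normc_kappa_ge1.
Qed.

Let square_frame_ge s (w : R[i]) : 0 < s ->
  [|| Re w == - s, Re w == s, Im w == - s | Im w == s] -> s <= normc w.
Proof.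
move=> s0 /or4P[] /eqP E.
- by have := Re_le_normc w; rewrite E normrN gtr0_norm.
- by have := Re_le_normc w; rewrite E gtr0_norm.
- by have := Im_le_normc w; rewrite E normrN gtr0_norm.
- by have := Im_le_normc w; rewrite E gtr0_norm.
Qed.

(** The three estimates come from the kernels [1 / w ^ 2], [z / (w * (w - z))] and
    [z ^ 2 / (w ^ 2 * (w - z))], with [|w| >= s] and [|w - z| >= s / 2] on the contour. [A] is the
    derivative at 0; this is not recorded here, since it follows from the last estimate. *)
Lemma cauchy_estimates g s M : 0 < s ->
  (forall w, rect (- s) s (- s) s w -> differentiable g w) ->
  (forall w, rect (- s) s (- s) s w -> normc (g w) <= M) ->
  exists A, [/\ normc A <= 16 * M / s,
    forall z, normc z <= s / 2 -> normc (g z - g 0) <= 32 * M * normc z / s &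
    forall z, normc z <= s / 2 -> normc (g z - g 0 - A * z) <= 32 * M * normc z ^+ 2 / s ^+ 2].
Proof.
move=> s0 dg gM.
have ss : - s <= s by lra.
have M0 : 0 <= M.
  by apply: le_trans (normc_ge0 (g 0)) _; apply: gM; split; rewrite /= oppr_le0 ltW.
have s20 : 0 < s / 2 by rewrite divr_gt0.
have fr (q : R[i] -> R[i]) : (forall w, s <= normc w -> differentiable q w) ->
    continuous_frame (fun w => g w * q w) (- s) s (- s) s.
  move=> dq; apply: continuous_frame_bd => // w wr wb; apply: differentiable_continuous.
  by apply: differentiable_mul; [exact: dg|apply: dq; exact: square_frame_ge wb].
have bd (q : R[i] -> R[i]) (K : R) : (forall w, s <= normc w -> differentiable q w) ->
    (forall w, s <= normc w -> normc (q w) <= K) ->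
    normc (rint (- s) s (- s) s (fun w => g w * q w) / kappa) <= 16 * M * K * s.
  move=> dq qK; apply: le_trans (normc_divk _) _.
  rewrite (_ : 16 * M * K * s = 4 * (M * K) * ((s - - s) + (s - - s))); last by ring.
  apply: normc_rint_le => //; first exact: fr.
  move=> w wr wb; rewrite normcM ler_pM ?normc_ge0//; first exact: gM.
  by apply: qK; exact: square_frame_ge wb.
have far (z w : R[i]) : normc z <= s / 2 -> s <= normc w -> s / 2 <= normc (w - z).
  by move=> zs sw; apply: le_trans (le_normcB _ _); lra.
have n0 (w : R[i]) : 0 < normc w -> w != 0 by rewrite normc_gt0.
have dk (z w : R[i]) : normc z <= s / 2 -> s <= normc w -> differentiable (fun w => (w - z)^-1) w.
  move=> zs sw; apply: differentiable_inv; last by apply: n0; apply: lt_le_trans (far _ _ zs sw).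
  exact: differentiableB.
have G z : normc z <= s / 2 -> g z = rint (- s) s (- s) s (fun w => g w * (w - z)^-1) / kappa.
  move=> zs; rewrite (@cauchy_formula _ g) ?mulfK ?kappa_neq0//.
  - have := le_trans (Re_le_normc z) zs; rewrite ler_norml; lra.
  - have := le_trans (Im_le_normc z) zs; rewrite ler_norml; lra.
have z00 : normc (0 : R[i]) <= s / 2 by rewrite normc0 ltW.
have dif (q1 q2 : R[i] -> R[i]) :
    (forall w, s <= normc w -> differentiable q1 w) ->
    (forall w, s <= normc w -> differentiable q2 w) ->
    rint (- s) s (- s) s (fun w => g w * q1 w) / kappa - rint (- s) s (- s) s (fun w => g w * q2 w) / kappa =
    rint (- s) s (- s) s (fun w => g w * (q1 w - q2 w)) / kappa.
  move=> d1 d2; rewrite -mulrBl; congr (_ / _).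
  rewrite -[- rint _ _ _ _ _]mulN1r -rintZ; last exact: fr.
  have E : (fun w => -1 * (g w * q2 w)) = (fun w => g w * (- q2 w)) by apply/funext => w; ring.
  rewrite E -rintD; [|exact: fr|by apply: fr => w sw; apply: differentiableN; exact: d2].
  by congr rint; apply/funext => w; ring.
have d2 w : s <= normc w -> differentiable (fun w : R[i] => w^-1 * w^-1) w.
  move=> sw; have := dk 0 w z00 sw; under eq_fun do rewrite subr0.
  by move=> dw; exact: differentiable_mul.
exists (rint (- s) s (- s) s (fun w => g w * (w^-1 * w^-1)) / kappa); split.
- apply: (le_trans (bd _ (s^-1 ^+ 2) d2 _)); last first.
    by rewrite le_eqVlt; apply/orP; left; apply/eqP; field; rewrite gt_eqF.
  move=> w sw; rewrite normcM normcV -expr2; apply: lerXn2r; rewrite ?nnegrE ?invr_ge0 ?normc_ge0 ?(ltW s0)//.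
  by rewrite lef_pV2// posrE (lt_le_trans _ sw).
- move=> z zs; rewrite (G z)// (G 0)// dif; [|by move=> w; exact: dk|by move=> w; exact: dk].
  apply: (le_trans (bd _ (2 * normc z / s ^+ 2) _ _)).
  + by move=> w sw; apply: differentiableB; exact: dk.
  + move=> w sw; have f := far _ _ zs sw.
    have w0 : w != 0 by apply: n0; apply: lt_le_trans sw.
    have wz0 : w - z != 0 by apply: n0; apply: lt_le_trans f.
    rewrite subr0 (_ : _ - _ = z / (w * (w - z))); last by field; rewrite w0 wz0.
    rewrite normcM normcV normcM [2 * _]mulrC -mulrA ler_wpM2l ?normc_ge0//.
    rewrite -[2]invrK -invfM lef_pV2 ?posrE ?mulr_gt0 ?invr_gt0 ?exprn_gt0 ?normc_gt0//.
    by rewrite mulrC expr2 -mulrA ler_pM// ltW.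
  + by rewrite le_eqVlt; apply/orP; left; apply/eqP; field; rewrite gt_eqF.
- move=> z zs.
  have dz w : s <= normc w -> differentiable (fun w => (w - z)^-1 - w^-1) w.
    move=> sw; apply: differentiableB; first exact: dk.
    by have := dk 0 w z00 sw; under eq_fun do rewrite subr0.
  have dz' w : s <= normc w -> differentiable (fun w : R[i] => z * (w^-1 * w^-1)) w.
    by move=> sw; apply: differentiable_mul; [exact: differentiable_cst|exact: d2].
  rewrite (G z)// (G 0)// dif; [|by move=> w; exact: dk|by move=> w; exact: dk].
  rewrite mulrAC [X in _ - X / _](_ : _ = rint (- s) s (- s) s (fun w : R[i] => g w * (z * (w^-1 * w^-1)))); last first.
    by rewrite mulrC -rintZ; [congr rint; apply/funext => w; ring|exact: fr].
  under eq_fun do rewrite subr0.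
  rewrite dif//.
  apply: (le_trans (bd _ (2 * normc z ^+ 2 / s ^+ 3) _ _)).
  + by move=> w sw; apply: differentiableB; [exact: dz|exact: dz'].
  + move=> w sw; have f := far _ _ zs sw.
    have w0 : w != 0 by apply: n0; apply: lt_le_trans sw.
    have wz0 : w - z != 0 by apply: n0; apply: lt_le_trans f.
    rewrite (_ : _ - _ = (z * z) / (w * w * (w - z))); last by field; rewrite w0 wz0.
    rewrite normcM normcV !normcM -expr2.
    rewrite (_ : 2 * normc z ^+ 2 / s ^+ 3 = normc z ^+ 2 * (2 / s ^+ 3)); last by ring.
    rewrite ler_wpM2l ?exprn_ge0 ?normc_ge0//.
    rewrite -[2]invrK -invfM lef_pV2 ?posrE ?mulr_gt0 ?invr_gt0 ?exprn_gt0 ?normc_gt0//.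
    rewrite (_ : 2^-1 * s ^+ 3 = s * s * (s / 2)); last by ring.
    by rewrite !ler_pM// ?mulr_ge0// ltW.
  + by rewrite le_eqVlt; apply/orP; left; apply/eqP; field; rewrite gt_eqF.
Qed.

End cauchy_estimates.

Section real_norm.
Variables (R : realType) (V : normedModType R[i]).
Implicit Types (v w : V).

(** Norms of an [R[i]]-module lie in [R[i]]; this is the same number as an element of [R], where
    real arithmetic applies. *)
Definition normR v : R := complex.Re `|v|.

Lemma normRE v : `|v| = (normR v)%:C.
Proof. by rewrite RRe_real// ger0_real. Qed.
Lemma normR_ge0 v : 0 <= normR v. Proof. by rewrite -lecR -normRE normr_ge0. Qed.
Lemma normRZ (a : R[i]) v : normR (a *: v) = normc a * normR v.
Proof. by apply: (@complexI R); rewrite rmorphM/= -!normRE -norm_normc; exact: normrZ. Qed.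
Lemma normRD v w : normR (v + w) <= normR v + normR w.
Proof. by rewrite -lecR rmorphD/= -!normRE ler_normD. Qed.
Lemma normRN v : normR (- v) = normR v. Proof. by rewrite /normR normrN. Qed.
Lemma normRB v w : normR (v - w) = normR (w - v). Proof. by rewrite -normRN opprB. Qed.
Lemma normR0 : normR 0 = 0. Proof. by rewrite /normR normr0. Qed.
Lemma normR_eq0 v : (normR v == 0) = (v == 0).
Proof.
apply/eqP/eqP => [v0|->]; last exact: normR0.
by apply/eqP; rewrite -normr_eq0; apply/eqP; rewrite [LHS](normRE v) v0.
Qed.
Lemma normR_gt0 v : (0 < normR v) = (v != 0).
Proof. by rewrite lt_def normR_eq0 normR_ge0 andbT. Qed.

Lemma nbhs_normRP v (A : set V) :
  nbhs v A <-> exists2 d : R, 0 < d & forall w, normR (w - v) < d -> A w.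
Proof.
split=> [/nbhs_ballP[e /= e0 eA]|[d d0 dA]].
  have eE : e = (complex.Re e)%:C by rewrite RRe_real// ger0_real// ltW.
  exists (complex.Re e); first by rewrite -ltcR -eE.
  by move=> w wz; apply: eA; rewrite -ball_normE /ball_/= eE normRE ltcR normRB.
apply/nbhs_ballP; exists d%:C => /=; first by rewrite ltcR.
by move=> w; rewrite -ball_normE /ball_/= normRE ltcR normRB; exact: dA.
Qed.

Lemma differentiable_normR (f : V -> R[i]) p (e : R) : differentiable f p -> 0 < e ->
  exists2 d : R, 0 < d & forall v, normR v < d ->
    normc (f (p + v) - f p - 'd f p v) <= e * normR v.
Proof.
move=> /diff_locallyP[_ /eqaddoP dg] e0.
have eC : 0 < e%:C by rewrite ltcR.
have /nbhs_normRP[d d0 dP] := dg _ eC.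
exists d => // v vd; have := dP v; rewrite subr0 => /(_ vd).
rewrite !fctE /= norm_normc normRE -rmorphM/= lecR addrC; congr (normc _ <= _).
by rewrite addrC opprD addrA addrC [p + v]addrC addrC.
Qed.

(** Each direction [v] is treated separately, by restricting [f] to the complex line through [p].
    The constants are those of [cauchy_estimates] for [s = r / (4 * |v|)], the increments being
    taken at the parameter 1. *)
Lemma holomorphic_estimates (f : V -> R[i]) p (r M : R) : 0 < r ->
  (forall w, normR (w - p) < r -> differentiable f w) ->
  (forall w, normR (w - p) < r -> normc (f w) <= M) ->
  (forall v, normc ('d f p v) <= 64 * M * normR v / r) /\
  forall v, normR v <= r / 8 ->
    normc (f (p + v) - f p) <= 128 * M * normR v / r /\
    normc (f (p + v) - f p - 'd f p v) <= 512 * M * normR v ^+ 2 / r ^+ 2.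
Proof.
move=> r0 df fM.
have M0 : 0 <= M.
  by apply: le_trans (normc_ge0 (f p)) _; apply: fM; rewrite subrr normR0.
have dp : differentiable f p by apply: df; rewrite subrr normR0.
have main v : v != 0 -> exists A, [/\ normc A <= 64 * M * normR v / r, A = 'd f p v &
    normR v <= r / 8 -> normc (f (p + v) - f p) <= 128 * M * normR v / r /\
      normc (f (p + v) - f p - A) <= 512 * M * normR v ^+ 2 / r ^+ 2].
  move=> v0; have nv : 0 < normR v by rewrite normR_gt0.
  (* Points of the square of half-width [s] have modulus at most [2 * s], so their images on the
     line stay within [r / 2] of [p]. *)
  pose s := r / (4 * normR v); have s0 : 0 < s by rewrite divr_gt0// mulr_gt0.
  have inb (w : R[i]) : rect (- s) s (- s) s w -> normR (p + w *: v - p) < r.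
    move=> [/andP[w1 w2] /andP[w3 w4]]; rewrite addrC addKr normRZ.
    apply: (@le_lt_trans _ _ ((s + s) * normR v)).
      rewrite ler_wpM2r ?normR_ge0// (le_trans (normc_le_ReIm _))// lerD// ler_norml ?w1 ?w3//.
    by rewrite (_ : _ * _ = r / 2); [lra|rewrite /s; field; rewrite gt_eqF].
  have [|w wr|A [A1 A2 A3]] := @cauchy_estimates R (fun z => f (p + z *: v)) s M s0.
  - by move=> w wr; apply: differentiable_complex_line; apply: df; exact: inb.
  - by apply: fM; exact: inb.
  exists A; split.
  - by rewrite (le_trans A1)// le_eqVlt; apply/orP; left; apply/eqP; rewrite /s; field; rewrite !gt_eqF.
  (* Both [A * t] and ['d f p v * t] approximate the increment of [f] along [t *: v] for small real
     [t]; so they differ by at most [e * t], for every [e]. *)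
  - apply/eqP; rewrite -subr_eq0 -normc_eq0 eq_le normc_ge0 andbT.
    apply/ler_addgt0Pr => e e0; rewrite add0r.
    have [|d d0 dP] := @differentiable_normR f p (e / 2 / normR v) dp; first by rewrite !divr_gt0.
    pose K := 32 * M / s ^+ 2 + 1.
    have K0 : 0 < K by apply: ltr_wpDl => //; apply: divr_ge0; [exact: mulr_ge0|exact: sqr_ge0].
    pose t := Num.min (Num.min (s / 2) (d / 2 / normR v)) (e / 2 / K).
    have t0 : 0 < t.
      by rewrite !lt_min; apply/andP; split; [apply/andP; split|]; do ?[apply: divr_gt0 => //].
    have : t <= t by [].
    rewrite {2}/t !le_min => /andP[/andP[t1 t2] t3].
    have nt : normc t%:C = t by rewrite normc_real gtr0_norm.
    have := A3 t%:C; rewrite nt scale0r addr0 => /(_ t1) B1.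
    have := dP (t%:C *: v); rewrite normRZ nt => B2.
    have {}B2 := B2 ltac:(by rewrite -ltr_pdivlMr// (le_lt_trans t2)// ltr_pM2r ?invr_gt0//; lra).
    rewrite linearZ/= [_ *: 'd f p v]/(t%:C * 'd f p v) in B2.
    have : normc ((A - 'd f p v) * t%:C) <= e * t.
      rewrite (_ : _ * _ = (f (p + t%:C *: v) - f p - t%:C * 'd f p v) - (f (p + t%:C *: v) - f p - A * t%:C)); last first.
        by ring.
      apply: (le_trans (le_normcD _ _)); rewrite normcN.
      apply: (le_trans (lerD B2 B1)).
      rewrite (_ : e / 2 / normR v * (t * normR v) = e / 2 * t); last by field; rewrite gt_eqF.

      have : 32 * M * t ^+ 2 / s ^+ 2 <= e / 2 * t.
        rewrite (_ : 32 * M * t ^+ 2 / s ^+ 2 = (32 * M / s ^+ 2 * t) * t); last by ring.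
        apply: ler_wpM2r; first exact: ltW.
        apply: (@le_trans _ _ (K * t)); first by rewrite ler_wpM2r ?(ltW t0)// lerDl.
        by rewrite mulrC -ler_pdivlMr.
      by lra.
    by rewrite normcM nt ler_pM2r.
  - move=> vr.
    (* This is where [|v| <= r / 8] enters: the parameter 1, which corresponds to [p + v], is within
       reach of the estimates. *)
    have s1 : normc (1 : R[i]) <= s / 2.
      by rewrite normc1 /s ler_pdivlMr// ler_pdivlMr ?mulr_gt0//; lra.
    have := A2 _ s1; have := A3 _ s1; rewrite !scale1r scale0r addr0 normc1 expr1n !mulr1 => B1 B2.
    split; [rewrite (le_trans B2)//|rewrite (le_trans B1)//];
     by rewrite le_eqVlt; apply/orP; left; apply/eqP; rewrite /s; field; rewrite !gt_eqF.
split=> v; have [->|/main[A [A1 AE A2]]] := eqVneq v 0.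
- by rewrite linear0 normc0 normR0 mulr0 mul0r.
- by rewrite -AE.
- by move=> _; rewrite addr0 subrr linear0 subr0 normc0 normR0 expr0n/= !mulr0 !mul0r.
- by rewrite -AE.
Qed.

End real_norm.

(** * Mean value bounds over polydisks *)

Section plane_mean.
Variable R : realType.
Local Notation Re := complex.Re.
Local Notation Im := complex.Im.
Local Notation leb := (@lebesgue_measure R).

(** Otherwise the integral over []u, v[] alone would be at least [I + e]. The margin [e] provides
    the contradiction even when [I = 0]. *)
Lemma exists_le_mean (f : R -> \bar R) (u v I e : R) : u < v -> 0 < e ->
  measurable_fun setT f -> (forall x, (0 <= f x)%E) -> (\int[leb]_x f x = I%:E)%E ->
  exists2 b, u < b < v & (f b <= ((I + e) / (v - u))%:E)%E.
Proof.
move=> uv e0 mf f0 fI; apply: contrapT => H.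
have fgt b : u < b < v -> (((I + e) / (v - u))%:E <= f b)%E.
  by move=> ub; rewrite leNgt; apply/negP => fb; apply: H; exists b => //; exact: ltW.
have I0 : 0 <= I by rewrite -lee_fin -fI integral_ge0.
have : (\int[leb]_(x in `]u, v[) ((I + e) / (v - u))%:E <= I%:E)%E.
  rewrite -fI; apply: (@le_trans _ _ (\int[leb]_(x in `]u, v[) f x)%E); last exact: ge0_subset_integral.
  apply: ge0_le_integral => //.
  - by move=> x _; rewrite lee_fin; apply: divr_ge0; [apply: addr_ge0 => //; exact: ltW|rewrite subr_ge0; exact: ltW].
  - exact: measurable_funTS.
rewrite integral_cst//= lebesgue_measure_itv/= lte_fin uv -EFinD -EFinM lee_fin divfK ?gt_eqF ?subr_gt0//.
by rewrite gerDl leNgt e0.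
Qed.

Lemma measurable_normc_itv (h : R -> R[i]) (a b : R) : continuous_on_itv h a b ->
  measurable_fun `[a, b] (fun x => normc (h x)).
Proof.
move=> [h1 h2].
have M (f : R -> R) : {within `[a, b], continuous f} -> measurable_fun `[a, b] f.
  by move=> /continuous_itv_integrable/measurable_int/measurable_EFinP.
rewrite (_ : (fun _ => _) = (fun z => Num.sqrt (Re (h z) ^+ 2 + Im (h z) ^+ 2))).
  apply: (@measurableT_comp _ _ _ _ _ _ (@Num.sqrt R)).
    by apply: continuous_measurable_fun; exact: sqrt_continuous.
  by apply: measurable_funD; apply: measurable_funX; exact: M.
by apply/funext => z; case: (h z).
Qed.

(** Tonelli's theorem provides a rectangle whose sides are between [r / 2] and [r] away from the
    centre and carry line integrals of [Phi] that are at most average; Cauchy's formula is applied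
    to it. Each side costs [8 / r ^ 2]: 2 from [normc_cint_le_integral], [2 / r] from the kernel,
    and [2 / r] from averaging over a strip of width [r / 2]. *)
Lemma plane_mean_bound (g : R[i] -> R[i]) (Phi : R * R -> \bar R) (x0 y0 r : R) : 0 < r ->
  (forall x y, x0 - r < x < x0 + r -> y0 - r < y < y0 + r -> differentiable g (x +i* y)) ->
  measurable_fun setT Phi -> (forall p, (0 <= Phi p)%E) ->
  (forall x y, x0 - r < x < x0 + r -> y0 - r < y < y0 + r ->
     Phi (x, y) = (normc (g (x +i* y)))%:E) ->
  ((normc (g (x0 +i* y0)))%:E <= (32 / r ^+ 2)%:E * \int[leb \x leb]_p Phi p)%E.
Proof.
move=> r0 dg mPhi Phi0 PhiE.
have K0 : 0 < 32 / r ^+ 2 by rewrite divr_gt0// exprn_gt0.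
have := integral_ge0 (leb \x leb)%E (fun p (_ : setT p) => Phi0 p).
(* If the integral is infinite, so is the right-hand side. *)
case IE : (\int[leb \x leb]_p Phi p)%E => [I| |]//; last first.
  by rewrite gt0_muley ?leey// lte_fin.
rewrite lee_fin => I0.
pose F := fubini_F leb Phi; pose G := fubini_G leb Phi.
have FI : (\int[leb]_x F x = I%:E)%E by rewrite -IE fubini_tonelli1.
have GI : (\int[leb]_y G y = I%:E)%E by rewrite -IE fubini_tonelli2.
have mF : measurable_fun setT F by exact: measurable_fun_fubini_tonelli_F.
have mG : measurable_fun setT G by exact: measurable_fun_fubini_tonelli_G.
have F0 x : (0 <= F x)%E by apply: integral_ge0.
have G0 y : (0 <= G y)%E by apply: integral_ge0.
rewrite -EFinM lee_fin; apply/ler_addgt0Pr => e' e'0.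
pose e := e' / (32 / r ^+ 2); have e0 : 0 < e by rewrite divr_gt0.
have pick (H : R -> \bar R) (u v : R) : measurable_fun setT H -> (forall x, (0 <= H x)%E) ->
    (\int[leb]_x H x = I%:E)%E -> v - u = r / 2 ->
    exists2 b, u < b < v & (H b <= (2 / r * (I + e))%:E)%E.
  move=> mH H0 HI vu; have uv : u < v by rewrite -subr_gt0 vu divr_gt0.
  have [b ub hb] := exists_le_mean uv e0 mH H0 HI.
  exists b => //; rewrite (le_trans hb)// vu lee_fin le_eqVlt; apply/orP; left; apply/eqP.
  by field; rewrite gt_eqF.
have [|a /andP[a1 a2] Fa] := pick F (x0 - r) (x0 - r / 2) mF F0 FI; first by field.
have [|b /andP[b1 b2] Fb] := pick F (x0 + r / 2) (x0 + r) mF F0 FI; first by field.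
have [|c /andP[c1 c2] Gc] := pick G (y0 - r) (y0 - r / 2) mG G0 GI; first by field.
have [|d /andP[d1 d2] Gd] := pick G (y0 + r / 2) (y0 + r) mG G0 GI; first by field.
have ab : a <= b by lra.
have cd : c <= d by lra.
have za : a < Re (x0 +i* y0) < b by rewrite /=; lra.
have zc : c < Im (x0 +i* y0) < d by rewrite /=; lra.
have xr x : a <= x <= b -> x0 - r < x < x0 + r by move=> /andP[x1 x2]; clear -a1 b2 x1 x2; lra.
have yr y : c <= y <= d -> y0 - r < y < y0 + r by move=> /andP[y1 y2]; clear -c1 d2 y1 y2; lra.
have dg' w : rect a b c d w -> differentiable g w.
  by move=> [w1 w2]; rewrite [w]complexReIm; apply: dg; [exact: xr|exact: yr].
have PhiE' x y : a <= x <= b -> c <= y <= d -> Phi (x, y) = (normc (g (x +i* y)))%:E.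
  by move=> xab ycd; apply: PhiE; [exact: xr|exact: yr].
have CF := cauchy_formula za zc dg'.
pose h w := g w * (w - (x0 +i* y0))^-1.
have far w : rect a b c d w -> [|| Re w == a, Re w == b, Im w == c | Im w == d] ->
    r / 2 <= normc (w - (x0 +i* y0)).
  have R2 := Re_le_normc (w - (x0 +i* y0)); have I2 := Im_le_normc (w - (x0 +i* y0)).
  rewrite cReB/= in R2; rewrite cImB/= in I2.
  move=> _ /or4P[] /eqP E; rewrite E in R2 I2.
  - by apply: le_trans R2; rewrite ler_normr; clear -a2 b1 c2 d1; lra.
  - by apply: le_trans R2; rewrite ler_normr; clear -a2 b1 c2 d1; lra.
  - by apply: le_trans I2; rewrite ler_normr; clear -a2 b1 c2 d1; lra.
  - by apply: le_trans I2; rewrite ler_normr; clear -a2 b1 c2 d1; lra.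
have hle w : rect a b c d w -> [|| Re w == a, Re w == b, Im w == c | Im w == d] ->
    normc (h w) <= 2 / r * normc (g w).
  move=> wr wb; have f := far w wr wb; rewrite normcM normcV mulrC ler_wpM2r ?normc_ge0//.
  rewrite -[2 / r]invrK lef_pV2 ?posrE ?invr_gt0 ?divr_gt0//.
    by rewrite invfM invrK mulrC.
  by apply: lt_le_trans f; rewrite divr_gt0.
have [f1 f2 f3 f4] : continuous_frame h a b c d.
  apply: (continuous_frame_bd ab cd) => w wr wb; apply: differentiable_continuous.
  apply: differentiable_mul; first exact: dg'.
  apply: differentiable_inv; first exact: differentiableB.
  by rewrite -normc_gt0 (lt_le_trans _ (far _ wr wb))// divr_gt0.
have [g1 g2 g3 g4] : continuous_frame g a b c d.
  by apply: (continuous_frame_bd ab cd) => w wr wb; apply: differentiable_continuous; exact: dg'.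
have r20 : 0 <= 2 / r by rewrite divr_ge0// ltW.
have fin (k : R -> R[i]) (u v : R) (k' : R -> R[i]) (H : \bar R) : continuous_on_itv k u v -> continuous_on_itv k' u v ->
    (forall x, u <= x <= v -> normc (k x) <= 2 / r * normc (k' x)) ->
    (\int[leb]_(x in `[u, v]) (normc (k' x))%:E <= H)%E ->
    (H <= (2 / r * (I + e))%:E)%E ->
    normc (cint u v k) <= 8 / r ^+ 2 * (I + e).
  move=> ck ck' kk' H1 H2; rewrite -lee_fin.
  apply: (le_trans (@normc_cint_le_integral _ k (fun x => normc (k' x)) u v (2 / r) ck r20 (measurable_normc_itv ck') _)).
    by move=> x xuv; split; [exact: normc_ge0|exact: kk'].
  apply: (@le_trans _ _ ((2 * (2 / r))%:E * (2 / r * (I + e))%:E)%E).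
    by apply: lee_wpmul2l; [rewrite lee_fin mulr_ge0|exact: le_trans H1 H2].
  by rewrite -EFinM lee_fin le_eqVlt; apply/orP; left; apply/eqP; field; rewrite gt_eqF.
have sub (H : R -> \bar R) (u v : R) (k : R -> R) : measurable_fun setT H -> (forall x, (0 <= H x)%E) ->
    (forall x, u <= x <= v -> H x = (k x)%:E) ->
    (\int[leb]_(x in `[u, v]) (k x)%:E <= \int[leb]_x H x)%E.
  move=> mH H0 Hk; apply: (@le_trans _ _ (\int[leb]_(x in `[u, v]) H x)%E); last exact: ge0_subset_integral.
  rewrite le_eqVlt; apply/orP; left; apply/eqP; apply: eq_integral => x; rewrite inE/= in_itv/= => /Hk <-//.
have S1 : normc (cint a b (fun x => h (x +i* c))) <= 8 / r ^+ 2 * (I + e).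
  apply: (fin _ _ _ _ _ f1 g1 _ _ Gc).
    by move=> x xab; apply: hle; [split=> //=; rewrite lexx|rewrite /= eqxx !orbT].
  apply: sub => //; first exact: measurable_fun_pair1.
  by move=> x xab; apply: (PhiE' x c xab); rewrite lexx cd.
have S2 : normc (cint a b (fun x => h (x +i* d))) <= 8 / r ^+ 2 * (I + e).
  apply: (fin _ _ _ _ _ f2 g2 _ _ Gd).
    by move=> x xab; apply: hle; [split=> //=; rewrite lexx cd|rewrite /= eqxx !orbT].
  apply: sub => //; first exact: measurable_fun_pair1.
  by move=> x xab; apply: (PhiE' x d xab); rewrite lexx cd.
have S3 : normc (cint c d (fun y => h (b +i* y))) <= 8 / r ^+ 2 * (I + e).
  apply: (fin _ _ _ _ _ f3 g3 _ _ Fb).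
    by move=> x xab; apply: hle; [split=> //=; rewrite lexx ab|rewrite /= eqxx !orbT].
  apply: sub => //; first exact: measurable_fun_pair2.
  by move=> y ycd; apply: (PhiE' b y _ ycd); rewrite lexx ab.
have S4 : normc (cint c d (fun y => h (a +i* y))) <= 8 / r ^+ 2 * (I + e).
  apply: (fin _ _ _ _ _ f4 g4 _ _ Fa).
    by move=> x xab; apply: hle; [split=> //=; rewrite lexx ab|rewrite /= eqxx].
  apply: sub => //; first exact: measurable_fun_pair2.
  by move=> y ycd; apply: (PhiE' a y _ ycd); rewrite lexx ab.
have : normc (rint a b c d h) <= 32 / r ^+ 2 * (I + e).
  rewrite /rint (le_trans (le_normcD _ _))// normcM normc_i mul1r.
  rewrite (_ : 32 / _ * _ = 8 / r ^+ 2 * (I + e) + 8 / r ^+ 2 * (I + e) + (8 / r ^+ 2 * (I + e) + 8 / r ^+ 2 * (I + e))); last by ring.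
  by apply: lerD; apply: (le_trans (le_normcD _ _)); rewrite normcN; [exact: lerD S1 S2|exact: lerD S3 S4].
rewrite CF normcM => N; apply: (@le_trans _ _ (32 / r ^+ 2 * (I + e))).
  apply: le_trans N; rewrite ler_peMr ?normc_ge0//; exact: normc_kappa_ge1.
by rewrite mulrDr /e mulrCA divff ?mulr1// gt_eqF.
Qed.

End plane_mean.

Section tuple_mean.
Variable R : realType.
Local Notation Re := complex.Re.
Local Notation Im := complex.Im.
Local Notation leb := (@lebesgue_measure R).

(* The Borel structures of [R * R] on the two sides carry different displays, so
   the integrals are compared through the push-forward by the identity. *)
Lemma integral_plane_measure (Phi : R * R -> \bar R) :
  measurable_fun setT Phi -> (forall p, (0 <= Phi p)%E) ->
  (\int[@plane_measure R]_p Phi p = \int[leb \x leb]_p Phi p)%E.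
Proof.
move=> mPhi Phi0.
pose j (p : measurableTypeR R * measurableTypeR R) : R * R := p.
have mj : measurable_fun setT j by move=> _ A mA; rewrite setTI; exact: mA.
transitivity (\int[pushforward (leb \x leb)%E j]_p Phi p)%E.
  by apply: eq_measure_integral.
by rewrite ge0_integral_pushforward.
Qed.
Definition tuple_update n (t : n.-tuple (R * R)) (i : 'I_n) (z : R[i]) : n.-tuple (R * R) :=
  [tuple if j == i then (Re z, Im z) else tnth t j | j < n].

Lemma tuple_update_cons n (p : R * R) (t : n.-tuple (R * R)) (i : 'I_n) z :
  tuple_update [tuple of p :: t] (lift ord0 i) z = [tuple of p :: tuple_update t i z].
Proof.
apply: eq_from_tnth => j; rewrite tnth_mktuple.
case: (unliftP ord0 j) => [k ->|->]; last by rewrite (negbTE (neq_lift _ _)).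
by rewrite (inj_eq (@lift_inj _ _)) !tnthS tnth_mktuple.
Qed.

Lemma tuple_update0 n (p : R * R) (t : n.-tuple (R * R)) z :
  tuple_update [tuple of p :: t] ord0 z = [tuple of (Re z, Im z) :: t].
Proof.
apply: eq_from_tnth => j; rewrite tnth_mktuple.
case: (unliftP ord0 j) => [k ->|->]//.
by rewrite eq_sym (negbTE (neq_lift _ _)) !tnthS.
Qed.

Lemma coord_box_cons n (p p0 : R * R) (t t0 : n.-tuple (R * R)) (r : R) :
  coord_box [tuple of p0 :: t0] r [tuple of p :: t] <->
  (p0.1 - r < p.1 < p0.1 + r /\ p0.2 - r < p.2 < p0.2 + r) /\ coord_box t0 r t.
Proof.
split=> [H|[[h1 h2] H] i].
  split; first by have /= [] := H ord0; rewrite !in_itv.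
  by move=> i; have := H (lift ord0 i); rewrite !tnthS.
case: (unliftP ord0 i) => [k ->|->]; first by rewrite !tnthS; exact: H.
by split; rewrite /= in_itv.
Qed.

Lemma integral_tuple_cons n (Phi : n.+1.-tuple (R * R) -> \bar R) :
  measurable_fun setT Phi -> (forall t, (0 <= Phi t)%E) ->
  (\int[tuple_measure (@plane_measure R) n.+1]_t Phi t =
   \int[@plane_measure R]_p \int[tuple_measure (@plane_measure R) n]_t Phi [tuple of p :: t])%E.
Proof.
move=> mPhi Phi0.
transitivity (\int[pushforward (@plane_measure R \x tuple_measure (@plane_measure R) n)%E
    (@tuple_cons (R * R)%type n)]_t Phi t)%E.
  by apply: eq_measure_integral; first exact: measurable_tuple_cons.
rewrite ge0_integral_pushforward//; last exact: measurable_tuple_cons.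
rewrite preimage_setT fubini_tonelli1//.
- exact: (measurableT_comp mPhi (@measurable_tuple_cons _ (R * R)%type n)).
- by move=> x; exact: Phi0.
Qed.

(** Induction on the number of coordinates: the planar bound in the first coordinate with the others
    frozen at [t0], then the induction hypothesis for each value of the first coordinate; the
    integrals combine by Tonelli's theorem. *)
Lemma tuple_mean_bound n (F : n.-tuple (R * R) -> R[i]) (Phi : n.-tuple (R * R) -> \bar R)
    (t0 : n.-tuple (R * R)) (r : R) : 0 < r ->
  (forall t i z, coord_box t0 r (tuple_update t i z) ->
    differentiable (fun w => F (tuple_update t i w)) z) ->
  measurable_fun setT Phi -> (forall t, (0 <= Phi t)%E) ->
  (forall t, coord_box t0 r t -> Phi t = (normc (F t))%:E) ->
  ((normc (F t0))%:E <= ((32 / r ^+ 2) ^+ n)%:E * \int[tuple_measure (@plane_measure R) n]_t Phi t)%E.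
Proof.
move=> r0; elim: n F Phi t0 => [|n IH] F Phi t0 dF mPhi Phi0 PhiE.
  rewrite expr0 mul1e /= integral_dirac// diracT mul1e.
  rewrite -PhiE; last by case.
  by rewrite (tuple0 t0).
case/tupleP: t0 dF PhiE => p0 t0 dF PhiE.
have K0 : 0 <= 32 / r ^+ 2 by rewrite divr_ge0// sqr_ge0.
pose Psi p := (\int[tuple_measure (@plane_measure R) n]_t Phi [tuple of p :: t])%E.
have mcons (p : R * R) : measurable_fun setT (fun t : n.-tuple (R * R) => Phi [tuple of p :: t]).
  have := @measurable_fun_pair2 _ _ _ _ _ _ (Phi \o @tuple_cons _ n) p; apply.
  by apply: measurableT_comp => //; exact: measurable_tuple_cons.
have mcons' (t : n.-tuple (R * R)) : measurable_fun setT (fun p : R * R => Phi [tuple of p :: t]).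
  have := @measurable_fun_pair1 _ _ _ _ _ _ (Phi \o @tuple_cons _ n) t; apply.
  by apply: measurableT_comp => //; exact: measurable_tuple_cons.
have Psi0 p : (0 <= Psi p)%E by apply: integral_ge0.
have mPsi : measurable_fun setT Psi.
  have := @measurable_fun_fubini_tonelli_F _ _ _ _ R (tuple_measure (@plane_measure R) n) (Phi \o @tuple_cons _ n); apply.
    by apply: measurableT_comp => //; exact: measurable_tuple_cons.
  by move=> x; exact: Phi0.
have box0 p : (p0.1 - r < p.1 < p0.1 + r /\ p0.2 - r < p.2 < p0.2 + r) ->
    coord_box [tuple of p0 :: t0] r [tuple of p :: t0].
  by move=> hp; apply/coord_box_cons; split=> // i; split; rewrite /= in_itv/= ltrBlDr !ltrDl r0.
pose B : set (R * R) := [set p | p0.1 - r < p.1 < p0.1 + r] `&` [set p | p0.2 - r < p.2 < p0.2 + r].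
have mB : measurable B.
  rewrite (_ : B = `]p0.1 - r, p0.1 + r[%classic `*` `]p0.2 - r, p0.2 + r[%classic).
    exact: measurableX.
  by apply/seteqP; split => p [/= h1 h2]; split; rewrite /= ?in_itv//; rewrite ?in_itv/= in h1 h2 *.
(* Outside [B] nothing relates [Phi] to [F], so the induction hypothesis gives no control of the
   slice there; it is replaced by 0. *)
pose Phi1 := (fun p => Phi [tuple of p :: t0]) \_ B.
have M := @plane_mean_bound R (fun z => F [tuple of (Re z, Im z) :: t0]) Phi1 p0.1 p0.2 r r0.
have mPhi1 : measurable_fun setT Phi1.
  by apply/(measurable_restrictT _ mB); apply: measurable_funTS; exact: mcons'.
set X := F _; have -> : X = (fun z => F [tuple of (Re z, Im z) :: t0]) (p0.1 +i* p0.2).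
  by rewrite /X; congr F; apply: val_inj => /=; rewrite -surjective_pairing.
apply: (le_trans (M _ _ _ _)).
- move=> x y hx hy.
  under eq_fun do rewrite -(tuple_update0 p0).
  by apply: (dF [tuple of p0 :: t0] ord0 (x +i* y)); rewrite tuple_update0; apply: box0.
- exact: mPhi1.
- by move=> p; rewrite /Phi1 patchE; case: ifP.
- move=> x y hx hy; rewrite /Phi1 patchE mem_set// PhiE//; exact: box0.
have -> : (((32 / r ^+ 2) ^+ n.+1)%:E = (32 / r ^+ 2)%:E * ((32 / r ^+ 2) ^+ n)%:E)%E by rewrite -EFinM -exprS.
rewrite -muleA; apply: lee_wpmul2l; first by rewrite lee_fin.
rewrite -integral_plane_measure//; last by move=> p; rewrite /Phi1 patchE; case: ifP.
rewrite integral_tuple_cons// -ge0_integralZl//; last by rewrite lee_fin exprn_ge0.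
apply: ge0_le_integral => //.
- by move=> p _; rewrite /Phi1 patchE; case: ifP.
- exact: measurable_funeM.
move=> p _; rewrite /Phi1 patchE; case: ifPn => [|_]; last by apply: mule_ge0; [rewrite lee_fin exprn_ge0|exact: Psi0].
rewrite inE => pB; rewrite PhiE; last exact: box0.
apply: (IH (fun t => F [tuple of p :: t]) (fun t => Phi [tuple of p :: t]) t0) => //.
- move=> t i z tb; under eq_fun do rewrite -tuple_update_cons.
  by apply: (dF [tuple of p :: t] (lift ord0 i) z); rewrite tuple_update_cons; apply/coord_box_cons.
- by move=> t tb; apply: PhiE; apply/coord_box_cons.
by move=> p _; exact: Psi0.
Qed.

End tuple_mean.

(** * Transfer from tuples of real pairs to complex row vectors *)

Section row_norm.
Variables (R : realType) (n : nat).
Local Notation Cn := 'rV[R[i]]_n.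

Lemma normR_rV_lt (v : Cn) (d : R) : 0 < d ->
  normR v < d <-> forall i, normc (v ord0 i) < d.
Proof.
move=> d0; have dC : 0 < d%:C by rewrite ltcR.
have -> : (normR v < d) <-> ball (0 : Cn) d%:C v.
  by rewrite -ball_normE /ball_/= sub0r normrN [`|v|]normRE ltcR.
split=> [[_ H] i|H].
  by have := H ord0 i; rewrite /ball/= mxE sub0r normrN norm_normc ltcR.
split => // i j; rewrite ord1 /ball/= mxE sub0r normrN norm_normc ltcR; exact: H.
Qed.

Lemma normc_le_normR_rV (v : Cn) i : normc (v ord0 i) <= normR v.
Proof.
apply/ler_addgt0Pr => e e0.
have h : 0 < normR v + e by rewrite ltr_wpDl ?normR_ge0.
have : normR v < normR v + e by rewrite ltrDl.
by move=> /(proj1 (@normR_rV_lt v _ h))/(_ i)/ltW.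
Qed.

Lemma complex_coords_surj (z : Cn) : exists t, complex_coords t = z.
Proof.
exists [tuple (complex.Re (z ord0 i), complex.Im (z ord0 i)) | i < n].
by apply/rowP => i; rewrite mxE tnth_mktuple/=; case: (z ord0 i).
Qed.

Lemma coord_box_normR (t s : n.-tuple (R * R)) (r : R) : 0 < r ->
  coord_box t r s -> normR (complex_coords s - complex_coords t) < 2 * r.
Proof.
move=> r0 st; apply/normR_rV_lt; first by rewrite mulr_gt0.
move=> i; have [/= a b] := st i; rewrite !in_itv/= in a b.
rewrite !mxE (le_lt_trans (normc_le_ReIm _))// cReB cImB/= mulr_natl mulr2n ltrD//.
  by rewrite ltr_norml; lra.
by rewrite ltr_norml; lra.
Qed.

Lemma integral_complex_lebesgue (Phi : Cn -> \bar R) :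
  measurable_fun setT Phi -> (forall z, (0 <= Phi z)%E) ->
  (\int[@complex_lebesgue R n]_z Phi z =
   \int[tuple_measure (@plane_measure R) n]_t Phi (complex_coords t))%E.
Proof.
move=> mPhi Phi0.
transitivity (\int[pushforward (tuple_measure (@plane_measure R) n) (@complex_coords R n)]_z Phi z)%E.
  by apply: eq_measure_integral; first exact: measurable_complex_coords.
by rewrite ge0_integral_pushforward//; exact: measurable_complex_coords.
Qed.

(** The norm of a row is the maximum of the moduli, so the coordinate box of half-width [r / 2] lies
    in the ball of radius [r]. Halving [r] turns the planar constant 32 into 128. *)
Lemma complex_mean_bound (f : Cn -> R[i]) (Phi : Cn -> \bar R) z0 (r : R) : 0 < r ->
  (forall z, normR (z - z0) < r -> differentiable f z) ->
  measurable_fun setT Phi -> (forall z, (0 <= Phi z)%E) ->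
  (forall z, normR (z - z0) < r -> Phi z = (normc (f z))%:E) ->
  ((normc (f z0))%:E <= ((128 / r ^+ 2) ^+ n)%:E * \int[@complex_lebesgue R n]_z Phi z)%E.
Proof.
move=> r0 df mPhi Phi0 PhiE.
have r20 : 0 < r / 2 by rewrite divr_gt0.
have [t0 tz] := complex_coords_surj z0.
have inb t : coord_box t0 (r / 2) t -> normR (complex_coords t - z0) < r.
  by move=> /(coord_box_normR r20); rewrite tz mulrC divfK.
have := @tuple_mean_bound R n (f \o @complex_coords R n) (Phi \o @complex_coords R n) t0 (r / 2) r20.
rewrite (_ : 32 / (r / 2) ^+ 2 = 128 / r ^+ 2); last by field; rewrite gt_eqF.
rewrite integral_complex_lebesgue// -tz; apply.
- move=> t i z tb.
  pose P : Cn := complex_coords (tuple_update t i 0).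
  have uE w : complex_coords (tuple_update t i w) = P + w *: delta_mx ord0 i.
    apply/rowP => j; rewrite !mxE !tnth_mktuple eqxx /=.
    by case: (j == i) => /=; rewrite ?mulr1 ?mulr0 ?addr0 //= add0r; case: w.
  under eq_fun do rewrite /= uE.
  by apply: differentiable_complex_line; rewrite -uE; apply: df; apply: inb.
- by apply: measurableT_comp => //; exact: measurable_complex_coords.
- by move=> t; exact: Phi0.
- by move=> t /inb tb; rewrite /= PhiE.
Qed.

Lemma complex_lebesgue_bounded (A : set Cn) : measurable A -> bounded_set A ->
  (@complex_lebesgue R n A < +oo)%E.
Proof.
move=> mA [M [Mr AM]].
pose r : R := complex.Re M + 1.
have MR : M = (complex.Re M)%:C by rewrite RRe_real.
have ltM : M < r%:C by rewrite {1}MR ltcR ltrDl.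
have Ar (z : Cn) : A z -> normR z <= r by move=> /(AM _ ltM) zr; rewrite -lecR -normRE.
pose t0 : n.-tuple (R * R) := [tuple (0, 0) | i < n].
have sub : @complex_coords R n @^-1` A `<=` coord_box t0 (r + 1).
  move=> t /= /Ar tr i; rewrite tnth_mktuple.
  have := le_trans (normc_le_normR_rV _ i) tr; rewrite mxE => tir.
  have := le_trans (Re_le_normc _) tir; have := le_trans (Im_le_normc _) tir.
  rewrite /= !ler_norml => /andP[? ?] /andP[? ?]; split; rewrite /= in_itv/=; lra.
apply: (@le_lt_trans _ _ (tuple_measure (@plane_measure R) n (coord_box t0 (r + 1)))).
  apply: (@le_measure _ _ _ (tuple_measure (@plane_measure R) n) (@complex_coords R n @^-1` A)) => //.
    rewrite inE -[X in measurable X]setTI; exact: measurable_complex_coords.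
  by rewrite inE; exact: measurable_coord_box.
pose B (i : 'I_n) := `](tnth t0 i).1 - (r + 1), (tnth t0 i).1 + (r + 1)[%classic `*`
    `](tnth t0 i).2 - (r + 1), (tnth t0 i).2 + (r + 1)[%classic.
rewrite [X in (X < _)%E](_ : _ = (\prod_(i < n) plane_measure (B i))%E); last first.
  by rewrite -tuple_measureE// => i; exact: measurableX.
suff : (\prod_(i < n) plane_measure (B i))%E \is a fin_num by rewrite fin_numElt => /andP[].
apply: prode_fin_num => i _.
by rewrite /plane_measure/= product_measure1E//= !lebesgue_measure_itv/=; do !case: ifP.
Qed.

End row_norm.

(** * The Bergman space as a Hilbert space *)

Section L2_dot.
Variables (R : realType) (n : nat) (Omega : domain R n).
Local Notation Cn := 'rV[R[i]]_n.
Local Notation mu := (@complex_lebesgue R n).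
Local Notation Re := complex.Re.
Local Notation Im := complex.Im.
Local Notation SI := (square_integrable Omega).
Local Notation dot := (L2dot Omega).
Local Notation norm2 := (L2norm Omega).
Implicit Types (f g h k : Cn -> R[i]) (a : R[i]).

Let md := @domain_measurable R n Omega.

Definition complex_integrable f :=
  mu.-integrable Omega (fun z => (Re (f z))%:E) /\ mu.-integrable Omega (fun z => (Im (f z))%:E).

Definition complex_integral f : R[i] :=
  (\int[mu]_(z in Omega) Re (f z)) +i* (\int[mu]_(z in Omega) Im (f z)).

Let integrableZ (c : R) (u : Cn -> R) : mu.-integrable Omega (EFin \o u) ->
  mu.-integrable Omega (EFin \o (fun z => c * u z)).
Proof. by move=> iu; rewrite (_ : EFin \o _ = (fun z => c%:E * (EFin \o u) z)%E)//; exact: integrableZl. Qed.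

Lemma complex_integralD f g : complex_integrable f -> complex_integrable g ->
  complex_integral (fun z => f z + g z) = complex_integral f + complex_integral g.
Proof.
move=> [f1 f2] [g1 g2]; rewrite /complex_integral.
under eq_Rintegral do rewrite cReD.
under [in X in _ +i* X]eq_Rintegral do rewrite cImD.
by rewrite !RintegralD.
Qed.

Lemma complex_integralZ a f : complex_integrable f ->
  complex_integral (fun z => a * f z) = a * complex_integral f.
Proof.
move=> [f1 f2]; rewrite /complex_integral.
under eq_Rintegral do rewrite cReM.
under [in X in _ +i* X]eq_Rintegral do rewrite cImM.
rewrite RintegralB ?RintegralD ?RintegralZl//; try exact: integrableZ.
by rewrite [RHS]complexReIm cReM cImM.
Qed.

Lemma sqr_normc_integrable f : SI f -> mu.-integrable Omega (fun z => (normc (f z) ^+ 2)%:E).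
Proof.
move=> fI; have mf := measurable_normc fI; case: fI => _ _ fin.
apply/integrableP; split; first by apply/measurable_EFinP; exact: measurable_funX.
under eq_integral do rewrite gee0_abs ?lee_fin ?sqr_ge0//.
by [].
Qed.

Lemma dot_integrable f g : SI f -> SI g -> complex_integrable (fun z => f z * (g z)^*).
Proof.
move=> fI gI.
have If := sqr_normc_integrable fI; have Ig := sqr_normc_integrable gI.
move: fI gI => [mf1 mf2 _] [mg1 mg2 _].
have D : mu.-integrable Omega (fun z => (normc (f z) ^+ 2 + normc (g z) ^+ 2)%:E).
  rewrite (_ : (fun _ => _) = (fun z => (normc (f z) ^+ 2)%:E + (normc (g z) ^+ 2)%:E)%E)//.
  exact: integrableD.
have B z : normc (f z * (g z)^*) <= normc (f z) ^+ 2 + normc (g z) ^+ 2.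
  rewrite normcM normc_conj.
  have := sqr_ge0 (normc (f z) - normc (g z)); have := normc_ge0 (f z); have := normc_ge0 (g z).
  by nra.
have Rec w : Re (w^*)%C = Re w :> R by case: w.
have Imc w : Im (w^*)%C = - Im w :> R by case: w.
split; apply: le_integrable D => //.
- apply/measurable_EFinP; under eq_fun do rewrite cReM Rec Imc mulrN opprK.
  by apply: measurable_funD; exact: measurable_funM.
- move=> z _; rewrite /= lee_fin [leRHS]ger0_norm ?addr_ge0 ?sqr_ge0//.
  exact: le_trans (Re_le_normc _) (B z).
- apply/measurable_EFinP; under eq_fun do rewrite cImM Rec Imc mulrN addrC.
  by apply: measurable_funB; exact: measurable_funM.
- move=> z _; rewrite /= lee_fin [leRHS]ger0_norm ?addr_ge0 ?sqr_ge0//.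
  exact: le_trans (Im_le_normc _) (B z).
Qed.

Lemma dotE f g : dot f g = complex_integral (fun z => f z * (g z)^*).
Proof. by []. Qed.

Lemma dotDl f g k : SI f -> SI g -> SI k ->
  dot (fun z => f z + g z) k = dot f k + dot g k.
Proof.
move=> fI gI kI; rewrite !dotE -complex_integralD; [|exact: dot_integrable..].
by congr complex_integral; apply/funext => z; rewrite mulrDl.
Qed.

Lemma dotZl a f k : SI f -> SI k -> dot (fun z => a * f z) k = a * dot f k.
Proof.
move=> fI kI; rewrite !dotE -complex_integralZ; last exact: dot_integrable.
by congr complex_integral; apply/funext => z; rewrite mulrA.
Qed.

Lemma dotC f g : SI f -> SI g -> dot f g = (dot g f)^*.
Proof.
move=> fI gI; rewrite !dotE /complex_integral /=; congr (_ +i* _).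
  by apply: eq_Rintegral => z _; case: (f z) => ? ?; case: (g z) => ? ? /=; ring.
rewrite -mulN1r -RintegralZl//; last by have [] := dot_integrable gI fI.
by apply: eq_Rintegral => z _; case: (f z) => ? ?; case: (g z) => ? ? /=; ring.
Qed.

Lemma norm2_ge0 f : 0 <= norm2 f. Proof. exact: sqrtr_ge0. Qed.

Lemma norm2_sqr f : norm2 f ^+ 2 = \int[mu]_(z in Omega) (normc (f z) ^+ 2).
Proof. by rewrite sqr_sqrtr// Rintegral_ge0// => z _; exact: sqr_ge0. Qed.

Lemma norm2_sqrE f : SI f ->
  (norm2 f ^+ 2)%:E = (\int[mu]_(z in Omega) (normc (f z) ^+ 2)%:E)%E.
Proof.
by move=> fI; rewrite norm2_sqr fineK//; apply: integrable_fin_num => //; exact: sqr_normc_integrable.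
Qed.

Lemma dotff f : dot f f = (norm2 f ^+ 2)%:C.
Proof.
rewrite norm2_sqr; apply/eqP; rewrite eq_complex /=; apply/andP; split; apply/eqP.
  by apply: eq_Rintegral => z _; rewrite conj_normc.
by rewrite /Rintegral integral0_eq// => z _; rewrite conj_normc.
Qed.

Lemma SI_D f g : SI f -> SI g -> SI (fun z => f z + g z).
Proof. exact: square_integrableD. Qed.
Lemma SI_Z a f : SI f -> SI (fun z => a * f z).
Proof. exact: square_integrableZ. Qed.
Lemma SI_B f g : SI f -> SI g -> SI (fun z => f z - g z).
Proof.
move=> fI gI; rewrite (_ : (fun _ => _) = (fun z => f z + (-1) * g z)); last first.
  by apply/funext => z; rewrite mulN1r.
by apply: SI_D => //; exact: SI_Z.
Qed.

Lemma dotBl f g k : SI f -> SI g -> SI k ->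
  dot (fun z => f z - g z) k = dot f k - dot g k.
Proof.
move=> fI gI kI; rewrite (_ : (fun _ => _) = (fun z => f z + (-1) * g z)); last first.
  by apply/funext => z; rewrite mulN1r.
by rewrite dotDl ?dotZl ?mulN1r//; exact: SI_Z.
Qed.

Lemma dotDr f g k : SI f -> SI g -> SI k ->
  dot k (fun z => f z + g z) = dot k f + dot k g.
Proof.
move=> fI gI kI; rewrite dotC ?dotDl//; last exact: SI_D.
by rewrite rmorphD/= -!dotC.
Qed.

Lemma dotZr a f k : SI f -> SI k -> dot k (fun z => a * f z) = a^* * dot k f.
Proof. by move=> fI kI; rewrite dotC ?dotZl// ?rmorphM/= -?dotC//; exact: SI_Z. Qed.

Lemma dotBr f g k : SI f -> SI g -> SI k ->
  dot k (fun z => f z - g z) = dot k f - dot k g.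
Proof.
move=> fI gI kI; rewrite dotC ?dotBl//; last exact: SI_B.
by rewrite rmorphB/= -!dotC.
Qed.

Lemma norm2_subZ f g (t : R) : SI f -> SI g ->
  norm2 (fun z => f z - (t%:C * dot f g) * g z) ^+ 2 =
  norm2 f ^+ 2 - 2 * t * normc (dot f g) ^+ 2 + t ^+ 2 * normc (dot f g) ^+ 2 * norm2 g ^+ 2.
Proof.
move=> fI gI; apply: (@complexI R); rewrite -dotff.
have gI' : SI (fun z => (t%:C * dot f g) * g z) by exact: SI_Z.
rewrite dotBl ?dotBr ?dotZl ?dotZr//; [|exact: SI_B..].
have cE : (t%:C * dot f g)^* = t%:C * (dot f g)^* by rewrite rmorphM; congr (_ * _); exact: conjc_real.
rewrite !dotff [dot g f]dotC// cE.
set A := (norm2 f ^+ 2)%:C; set B := (norm2 g ^+ 2)%:C; set D := dot f g.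
transitivity (A - 2 * t%:C * (D * D^*) + t%:C ^+ 2 * (D * D^*) * B); first by ring.
by rewrite conj_normc /A /B; ring.
Qed.

Lemma cauchy_schwarz f g : SI f -> SI g -> normc (dot f g) <= norm2 f * norm2 g.
Proof.
move=> fI gI.
have H t := norm2_subZ t fI gI.
have P t : 0 <= norm2 f ^+ 2 - 2 * t * normc (dot f g) ^+ 2 + t ^+ 2 * normc (dot f g) ^+ 2 * norm2 g ^+ 2.
  by rewrite -H sqr_ge0.
rewrite -(@ler_pXn2r _ 2) ?nnegrE ?normc_ge0 ?mulr_ge0 ?norm2_ge0// exprMn.
have [g0|gn0] := eqVneq (norm2 g) 0.
  (* With [norm2 g = 0] the quadratic term disappears; unless [dot f g] is 0, this [t] would make
     the nonnegative expression equal to -1. *)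
  have := P ((norm2 f ^+ 2 + 1) / (2 * normc (dot f g) ^+ 2)).
  have [->|dn0] := eqVneq (normc (dot f g)) 0; first by rewrite expr0n /= mulr_ge0 ?sqr_ge0.
  rewrite g0 expr0n/= !mulr0 addr0 (_ : 2 * _ * _ = norm2 f ^+ 2 + 1); last by field.
  by lra.
have := P ((norm2 g ^+ 2)^-1).
rewrite (_ : norm2 f ^+ 2 - _ + _ = norm2 f ^+ 2 - normc (dot f g) ^+ 2 / norm2 g ^+ 2); last by field.
by rewrite subr_ge0 ler_pdivrMr// exprn_gt0// lt_def gn0 norm2_ge0.
Qed.

End L2_dot.

Section complex_limits.
Variable R : realType.

Definition seq_limit (c : nat -> R[i]) (l : R[i]) :=
  forall e : R, 0 < e -> exists N, forall k, (N <= k)%N -> normc (c k - l) <= e.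

Lemma complex_cauchy_limit (c : nat -> R[i]) :
  (forall e : R, 0 < e -> exists N, forall j k, (N <= j)%N -> (N <= k)%N -> normc (c j - c k) <= e) ->
  exists l, seq_limit c l.
Proof.
move=> cc.
have real_limit (u : nat -> R) :
    (forall e : R, 0 < e -> exists N, forall j k, (N <= j)%N -> (N <= k)%N -> `|u j - u k| <= e) ->
    exists l : R, u @ \oo --> l.
  move=> uc; apply/cvg_ex/cauchy_cvgP/cauchy_exP => e e0.
  have [N uN] := uc (e / 2) ltac:(by rewrite divr_gt0).
  exists (u N); exists N => // k /= Nk; rewrite /ball/=.
  by apply: (le_lt_trans (uN _ _ _ _)) => //; rewrite ltr_pdivrMr// ltr_pMr// ltr1n.
have [|a ca] := real_limit (fun k => complex.Re (c k)).
  by move=> e /cc[N cN]; exists N => j k Nj Nk; rewrite -cReB (le_trans (Re_le_normc _))// cN.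
have [|b cb] := real_limit (fun k => complex.Im (c k)).
  by move=> e /cc[N cN]; exists N => j k Nj Nk; rewrite -cImB (le_trans (Im_le_normc _))// cN.
exists (a +i* b) => e e0; have e2 : 0 < e / 2 by rewrite divr_gt0.
move/cvgrPdist_le : ca => /(_ _ e2)[N1 _ H1]; move/cvgrPdist_le : cb => /(_ _ e2)[N2 _ H2].
exists (maxn N1 N2) => k; rewrite geq_max => /andP[k1 k2].
rewrite (le_trans (normc_le_ReIm _))// cReB cImB/= [e]splitr lerD//.
  by rewrite distrC; exact: H1.
by rewrite distrC; exact: H2.
Qed.

Lemma seq_limit_le (c : nat -> R[i]) l (x : R[i]) (B : R) N : seq_limit c l ->
  (forall k, (N <= k)%N -> normc (c k - x) <= B) -> normc (l - x) <= B.
Proof.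
move=> cl cB; apply/ler_addgt0Pr => e /cl[N' H].
have k1 : (N <= maxn N N')%N by rewrite leq_maxl.
have k2 : (N' <= maxn N N')%N by rewrite leq_maxr.
rewrite (_ : l - x = (c (maxn N N') - x) + (l - c (maxn N N'))); last by ring.
by rewrite (le_trans (le_normcD _ _))// lerD//; [exact: cB|rewrite normcB; exact: H].
Qed.

Lemma seq_limitD c d l m : seq_limit c l -> seq_limit d m -> seq_limit (fun k => c k + d k) (l + m).
Proof.
move=> cl dm e e0; have e2 : 0 < e / 2 by rewrite divr_gt0.
have [N H] := cl _ e2; have [N' H'] := dm _ e2.
exists (maxn N N') => k; rewrite geq_max => /andP[k1 k2].
rewrite (_ : _ - _ = (c k - l) + (d k - m)); last by ring.
by rewrite (le_trans (le_normcD _ _))// [e]splitr lerD// ?H ?H'.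
Qed.

Lemma seq_limitZ a c l : seq_limit c l -> seq_limit (fun k => a * c k) (a * l).
Proof.
move=> cl e e0; have K0 : 0 < normc a + 1 by rewrite ltr_wpDl ?normc_ge0.
have [N H] := cl _ (divr_gt0 e0 K0).
exists N => k /H; rewrite -mulrBr normcM ler_pdivlMr// mulrC => h.
by apply: le_trans h; rewrite ler_wpM2r ?normc_ge0// lerDl.
Qed.

Lemma seq_limit_unique c l m : seq_limit c l -> seq_limit c m -> l = m.
Proof.
move=> cl cm; apply/eqP; rewrite -subr_eq0 -normc_eq0 eq_le normc_ge0 andbT.
apply/ler_addgt0Pr => e /cm[N H]; rewrite add0r.
exact: (seq_limit_le cl H).
Qed.

End complex_limits.

Section differentiability_criterion.
Variables (R : realType) (V : normedModType R[i]).

(** A quadratic error is [o(|v|)], and the bound on [L] makes it continuous. Explicit inequalities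
    of this kind survive pointwise limits, unlike differentiability itself. *)
Lemma differentiable_of_estimate (f L : V -> R[i]) p (B K r : R) : 0 < r -> 0 <= K ->
  linear L -> (forall v, normc (L v) <= B * normR v) ->
  (forall v, normR v <= r -> normc (f (p + v) - f p - L v) <= K * normR v ^+ 2) ->
  differentiable f p.
Proof.
move=> r0 K0 Llin LB fL.
pose LL := GRing.isLinear.Build _ _ _ _ L Llin.
pose l : {linear V -> R[i]} := HB.pack L LL.
have cl : continuous l.
  move=> v A /nbhs_normcP[e e0 eA]; apply/nbhs_normRP.
  exists (e / (`|B| + 1)); first by rewrite divr_gt0// ltr_wpDl.
  move=> w wv; apply: eA; rewrite -linearB/=.
  apply: (le_lt_trans (LB _)); apply: (@le_lt_trans _ _ ((`|B| + 1) * normR (w - v))).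
    by rewrite ler_wpM2r ?normR_ge0// (le_trans (ler_norm _))// lerDl.
  by rewrite mulrC -ltr_pdivlMr// ltr_wpDl.
have fo : f \o shift p = cst (f p) + l +o_ 0 id.
  apply/eqaddoP => e e0.
  have eE : e = (complex.Re e)%:C by rewrite RRe_real// ger0_real// ltW.
  have e0' : 0 < complex.Re e by rewrite -ltcR -eE.
  apply/nbhs_normRP; exists (Num.min r (complex.Re e / (K + 1))).
    by rewrite lt_min r0 divr_gt0// ltr_wpDl.
  move=> v; rewrite subr0 lt_min => /andP[vr ve].
  rewrite !fctE /= norm_normc normRE eE -rmorphM/= lecR addrC.
  rewrite (_ : - (f p + L v) + f (v + p) = f (p + v) - f p - L v); last by rewrite [v + p]addrC; ring.
  apply: (le_trans (fL _ (ltW vr))).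
  rewrite expr2 mulrA ler_wpM2r ?normR_ge0//.
  apply: (@le_trans _ _ ((K + 1) * normR v)); first by rewrite ler_wpM2r ?normR_ge0// lerDl.
  by rewrite mulrC -ler_pdivlMr ?ltr_wpDl// ltW.
by apply/diff_locallyP; rewrite (diff_unique cl fo).
Qed.

End differentiability_criterion.

Section bergman_space.
Variables (R : realType) (n : nat) (Omega : domain R n).
Hypothesis Omega_bounded : bounded_set (domain_set Omega).
Local Notation Cn := 'rV[R[i]]_n.
Local Notation mu := (@complex_lebesgue R n).
Local Notation SI := (square_integrable Omega).
Local Notation norm2 := (L2norm Omega).
Local Notation A2 := (bergman Omega).
Implicit Types (f g h k : A2).

Let md := @domain_measurable R n Omega.

Lemma bergman_differentiable f z : domain_set Omega z -> differentiable (f : Cn -> R[i]) z.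
Proof. by have [H _ _] := set_mem (bergmanP f); exact: H. Qed.

Lemma bergman_SI f : SI f.
Proof. by have [] := set_mem (bergmanP f). Qed.

Lemma bergman0 f z : ~ domain_set Omega z -> bergman_fun f z = 0.
Proof. by have [_ _ H] := set_mem (bergmanP f); exact: H. Qed.

Lemma normR_bergman f : normR f = norm2 f. Proof. by []. Qed.

(** The summand 1 comes from integrating [|g| <= 1 + |g| ^ 2] for [g] in the unit ball; other
    functions are reduced to this case by scaling. *)
Definition eval_const (r : R) : R := (128 / r ^+ 2) ^+ n * (fine (mu Omega) + 1).

Lemma eval_const_ge0 r : 0 <= eval_const r.
Proof.
apply: mulr_ge0; first by rewrite exprn_ge0// divr_ge0// sqr_ge0.
by rewrite addr_ge0// fine_ge0.
Qed.

Lemma domain_measure_fin : (mu Omega < +oo)%E.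
Proof. by apply: complex_lebesgue_bounded. Qed.

Lemma eval_bound f z (r : R) : 0 < r ->
  (forall w, normR (w - z) < r -> domain_set Omega w) ->
  normc (f z) <= eval_const r * normR f.
Proof.
move=> r0 zr.
have main g : normR g <= 1 -> normc (g z) <= eval_const r.
  move=> g1.
  have mg := measurable_normc_bergman g.
  have B := @complex_mean_bound R n g (fun w => (normc (g w))%:E) z r r0.
  have {}B := B (fun w wr => bergman_differentiable g (zr w wr)).
  have {}B := B ltac:(exact/measurable_EFinP) ltac:(by move=> w; rewrite lee_fin normc_ge0) ltac:(by []).
  rewrite -lee_fin; apply: le_trans B _; rewrite /eval_const EFinM.
  apply: lee_wpmul2l; first by rewrite lee_fin exprn_ge0// divr_ge0// sqr_ge0.
  have -> : (\int[mu]_w (normc (g w))%:E = \int[mu]_(w in Omega) (normc (g w))%:E)%E.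
    rewrite [RHS]integral_mkcond; apply: eq_integral => w _; rewrite patchE.
    case: ifPn => // /negP wO; rewrite bergman0 ?normc0// => ?; apply: wO; exact: mem_set.
  apply: (@le_trans _ _ (\int[mu]_(w in Omega) (1 + (normc (g w) ^+ 2)%:E))%E).
    apply: ge0_le_integral => //.
    - by move=> w _; rewrite lee_fin normc_ge0.
    - by apply/measurable_EFinP; exact: measurable_funTS.
    - apply: emeasurable_funD; first exact: measurable_cst.
      by apply/measurable_EFinP; apply: measurable_funX; exact: measurable_funTS.
    - move=> w _; rewrite -EFinD lee_fin; have := sqr_ge0 (normc (g w) - 1); have := sqr_ge0 (normc (g w)); nra.
  rewrite ge0_integralD//; first last.
  - by apply/measurable_EFinP; apply: measurable_funX; exact: measurable_funTS.
  - by move=> w _; rewrite lee_fin sqr_ge0.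
  rewrite integral_cst// mul1e -norm2_sqrE; last exact: bergman_SI.
  have -> : (fine (mu Omega) + 1)%:E = (mu Omega + 1)%E.
    by rewrite EFinD fineK// ge0_fin_numE// domain_measure_fin.
  by rewrite leeD2l// lee_fin expr_le1// norm2_ge0.
have [f0|fn0] := eqVneq (normR f) 0.
  have -> : f = 0 by apply/eqP; rewrite -normR_eq0 f0.
  by rewrite normR0 mulr0 [X in normc X](_ : _ = 0)// normc0.
have fp : 0 < normR f by rewrite lt_def fn0 normR_ge0.
have := main ((normR f)^-1%:C *: f).
rewrite normRZ normc_real gtr0_norm ?invr_gt0// mulVf// lexx => /(_ isT).
rewrite [X in normc X](_ : _ = (normR f)^-1%:C * f z)// normcM normc_real gtr0_norm ?invr_gt0//.
by rewrite mulrC ler_pdivrMr.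
Qed.

End bergman_space.

(** * Completeness of the Bergman space *)

Section bergman_complete.
Variables (R : realType) (n : nat) (Omega : domain R n).
Hypothesis Omega_bounded : bounded_set (domain_set Omega).
Local Notation Cn := 'rV[R[i]]_n.
Local Notation mu := (@complex_lebesgue R n).
Local Notation Re := complex.Re.
Local Notation Im := complex.Im.
Local Notation SI := (square_integrable Omega).
Local Notation norm2 := (L2norm Omega).
Local Notation A2 := (bergman Omega).
Implicit Types (f g : A2).

Let md := @domain_measurable R n Omega.

(** Halving the radius leaves a ball of fixed size inside the domain around every nearby point, so
    one constant serves all points and all functions. *)
Lemma bergman_local p : domain_set Omega p -> exists r C : R, [/\ 0 < r, 0 <= C &
  forall w, normR (w - p) < r -> domain_set Omega w /\ forall f, normc (f w) <= C * normR f].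
Proof.
move=> Op; have /nbhs_normRP[d d0 dO] := open_nbhs_nbhs (conj (@domain_open _ _ Omega) Op).
have d20 : 0 < d / 2 by rewrite divr_gt0.
exists (d / 2), (eval_const Omega (d / 2)); split => //; first exact: eval_const_ge0.
move=> w wp; split=> [|f].
  by apply: dO; apply: (lt_le_trans wp); rewrite ler_pdivrMr// ler_pMr// ler1n.
apply: eval_bound => // v vw; apply: dO.
rewrite -(subrK w v) -addrA (le_lt_trans (normRD _ _))// [d]splitr.
by rewrite ltrD.
Qed.

Lemma continuous_open_measurable (u : Cn -> R) :
  (forall z, domain_set Omega z -> {for z, continuous u}) -> measurable_fun Omega u.
Proof.
move=> cu _; apply: (measurability (@RGenOInfty.G R)) => //; first exact: RGenOInfty.measurableE.
move=> _ [_ [x ->] <-].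
have oS : open (domain_set Omega `&` u @^-1` `]x, +oo[%classic).
  rewrite openE => z [Oz]; rewrite /= in_itv/= andbT => xz.
  apply: filterI; first by apply: open_nbhs_nbhs; split => //; exact: domain_open.
  have := cu z Oz `]x, +oo[%classic; apply.
  by apply: open_nbhs_nbhs; split; [exact: interval_open|rewrite /= in_itv/= xz].
exact: sub_sigma_algebra oS.
Qed.

Lemma holomorphic_measurable (u : Cn -> R[i]) :
  (forall z, domain_set Omega z -> {for z, continuous u}) ->
  measurable_fun Omega (fun z => Re (u z)) /\ measurable_fun Omega (fun z => Im (u z)).
Proof.
move=> cu; split; apply: continuous_open_measurable => z /cu cz A /nbhs_ballP[e /= e0 eA].
  have /nbhs_normRP[d d0 dP] : nbhs z (u @^-1` [set w | normc (w - u z) < e]) by apply: cz; apply/nbhs_normcP; exists e.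
  apply/nbhs_normRP; exists d => // w /dP /= h; apply: eA.
  by rewrite /ball/= distrC -cReB; exact: le_lt_trans (Re_le_normc _) h.
have /nbhs_normRP[d d0 dP] : nbhs z (u @^-1` [set w | normc (w - u z) < e]) by apply: cz; apply/nbhs_normcP; exists e.
apply/nbhs_normRP; exists d => // w /dP /= h; apply: eA.
by rewrite /ball/= distrC -cImB; exact: le_lt_trans (Im_le_normc _) h.
Qed.

(** The differentials at [p] form a Cauchy sequence in each direction, being controlled by the norm
    of [u j - u k]. The quadratic remainder estimate is uniform in [k], so it passes to the
    limit. *)
Lemma bergman_limit (u : nat -> A2) (h : Cn -> R[i]) (B : R) :
  (forall k, normR (u k) <= B) ->
  (forall e : R, 0 < e -> exists N, forall j k, (N <= j)%N -> (N <= k)%N -> normR (u j - u k) <= e) ->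
  (forall z, domain_set Omega z -> seq_limit (fun k => u k z) (h z)) ->
  holomorphic_on Omega h.
Proof.
move=> uB uc uh p Op.
have [r [C [r0 C0 loc]]] := bergman_local Op.
have B0 : 0 <= B by apply: le_trans (normR_ge0 _) (uB 0%N).
have Est (f : A2) : (forall v, normc ('d f p v) <= 64 * (C * normR f) * normR v / r) /\
  forall v, normR v <= r / 8 ->
    normc (f (p + v) - f p) <= 128 * (C * normR f) * normR v / r /\
    normc (f (p + v) - f p - 'd f p v) <= 512 * (C * normR f) * normR v ^+ 2 / r ^+ 2.
  apply: holomorphic_estimates => // w wp; have [Ow fw] := loc w wp.
    exact: bergman_differentiable.
  exact: fw.
have dB (j k : nat) v : 'd (u j - u k : A2) p v = 'd (u j) p v - 'd (u k) p v.
  have := @diffB _ _ _ (u j : Cn -> R[i]) (u k) p (bergman_differentiable _ Op) (bergman_differentiable _ Op).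
  by move=> /(congr1 (fun F => F v)) /= <-.
have dc v : exists l, seq_limit (fun k => 'd (u k) p v) l.
  apply: complex_cauchy_limit => e e0.
  pose K := 64 * C * normR v / r + 1.
  have K0 : 0 < K by rewrite ltr_wpDl// divr_ge0 ?mulr_ge0 ?normR_ge0// ltW.
  have [N uN] := uc (e / K) (divr_gt0 e0 K0).
  exists N => j k Nj Nk; rewrite -dB (le_trans ((Est _).1 v))//.
  apply: (@le_trans _ _ (K * normR (u j - u k))); last by rewrite mulrC -ler_pdivlMr// uN.
  have -> : K * normR (u j - u k) = 64 * (C * normR (u j - u k)) * normR v / r + normR (u j - u k).
    by rewrite /K; ring.
  by rewrite lerDl normR_ge0.
have [L HL] := choice dc.
apply: (@differentiable_of_estimate _ _ h L p (64 * (C * B) / r) (512 * (C * B) / r ^+ 2) (Num.min (r / 8) (r / 2))).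
- by rewrite lt_min !divr_gt0.
- by apply: divr_ge0; [apply: mulr_ge0; [exact: ler0n|exact: mulr_ge0]|exact: sqr_ge0].
- move=> a v w; apply: (seq_limit_unique (HL _)).
  have := seq_limitD (seq_limitZ a (HL v)) (HL w).
  by congr seq_limit; apply/funext => k; rewrite linearP.
- move=> v; rewrite -[L v]subr0; apply: (seq_limit_le (N := 0%N) (HL v)) => k _.
  rewrite subr0 (le_trans ((Est _).1 v))//.
  rewrite [leRHS]mulrAC; apply: ler_wpM2r; first by rewrite invr_ge0 ltW.
  apply: ler_wpM2r; first exact: normR_ge0.
  by apply: ler_wpM2l; [exact: ler0n|exact: ler_wpM2l].
move=> v; rewrite le_min => /andP[v8 v2].
have Opv : domain_set Omega (p + v).
  have [|//] := loc (p + v); rewrite addrC addKr (le_lt_trans v2)//.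
  by rewrite ltr_pdivrMr// ltr_pMr// ltr1n.
have lim := seq_limitD (seq_limitD (uh _ Opv) (seq_limitZ (-1) (uh _ Op))) (seq_limitZ (-1) (HL v)).
rewrite !mulN1r in lim; rewrite -[_ - L v]subr0.
apply: (seq_limit_le (N := 0%N) lim) => k _.
rewrite subr0 !mulN1r (le_trans ((Est _).2 v v8).2)//.
rewrite [leRHS]mulrAC; apply: ler_wpM2r; first by rewrite invr_ge0 sqr_ge0.
apply: ler_wpM2r; first exact: sqr_ge0.
by apply: ler_wpM2l; [exact: ler0n|exact: ler_wpM2l].
Qed.

(** Bounded evaluations give a pointwise limit, which is holomorphic by [bergman_limit]; Fatou's
    lemma then turns the Cauchy condition into square integrability and norm convergence. *)
Theorem bergman_complete (u : nat -> A2) :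
  (forall e : R, 0 < e -> exists N, forall j k, (N <= j)%N -> (N <= k)%N -> normR (u j - u k) <= e) ->
  exists h, forall e : R, 0 < e -> exists N, forall k, (N <= k)%N -> normR (u k - h) <= e.
Proof.
move=> uc0.
wlog : u uc0 / exists B, forall k, normR (u k) <= B.
  move=> H; have [N uN] := uc0 1 ltr01.
  have [||h hh] := H (fun k => u (N + k)%N).
  - move=> e /uc0[M uM]; exists M => j k Mj Mk; apply: uM.
      by rewrite (leq_trans Mj)// leq_addl.
    by rewrite (leq_trans Mk)// leq_addl.
  - exists (normR (u N) + 1) => k; rewrite -(subrK (u N) (u (N + k)%N)) addrC.
    by rewrite (le_trans (normRD _ _))// lerD// uN// leq_addr.
  exists h => e /hh[M hM]; exists (N + M)%N => k NMk.
  have -> : k = (N + (k - N))%N by rewrite subnKC// (leq_trans _ NMk)// leq_addr.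
  by apply: hM; rewrite leq_subRL// (leq_trans _ NMk)// leq_addr.
move=> [B uB]; have uc := uc0.
have lim z : exists l, (domain_set Omega z -> seq_limit (fun k => u k z) l) /\ (~ domain_set Omega z -> l = 0).
  have [Oz|nOz] := pselect (domain_set Omega z); last by exists 0.
  have [r [C [r0 C0 loc]]] := bergman_local Oz.
  have [|_ loc'] := loc z; first by rewrite subrr normR0.
  have [|l Hl] := @complex_cauchy_limit R (fun k => u k z); last by exists l.
  move=> e e0; have K0 : 0 < C + 1 by rewrite ltr_wpDl.
  have [N uN] := uc _ (divr_gt0 e0 K0); exists N => j k Nj Nk.
  have := loc' (u j - u k); move=> /le_trans; apply.
  apply: (@le_trans _ _ ((C + 1) * normR (u j - u k))); first by rewrite ler_wpM2r ?normR_ge0// lerDl.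
  by rewrite mulrC -ler_pdivlMr// uN.
have [h Hh] := choice lim.
have uh z : domain_set Omega z -> seq_limit (fun k => u k z) (h z) by move=> /(Hh z).1.
have holh : holomorphic_on Omega h by exact: bergman_limit uB uc uh.
have [mh1 mh2] := @holomorphic_measurable h (fun z Oz => differentiable_continuous (holh z Oz)).
(* Fatou's lemma in [j] with [k] fixed; the index is shifted by [N] so that every term of the
   sequence obeys the bound. *)
have Fat k e : (exists N, forall j, (N <= j)%N -> normR (u k - u j) <= e) ->
    (\int[mu]_(z in Omega) (normc (u k z - h z) ^+ 2)%:E <= (e ^+ 2)%:E)%E.
  move=> [N uN].
  pose F j z := ((normc (u k z - u (N + j)%N z)) ^+ 2)%:E.
  have SIj j : SI (fun z => u k z - u (N + j)%N z) by apply: SI_B; exact: bergman_SI.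
  have mF j : measurable_fun Omega (F j).
    by apply/measurable_EFinP; apply: measurable_funX; exact: measurable_normc (SIj j).
  have F0 j z : domain_set Omega z -> (0 <= F j z)%E by move=> _; rewrite lee_fin sqr_ge0.
  have := fatou mu md mF F0.
  have -> : (\int[mu]_(z in Omega) limn_einf (F^~ z) = \int[mu]_(z in Omega) (normc (u k z - h z) ^+ 2)%:E)%E.
    apply: eq_integral => z; rewrite inE => Oz.
    have c1 : (fun j => normc (u k z - u (N + j)%N z)) @ \oo --> normc (u k z - h z).
      apply/cvgrPdist_le => e' e'0; have [M HM] := uh z Oz _ e'0.
      exists M => // j /= Mj; have h1 := HM (N + j)%N (leq_trans Mj (leq_addl _ _)).
      apply: le_trans h1; rewrite (_ : u (N + j)%N z - h z = (u k z - h z) - (u k z - u (N + j)%N z)); last by ring.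
      set x := u k z - h z; set y := u k z - _.
      by rewrite ler_norml lerNl opprB le_normcB andbT normcB le_normcB.
    have c2 : F^~ z @ \oo --> (normc (u k z - h z) ^+ 2)%:E.
      by apply: cvg_EFin; [exact: nearW|rewrite expr2; exact: cvgM].
    by have [-> _] := cvg_limn_einf_sup c2.
  move=> /le_trans; apply; rewrite limn_einf_lim; apply: lime_le; first exact: is_cvg_einfs.
  apply: nearW => j.
  apply: (@le_trans _ _ (\int[mu]_(x in Omega) F j x)%E).
    by apply: ereal_inf_lbound; exists j => /=.
  rewrite /F -(norm2_sqrE (SIj j)) lee_fin lerXn2r ?nnegrE ?norm2_ge0//.
    by apply: le_trans (normR_ge0 _) (uN N (leqnn _)).
  exact: (uN (N + j)%N (leq_addr _ _)).
have SIuh k : (exists N e, forall j, (N <= j)%N -> normR (u k - u j) <= e) -> SI (fun z => u k z - h z).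
  move=> [N [e uN]]; have [m1 m2 _] := bergman_SI (u k); split.
  - by under eq_fun do rewrite cReB; exact: measurable_funB.
  - by under eq_fun do rewrite cImB; exact: measurable_funB.
  - by apply: (le_lt_trans (Fat k e _)); [exists N|rewrite ltry].
have SIh : SI h.
  have [N uN] := uc 1 ltr01.
  rewrite (_ : h = (fun z => u N z - (u N z - h z))); last by apply/funext => z; ring.
  apply: SI_B; first exact: bergman_SI.
  by apply: SIuh; exists N, 1 => j Nj; exact: uN.
have hP : h \in bergman_pred Omega.
  by rewrite inE; split=> // z /(Hh z).2.
exists (Bergman hP) => e e0; have [N uN] := uc e e0; exists N => k Nk.
have := Fat k e ltac:(by exists N => j Nj; exact: uN).
have E : normR (u k - Bergman hP) = norm2 (fun z => u k z - h z) by [].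
rewrite -norm2_sqrE ?lee_fin -?E; last by apply: SIuh; exists N, e => j Nj; exact: uN.
by rewrite ler_pXn2r ?nnegrE ?normR_ge0// ltW.
Qed.

End bergman_complete.

(** * Riesz representation and the Bergman projection *)

Section bergman_projection.
Variables (R : realType) (n : nat) (Omega : domain R n).
Hypothesis Omega_bounded : bounded_set (domain_set Omega).
Local Notation Cn := 'rV[R[i]]_n.
Local Notation mu := (@complex_lebesgue R n).
Local Notation Re := complex.Re.
Local Notation Im := complex.Im.
Local Notation SI := (square_integrable Omega).
Local Notation dot := (L2dot Omega).
Local Notation norm2 := (L2norm Omega).
Local Notation A2 := (bergman Omega).
Implicit Types (f g h k : A2).

Let md := @domain_measurable R n Omega.
#[local] Hint Resolve bergman_SI : core.

Lemma normR_sqrD f g : normR (f + g) ^+ 2 = normR f ^+ 2 + normR g ^+ 2 + 2 * Re (dot f g).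
Proof.
apply: (@complexI R); rewrite -[LHS]dotff.
have -> : dot (f + g) (f + g) = dot (fun z => f z + g z) (fun z => f z + g z) by [].
have [fI gI] := (bergman_SI f, bergman_SI g).
rewrite dotDl// ?dotDr//; last exact: SI_D.
rewrite !dotff [dot g f]dotC//.
set x := dot f g.
have E : (2 * Re x)%:C = x + x^* by rewrite addcJ rmorphM rmorph_nat.
transitivity ((normR f ^+ 2)%:C + (normR g ^+ 2)%:C + (2 * Re x)%:C); last by rewrite !rmorphD.
by rewrite E; ring.
Qed.

Lemma bergman_dotZ (a : R[i]) f (u : Cn -> R[i]) : SI u -> dot (a *: f) u = a * dot f u.
Proof. move=> uI; exact: (dotZl a (bergman_SI f) uI). Qed.

Lemma bergman_dotD f g (u : Cn -> R[i]) : SI u -> dot (f + g) u = dot f u + dot g u.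
Proof. move=> uI; exact: (dotDl (bergman_SI f) (bergman_SI g) uI). Qed.

(** For the vector [h] sought, [J f] equals [|f - h| ^ 2 - |h| ^ 2]; so [h] is obtained as the limit
    of a minimizing sequence of [J], which is bounded below by [- C ^ 2]. *)
Lemma riesz (L : A2 -> R[i]) (C : R) : 0 <= C ->
  (forall f g, L (f + g) = L f + L g) -> (forall a f, L (a *: f) = a * L f) ->
  (forall f, normc (L f) <= C * normR f) ->
  exists h, forall k, dot k h = L k.
Proof.
move=> C0 LD LZ LC.
pose J f := normR f ^+ 2 - 2 * Re (L f).
have J_ge f : - C ^+ 2 <= J f.
  have := le_trans (ler_norm _) (le_trans (Re_le_normc _) (LC f)).
  rewrite /J; have := sqr_ge0 (normR f - C); nra.
have Jinf : has_inf (range J).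
  by split; [exists (J 0); exists 0|exists (- C ^+ 2) => _ [f _ <-]].
pose d := inf (range J).
have dJ f : d <= J f by apply: ge_inf; [case: Jinf|exists f].
have appr (j : nat) : exists f, J f <= d + j.+1%:R^-1.
  have [_ [f _ <-] Jf] := @inf_adherent _ (range J) (j.+1%:R^-1) ltac:(by rewrite invr_gt0) Jinf.
  by exists f; exact: ltW.
have [u uJ] := choice appr.
have Jadd f g : J (f + g) = J f + J g + 2 * Re (dot f g).
  by rewrite /J normR_sqrD LD cReD; ring.
have reZ (c : R) (z : R[i]) : Re (c%:C * z) = c * Re z by rewrite cReM /= mul0r subr0.
(* The parallelogram law, combined with [J m >= d] at the midpoint [m]. It makes the minimizing
   sequence Cauchy. *)
have par f g : normR (f - g) ^+ 2 <= 2 * (J f + J g - 2 * d).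
  pose m := (2^-1)%:C *: (f + g).
  have Jm := dJ m.
  have Em : J m = (normR f ^+ 2 + normR g ^+ 2 + 2 * Re (dot f g)) / 4 - Re (L f) - Re (L g).
    rewrite /J /m normRZ normc_real ger0_norm ?invr_ge0// exprMn normR_sqrD LZ reZ LD cReD.
    by field.
  have Es : normR (f - g) ^+ 2 = normR f ^+ 2 + normR g ^+ 2 - 2 * Re (dot f g).
    rewrite -scaleN1r normR_sqrD normRZ normcN normc1 mul1r; congr (_ + _).
    have -> : dot f (-1 *: g) = - dot f g.
      rewrite [LHS]dotC// bergman_dotZ// mulN1r [dot f g]dotC//; exact: rmorphN.
    by rewrite cReN mulrN.
  move: Jm; rewrite Em Es /J; lra.
have uc (e : R) : 0 < e -> exists N, forall j k : nat, (N <= j)%N -> (N <= k)%N -> normR (u j - u k) <= e.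
  move=> e0; have e4 : 0 < e ^+ 2 / 4 by rewrite divr_gt0// exprn_gt0.
  have [N HN] := ltr_add_invr (y := 0) (x := e ^+ 2 / 4) e4.
  rewrite add0r in HN; exists N => j k Nj Nk.
  have inv i : (N <= i)%N -> i.+1%:R^-1 <= e ^+ 2 / 4.
    by move=> Ni; rewrite (le_trans _ (ltW HN))// lef_pV2 ?posrE// ler_nat.
  rewrite -(@ler_pXn2r _ 2) ?nnegrE ?normR_ge0// ?(ltW e0)//.
  apply: (le_trans (par _ _)).
  move: (uJ j) (uJ k) (inv _ Nj) (inv _ Nk).
  move: (J (u j)) (J (u k)) (j.+1%:R^-1) (k.+1%:R^-1) => a b x y; clear; move: (e ^+ 2) => c; lra.
have [h uh] := bergman_complete Omega_bounded uc.
exists h => k; apply/eqP; rewrite -subr_eq0 -normc_eq0 eq_le normc_ge0 andbT.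
(* Since [u j] is nearly minimal, a perturbation along [k] with coefficient [- s] times the
   conjugate of the defect [w] cannot lower [J] by more than [1 / (j + 1)]. As [s * |k| ^ 2 <= 1],
   the second-order term is at most half the first-order gain [2 * s * |w| ^ 2], which bounds
   [w]. *)
have var j : normc (dot k (u j) - L k) ^+ 2 <= (normR k ^+ 2 + 1) * j.+1%:R^-1.
  set w := dot k (u j) - L k.
  pose s := (normR k ^+ 2 + 1)^-1.
  have K0 : 0 < normR k ^+ 2 + 1 by rewrite ltr_wpDl ?sqr_ge0.
  have s0 : 0 < s by rewrite invr_gt0.
  have := dJ (u j + (- s%:C * w^*) *: k).
  rewrite Jadd {2}/J normRZ normcM normcN normc_real gtr0_norm// normc_conj LZ.
  rewrite dotC// bergman_dotZ// => H.
  have E : Re ((- s%:C * w^* * dot k (u j))^*) - Re (- s%:C * w^* * L k) = - (s * normc w ^+ 2).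
    have -> : Re ((- s%:C * w^* * dot k (u j))^*) = Re (- s%:C * w^* * dot k (u j)).
      by case: (- s%:C * w^* * dot k (u j)).
    by rewrite -cReB -mulrBr -/w -mulrA [w^* * w]mulrC conj_normc mulNr cReN reZ.
  have s1 : s * normR k ^+ 2 <= 1 by rewrite /s mulrC ler_pdivrMr// mul1r lerDl.
  have h1 : s ^+ 2 * normc w ^+ 2 * normR k ^+ 2 <= s * normc w ^+ 2.
    rewrite (_ : s ^+ 2 * _ * _ = s * normc w ^+ 2 * (s * normR k ^+ 2)); last by ring.
    by rewrite ler_piMr// mulr_ge0 ?sqr_ge0// ltW.
  have h2 : s * normc w ^+ 2 <= j.+1%:R^-1.
    move: H E h1 (uJ j); rewrite !exprMn.
    move: (s ^+ 2 * _ * _) (s * normc w ^+ 2) (Re (_ ^*)) (Re (_ * L k)) (J (u j)) (j.+1%:R^-1).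
    move=> P Q a b c x; clear; lra.
  by rewrite mulrC -ler_pdivrMr// mulrC.
apply/ler_addgt0Pr => e e0; rewrite add0r.
have e20 : 0 < e / 2 by rewrite divr_gt0.
have kk : 0 < normR k + 1 by rewrite ltr_wpDl ?normR_ge0.
have [N1 H1] := uh (e / 2 / (normR k + 1)) (divr_gt0 e20 kk).
have K0 : 0 < normR k ^+ 2 + 1 by rewrite ltr_wpDl ?sqr_ge0.
have [N2 H2] := ltr_add_invr (y := 0) (x := (e / 2) ^+ 2 / (normR k ^+ 2 + 1)) ltac:(by rewrite divr_gt0// exprn_gt0).
rewrite add0r in H2.
pose j := maxn N1 N2.
have j1 : normR (u j - h) <= e / 2 / (normR k + 1) by apply: H1; exact: leq_maxl.
have j2 : j.+1%:R^-1 <= (e / 2) ^+ 2 / (normR k ^+ 2 + 1).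
  by rewrite (le_trans _ (ltW H2))// lef_pV2 ?posrE// ler_nat ltnS leq_maxr.
have D : dot k (u j) - dot k h = dot k (u j - h) by rewrite -dotBr.
rewrite (_ : dot k h - L k = (dot k (u j) - L k) - (dot k (u j) - dot k h)); last by ring.
rewrite (le_trans (le_normcD _ _))// normcN [e]splitr lerD//.
  rewrite -(@ler_pXn2r _ 2) ?nnegrE ?normc_ge0// ?(ltW e20)//.
  apply: (le_trans (var j)); rewrite mulrC -ler_pdivlMr//.
rewrite D (le_trans (cauchy_schwarz _ _))//.
apply: (@le_trans _ _ ((normR k + 1) * normR (u j - h))); last by rewrite mulrC -ler_pdivlMr.
by apply: ler_wpM2r; [exact: norm2_ge0|rewrite lerDl].
Qed.

Lemma bergman_dot_inj f g : (forall k, dot f k = dot g k) -> f = g.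
Proof.
move=> fg; apply/eqP; rewrite -subr_eq0 -normR_eq0 -sqrf_eq0; apply/eqP.
apply: (@complexI R); rewrite -[LHS]dotff.
have E : dot (f - g) (f - g) = dot f (f - g) - dot g (f - g).
  exact: (dotBl (bergman_SI f) (bergman_SI g) (bergman_SI (f - g))).
by rewrite E fg subrr.
Qed.

(** The Riesz vector of [k |-> dot k u] belongs to the set in the definition of [bergman_proj], so
    [xget] returns a member of that set and not its default. *)
Lemma bergman_projP (u : Cn -> R[i]) : SI u -> forall k, dot (bergman_proj Omega u) k = dot u k.
Proof.
move=> uI.
have [h Hh] : exists h : A2, forall k, dot k h = dot k u.
  apply: (@riesz (fun k => dot k u) (norm2 u)); first exact: norm2_ge0.
  - by move=> f g; rewrite bergman_dotD.
  - by move=> a f; rewrite bergman_dotZ.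
  - by move=> f; rewrite mulrC; exact: cauchy_schwarz.
have : [set h : A2 | forall k : A2, dot (fun z => u z - bergman_fun h z) (bergman_fun k) = 0] (bergman_proj Omega u).
  apply: (@xgetPex _ 0); exists h => k /=.
  by rewrite dotBl// [dot u k]dotC// [dot h k]dotC// Hh subrr.
move=> /= H k; have := H k; rewrite dotBl// => /eqP; rewrite subr_eq0 => /eqP ->//.
Qed.

Lemma bergman_proj_norm (u : Cn -> R[i]) : SI u -> normR (bergman_proj Omega u) <= norm2 u.
Proof.
move=> uI; set p := bergman_proj _ _.
have [->|p0] := eqVneq (normR p) 0; first exact: norm2_ge0.
have pp : 0 < normR p by rewrite lt_def p0 normR_ge0.
rewrite -(ler_pM2r pp) -expr2.
have -> : normR p ^+ 2 = normc (dot p p) by rewrite dotff normc_real ger0_norm// sqr_ge0.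
by rewrite bergman_projP// cauchy_schwarz.
Qed.

Lemma bergman_projD (u v : Cn -> R[i]) : SI u -> SI v ->
  bergman_proj Omega (fun z => u z + v z) = bergman_proj Omega u + bergman_proj Omega v.
Proof.
move=> uI vI; apply: bergman_dot_inj => k.
rewrite bergman_projP; last exact: SI_D.
by rewrite dotDl// bergman_dotD// !bergman_projP.
Qed.

Lemma bergman_projZ (a : R[i]) (u : Cn -> R[i]) : SI u ->
  bergman_proj Omega (fun z => a * u z) = a *: bergman_proj Omega u.
Proof.
move=> uI; apply: bergman_dot_inj => k.
rewrite bergman_projP; last exact: SI_Z.
by rewrite dotZl// bergman_dotZ// !bergman_projP.
Qed.

Definition bounded_symbol (psi : Cn -> R[i]) (M : R) :=
  [/\ measurable_fun Omega (fun z => Re (psi z)), measurable_fun Omega (fun z => Im (psi z)) &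
    forall z, domain_set Omega z -> normc (psi z) <= M].

Lemma symbol_mul (psi u : Cn -> R[i]) (M : R) : 0 <= M -> bounded_symbol psi M -> SI u ->
  SI (fun z => psi z * u z) /\ norm2 (fun z => psi z * u z) <= M * norm2 u.
Proof.
move=> M0 [p1 p2 pM] uI; have [u1 u2 uf] := uI.
have mu2 := measurable_normc uI.
have m1 : measurable_fun Omega (fun z => Re (psi z * u z)).
  by under eq_fun do rewrite cReM; apply: measurable_funB; exact: measurable_funM.
have m2 : measurable_fun Omega (fun z => Im (psi z * u z)).
  by under eq_fun do rewrite cImM; apply: measurable_funD; exact: measurable_funM.
have mn : measurable_fun Omega (fun z => (normc (psi z * u z) ^+ 2)%:E).
  apply/measurable_EFinP; under eq_fun do rewrite sqr_normcE.
  by apply: measurable_funD; exact: measurable_funX.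
have le : (\int[mu]_(z in Omega) (normc (psi z * u z) ^+ 2)%:E <=
    (M ^+ 2)%:E * \int[mu]_(z in Omega) (normc (u z) ^+ 2)%:E)%E.
  rewrite -ge0_integralZl//; first last.
  - by rewrite lee_fin sqr_ge0.
  - by move=> z _; rewrite lee_fin sqr_ge0.
  - by apply/measurable_EFinP; exact: measurable_funX.
  apply: ge0_le_integral => //.
  - by move=> z _; rewrite lee_fin sqr_ge0.
  - by apply: measurable_funeM; apply/measurable_EFinP; exact: measurable_funX.
  - move=> z Oz; rewrite -EFinM lee_fin normcM exprMn ler_wpM2r ?sqr_ge0//.
    by rewrite ler_pXn2r ?nnegrE ?normc_ge0// pM.
have I : SI (fun z => psi z * u z).
  split => //; apply: (le_lt_trans le).
  by rewrite lte_mul_pinfty// lee_fin sqr_ge0.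
split => //; rewrite -(@ler_pXn2r _ 2) ?nnegrE ?norm2_ge0 ?mulr_ge0 ?norm2_ge0//.
by rewrite -lee_fin exprMn norm2_sqrE// [X in (_ <= X)%E]EFinM norm2_sqrE.
Qed.

End bergman_projection.

(** * Upper bound *)

Section complex_compact.
Variable R : realType.

Lemma compact_complex_box (r : R) :
  compact [set z : R[i] | -r <= complex.Re z <= r /\ -r <= complex.Im z <= r].
Proof.
rewrite (_ : mkset _ = (fun p : R * R => p.1 +i* p.2) @` (`[-r, r]%classic `*` `[-r, r]%classic)).
  apply: continuous_compact; last by apply: compact_setX; exact: segment_compact.
  apply: continuous_subspaceT => p A /nbhs_normcP[e e0 eA].
  have e2 : 0 < e / 2 by rewrite divr_gt0.
  apply/nbhs_ballP; exists (e / 2) => //= q [q1 q2]; apply: eA.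
  rewrite (le_lt_trans (normc_le_ReIm _))// cReB cImB/= [e]splitr ltrD//.
    by rewrite distrC.
  by rewrite distrC.
apply/seteqP; split => [[x y] /= [hx hy]|_ [[x y] /= [hx hy] <-]].
  by exists (x, y) => //; split; rewrite /= in_itv.
by rewrite /= !in_itv/= in hx hy.
Qed.

Lemma compact_rV_box n (r : R) :
  compact [set v : 'rV[R[i]]_n | forall i, -r <= complex.Re (v ord0 i) <= r /\ -r <= complex.Im (v ord0 i) <= r].
Proof.
exact: (@rV_compact R[i] n (fun=> [set z | -r <= complex.Re z <= r /\ -r <= complex.Im z <= r])
  (fun=> @compact_complex_box r)).
Qed.

Lemma compact_bounded_closed n (A : set 'rV[R[i]]_n) (r : R) :
  closed A -> (forall z, A z -> normR z <= r) -> compact A.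
Proof.
move=> cA Ar; apply: (subclosed_compact cA (@compact_rV_box n r)) => z /Ar zr i.
have := le_trans (normc_le_normR_rV z i) zr => h.
have := le_trans (Re_le_normc _) h; have := le_trans (Im_le_normc _) h.
by rewrite !ler_norml.
Qed.

Lemma compact_finite_cover (T : ptopologicalType) (K : set T) (B : T -> set T) :
  compact K -> (forall p, K p -> open (B p) /\ B p p) ->
  exists s : seq T, (forall p, p \in s -> K p) /\ forall z, K z -> exists2 p, p \in s & B p z.
Proof.
rewrite compact_cover => cK KB.
have [||D DK cov] := cK T K B.
- by move=> p /KB[].
- by move=> p Kp; exists p => //; have [] := KB p Kp.
exists (finmap.enum_fset D); split=> [p pD|z /cov[p /= pD Bz]].
  by have := DK p pD; rewrite inE.
by exists p.
Qed.

Lemma closure_normRP (V : normedModType R[i]) (A : set V) (p : V) :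
  closure A p <-> forall e : R, 0 < e -> exists2 z, A z & normR (z - p) < e.
Proof.
split=> [cp e e0|cp B /nbhs_normRP[e e0 eB]].
  have [|z [Az /= ze]] := cp [set z | normR (z - p) < e]; last by exists z.
  by apply/nbhs_normRP; exists e.
by have [z Az ze] := cp e e0; exists z; split => //; exact: eB.
Qed.

Lemma open_normRP (V : normedModType R[i]) (A : set V) :
  open A <-> forall p, A p -> exists2 e : R, 0 < e & forall z, normR (z - p) < e -> A z.
Proof.
rewrite openE; split=> [oA p /oA/nbhs_normRP//|oA p /oA pA].
by apply/nbhs_normRP.
Qed.

Lemma open_normR_ball (V : normedModType R[i]) (p : V) (e : R) : open [set z | normR (z - p) < e].
Proof.
apply/open_normRP => q /= qe; exists (e - normR (q - p)); first by rewrite subr_gt0.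
move=> z zq; rewrite -(subrK q z) -addrA (le_lt_trans (normRD _ _))//.
by rewrite -ltrBrDr.
Qed.

End complex_compact.

(** * Gram-Schmidt and finite rank operators *)

Section orthonormal.
Variables (R : realType) (n : nat) (Omega : domain R n).
Hypothesis Omega_bounded : bounded_set (domain_set Omega).
Local Notation dot := (L2dot Omega).
Local Notation A2 := (bergman Omega).
Implicit Types (f g h : A2) (s : seq A2).
#[local] Hint Resolve bergman_SI : core.

(** This is an orthogonal projection only for suitable [s], such as orthonormal families. *)
Definition span_proj s f : A2 := \sum_(x <- s) dot f x *: x.

Lemma dot_conj f g : dot f g = (dot g f)^*. Proof. exact: dotC. Qed.

Lemma bdotD f g h : dot (f + g) h = dot f h + dot g h.
Proof. exact: bergman_dotD. Qed.
Lemma bdotB f g h : dot (f - g) h = dot f h - dot g h.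
Proof. exact: (dotBl (bergman_SI f) (bergman_SI g) (bergman_SI h)). Qed.
Lemma bdotZ a f h : dot (a *: f) h = a * dot f h.
Proof. exact: bergman_dotZ. Qed.
Lemma bdot0 h : dot (0 : A2) h = 0.
Proof. by rewrite -(scale0r (0 : A2)) bdotZ mul0r. Qed.

Lemma span_proj_orth f g s : (forall x, x \in s -> dot f x = 0) -> dot f (span_proj s g) = 0.
Proof.
move=> fs; rewrite dot_conj /span_proj; suff -> : dot (\sum_(x <- s) dot g x *: x) f = 0 by exact: conjc0.
elim: s fs => [|x s IH] fs; first by rewrite big_nil bdot0.
rewrite big_cons bdotD bdotZ IH; last by move=> y ys; apply: fs; rewrite inE ys orbT.
by rewrite [dot x f]dot_conj fs ?mem_head// [X in _ * X]conjc0 mulr0 addr0.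
Qed.

(** The first property stands in for orthonormality of [s] and is all that the projection arguments
    require. The second makes remainders orthogonal to the original vectors; for vectors
    representing evaluations, it makes remainders vanish at the chosen points. *)
Lemma gram_schmidt (hs : seq A2) : exists s,
  (forall f x, x \in s -> dot (f - span_proj s f) x = 0) /\
  (forall f h, h \in hs -> dot (f - span_proj s f) h = 0).
Proof.
elim: hs => [|h hs [s [os oh]]]; first by exists [::].
pose g := h - span_proj s h.
(* If [g = 0], then [h] already equals its projection and no vector is added; otherwise the
   normalized [g] is. *)
have [g0|gn0] := eqVneq g 0.
  exists s; split=> // f h'; rewrite inE => /orP[/eqP ->|]; last exact: oh.
  have -> : h = span_proj s h by apply/eqP; rewrite -subr_eq0; exact/eqP.
  by apply: span_proj_orth => x; exact: os.
have gp : 0 < normR g by rewrite normR_gt0.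
pose e := (normR g)^-1%:C *: g.
have ge : g = (normR g)%:C *: e.
  by rewrite /e scalerA -rmorphM divff ?gt_eqF// scale1r.
have es x : x \in s -> dot e x = 0 by move=> xs; rewrite bdotZ os// mulr0.
have eh h' : h' \in hs -> dot e h' = 0 by move=> xs; rewrite bdotZ oh// mulr0.
have ee : dot e e = 1.
  rewrite dotff -normR_bergman normRZ normc_real gtr0_norm ?invr_gt0//.
  by rewrite mulVf ?gt_eqF// expr1n.
have projE f : f - span_proj (e :: s) f = (f - span_proj s f) - dot f e *: e.
  by rewrite /span_proj big_cons opprD addrA addrAC.
have fe f : dot (f - span_proj (e :: s) f) e = 0.
  rewrite projE !bdotB bdotZ ee mulr1 [dot (span_proj s f) e]dot_conj.
  by rewrite (span_proj_orth f es) [X in _ - X - _]conjc0 subr0 subrr.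
exists (e :: s); split=> f x; rewrite inE => /orP[/eqP ->|xs].
- exact: fe.
- by rewrite projE bdotB os// bdotZ es// mulr0 subr0.
- have -> : h = span_proj s h + (normR g)%:C *: e by rewrite -ge addrC subrK.
  have H1 : dot (f - span_proj (e :: s) f) (span_proj s h) = 0.
    apply: span_proj_orth => y ys.
    by rewrite projE bdotB os// bdotZ es// mulr0 subr0.
  have H0 (c : R[i]) : (0^* + c * 0^*)^* = 0.
    by case: c => c1 c2; apply/eqP; rewrite eq_complex /=; apply/andP; split; apply/eqP; ring.
  rewrite dot_conj bdotD bdotZ [dot (span_proj s h) _]dot_conj H1 [dot e _]dot_conj fe.
  exact: H0.
- by rewrite projE bdotB oh// bdotZ eh// mulr0 subr0.
Qed.

Lemma span_proj_contract s f : (forall f x, x \in s -> dot (f - span_proj s f) x = 0) ->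
  normR (f - span_proj s f) <= normR f.
Proof.
move=> os; rewrite -(@ler_pXn2r _ 2) ?nnegrE ?normR_ge0//.
rewrite -[in leRHS](subrK (span_proj s f) f) [in leRHS]normR_sqrD.
rewrite (span_proj_orth f (os f)) /= mulr0 addr0 lerDl sqr_ge0//.
Qed.

Lemma finite_rank_linear s (T : A2 -> A2) : linear (fun f => \sum_(x <- s) dot f x *: T x).
Proof.
move=> a f g; rewrite scaler_sumr -big_split/=.
apply: eq_bigr => x _; rewrite scalerA -scalerDl; congr (_ *: _).
exact: etrans (bdotD _ _ _) (congr1 (fun y => y + _) (bdotZ _ _ _)).
Qed.

(** On the unit ball the coefficients [dot f x] stay in a bounded box of a finite-dimensional space,
    and the continuous image of that box is compact. *)
Lemma finite_rank_compact s (T : A2 -> A2) (S : {linear A2 -> A2}) :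
  (forall f, S f = \sum_(x <- s) dot f x *: T x) -> compact_operator S.
Proof.
move=> SE.
pose m := size s.
pose v (i : 'I_m) := T (tnth (in_tuple s) i).
pose phi (c : 'rV[R[i]]_m) : A2 := \sum_(i < m) c ord0 i *: v i.
pose r : R := \sum_(i < m) normR (tnth (in_tuple s) i).
pose K := phi @` [set c : 'rV[R[i]]_m | forall i, -r <= complex.Re (c ord0 i) <= r /\ -r <= complex.Im (c ord0 i) <= r].
have cK : compact K.
  apply: continuous_compact; last exact: compact_rV_box.
  apply: continuous_subspaceT => c A /nbhs_normRP[e e0 eA]; apply/nbhs_normRP.
  pose B := \sum_(i < m) normR (v i) + 1.
  have B0 : 0 < B by rewrite ltr_wpDl// sumr_ge0// => i _; exact: normR_ge0.
  exists (e / B); first exact: divr_gt0.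
  move=> w wc; apply: eA; rewrite /phi -sumrB.
  apply: (@le_lt_trans _ _ (normR (w - c) * B)); last by rewrite -ltr_pdivlMr.
  rewrite /B mulrDr mulr1 mulr_sumr.
  apply: (@le_trans _ _ (\sum_(i < m) normR (w - c) * normR (v i))); last by rewrite lerDl normR_ge0.
  apply: (big_ind2 (fun (x : A2) (y : R) => normR x <= y)) => [|x x' y y' h h'|i _].
  - by rewrite normR0.
  - by rewrite (le_trans (normRD _ _))// lerD.
  - rewrite -scalerBl normRZ ler_wpM2r ?normR_ge0//.
    by have := normc_le_normR_rV (w - c) i; rewrite !mxE.
exists K; last by split => //; apply: compact_closed => //; exact: norm_hausdorff.
move=> _ [f /= f1 <-].
exists (\row_i dot f (tnth (in_tuple s) i)); last first.
  by rewrite /phi SE [RHS]big_tnth; apply: eq_bigr => i _; rewrite mxE.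
move=> i; rewrite mxE.
have fn : normR f <= 1 by rewrite -lecR -normRE.
have b : normc (dot f (tnth (in_tuple s) i)) <= r.
  apply: (le_trans (cauchy_schwarz _ _)) => //.
  apply: (@le_trans _ _ (1 * normR (tnth (in_tuple s) i))).
    by apply: ler_wpM2r => //; exact: norm2_ge0.
  rewrite mul1r /r (bigD1 i)//= lerDl sumr_ge0// => j _; exact: normR_ge0.
have := le_trans (Re_le_normc _) b; have := le_trans (Im_le_normc _) b.
by rewrite !ler_norml.
Qed.

End orthonormal.

Section upper_bound.
Variables (R : realType) (n : nat) (Omega : domain R n).
Hypothesis Omega_bounded : bounded_set (domain_set Omega).
Local Notation Cn := 'rV[R[i]]_n.
Local Notation mu := (@complex_lebesgue R n).
Local Notation Re := complex.Re.
Local Notation Im := complex.Im.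
Local Notation SI := (square_integrable Omega).
Local Notation dot := (L2dot Omega).
Local Notation norm2 := (L2norm Omega).
Local Notation A2 := (bergman Omega).
Local Notation O := (domain_set Omega).
#[local] Hint Resolve bergman_SI : core.

Let md := @domain_measurable R n Omega.

Lemma closure_domain_bounded : exists r : R, forall z, closure O z -> normR z <= r.
Proof.
have [M [Mr OM]] := Omega_bounded.
pose r : R := Re M + 1.
have MR : M = (Re M)%:C by rewrite RRe_real.
have ltM : M < r%:C by rewrite {1}MR ltcR ltrDl.
have Or z : O z -> normR z <= r by move=> /(OM _ ltM) zr; rewrite -lecR -normRE.
exists r => z /closure_normRP cz; apply/ler_addgt0Pr => e e0.
have [w Ow wz] := cz e e0; rewrite -(subrK w z) addrC (le_trans (normRD _ _))// lerD ?Or//.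
by rewrite normRB ltW.
Qed.

Lemma compact_closure_domain : compact (closure O).
Proof.
have [r Or] := closure_domain_bounded.
by apply: compact_bounded_closed Or; exact: closed_closure.
Qed.

Lemma within_continuous_normR (A : set Cn) (psi : Cn -> R[i]) :
  {within A, continuous psi} -> forall p, A p -> forall e : R, 0 < e ->
  exists2 d : R, 0 < d & forall w, A w -> normR (w - p) < d -> normc (psi w - psi p) < e.
Proof.
move=> /subspace_continuousP cpsi p Ap e e0.
have : (psi @ within A (nbhs p)) [set w | normc (w - psi p) < e].
  by apply: (cpsi p Ap); apply/nbhs_normcP; exists e.
by move=> /nbhs_normRP[d d0 dP]; exists d => // w Aw wp; exact: dP.
Qed.

Lemma symbol_bounded (psi : Cn -> R[i]) : {within closure O, continuous psi} ->
  exists2 M : R, 0 <= M & forall z, closure O z -> normc (psi z) <= M.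
Proof.
move=> cpsi.
have H p : exists d : R, 0 < d /\ (closure O p -> forall w, closure O w -> normR (w - p) < d -> normc (psi w - psi p) < 1).
  have [cp|ncp] := pselect (closure O p); last by exists 1; split=> [|/ncp]; [exact: ltr01|case].
  have [d d0 dP] := within_continuous_normR cpsi cp ltr01.
  by exists d; split=> [|_]; [exact: d0|exact: dP].
have [d dP] := choice H.
have [|s [sK cov]] := @compact_finite_cover _ (closure O) (fun p => [set z | normR (z - p) < d p]) compact_closure_domain.
  by move=> p cp; split; [exact: open_normR_ball|rewrite /= subrr normR0; have [] := dP p].
exists (\sum_(p <- s) (normc (psi p) + 1)).
  by apply: sumr_ge0 => p _; rewrite addr_ge0// normc_ge0.
move=> z cz; have [p ps /= zp] := cov z cz.
apply: (@le_trans _ _ (normc (psi p) + 1)).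
  rewrite -(subrK (psi p) (psi z)) addrC (le_trans (le_normcD _ _))// lerD//; apply: ltW.
  exact: ((dP p).2 (sK _ ps) z cz zp).
rewrite (big_rem p)//= lerDl sumr_ge0// => q _; by rewrite addr_ge0// normc_ge0.
Qed.

Lemma symbol_measurable (psi : Cn -> R[i]) : {within closure O, continuous psi} ->
  measurable_fun Omega (fun z => Re (psi z)) /\ measurable_fun Omega (fun z => Im (psi z)).
Proof.
move=> cpsi; apply: holomorphic_measurable => z Oz A /nbhs_normcP[e e0 eA].
have [d d0 dP] := within_continuous_normR cpsi (subset_closure Oz) e0.
have [d' d'0 d'O] := (open_normRP O).1 (@domain_open _ _ Omega) z Oz.
apply/nbhs_normRP; exists (Num.min d d'); first by rewrite lt_min d0.
move=> w; rewrite lt_min => /andP[wd wd']; apply: eA; apply: dP => //.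
by apply: subset_closure; exact: d'O.
Qed.

(** A Lipschitz bound from [holomorphic_estimates]: near [p] every [f] is bounded by [C * normR f]
    with [C] independent of [f], hence so is the radius. *)
Lemma bergman_equicontinuous p (e : R) : O p -> 0 < e -> exists2 r : R, 0 < r &
  forall w, normR (w - p) < r -> forall f : A2, normc (f w - f p) <= e * normR f.
Proof.
move=> Op e0; have [r [C [r0 C0 loc]]] := bergman_local Omega_bounded Op.
pose K := 128 * C / r + 1.
have K0 : 0 < K by apply: ltr_wpDl; [apply: divr_ge0; [apply: mulr_ge0; [exact: ler0n|]|exact: ltW]|exact: ltr01].
exists (Num.min (r / 8) (e / K)); first by rewrite lt_min !divr_gt0.
move=> w; rewrite lt_min => /andP[w1 w2] f.
have [||_ H] := @holomorphic_estimates _ _ f p r (C * normR f) r0.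
- by move=> v vp; apply: bergman_differentiable; have [] := loc v vp.
- by move=> v vp; have [_] := loc v vp; apply.
have [H1 _] := H (w - p) (ltW w1).
rewrite (_ : p + (w - p) = w) in H1; last by rewrite addrC subrK.
apply: (le_trans H1).
rewrite (_ : 128 * (C * normR f) * normR (w - p) / r = (128 * C / r) * normR (w - p) * normR f); last by ring.
apply: ler_wpM2r; first exact: normR_ge0.
apply: (@le_trans _ _ (K * normR (w - p))); first by rewrite ler_wpM2r ?normR_ge0// lerDl.
by rewrite mulrC -ler_pdivlMr// ltW.
Qed.

Lemma evaluation_riesz p : O p -> exists h : A2, forall f : A2, dot f h = f p.
Proof.
move=> Op; have [r [C [r0 C0 loc]]] := bergman_local Omega_bounded Op.
have [|_ H] := loc p; first by rewrite subrr normR0.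
exact: (@riesz _ _ _ Omega_bounded (fun f : A2 => f p) C).
Qed.

Lemma norm2_le_cst (u : Cn -> R[i]) (c : R) : 0 <= c -> SI u ->
  (forall z, O z -> normc (u z) <= c) -> norm2 u <= c * (fine (mu Omega) + 1).
Proof.
move=> c0 uI uc; have V0 : 0 <= fine (mu Omega) by exact: fine_ge0.
rewrite -(@ler_pXn2r _ 2) ?nnegrE ?norm2_ge0 ?mulr_ge0 ?addr_ge0//.
rewrite -lee_fin norm2_sqrE//.
apply: (@le_trans _ _ (\int[mu]_(z in Omega) (c ^+ 2)%:E)%E).
  apply: ge0_le_integral => //.
  - by move=> z _; rewrite lee_fin sqr_ge0.
  - by apply/measurable_EFinP; apply: measurable_funX; exact: measurable_normc.
  - by move=> z Oz; rewrite lee_fin ler_pXn2r ?nnegrE ?normc_ge0// uc.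
rewrite integral_cst//.
have Vf : mu Omega \is a fin_num by rewrite ge0_fin_numE// domain_measure_fin.
rewrite -[X in (_ * X)%E](fineK Vf) -EFinM lee_fin exprMn ler_wpM2l ?sqr_ge0//= expr2.
have := sqr_ge0 (fine (mu Omega)); nra.
Qed.

Lemma toeplitz_linear (psi : Cn -> R[i]) (M : R) : 0 <= M -> bounded_symbol Omega psi M ->
  linear (toeplitz psi : A2 -> A2).
Proof.
move=> M0 bpsi a f g; rewrite /toeplitz.
have If := (symbol_mul M0 bpsi (bergman_SI f)).1.
have Ig := (symbol_mul M0 bpsi (bergman_SI g)).1.
rewrite -bergman_projZ// -bergman_projD//; last exact: SI_Z.
by congr bergman_proj; apply/funext => z; rewrite [bergman_fun (a *: f + g) z](_ : _ = a * f z + g z)//; ring.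
Qed.

Theorem essential_norm_le (psi : Cn -> R[i]) (M e : R) : {within closure O, continuous psi} ->
  0 <= M -> (forall z, boundary O z -> normc (psi z) <= M) -> 0 < e ->
  (essential_norm (toeplitz (Omega := Omega) psi) <= (M + e)%:E)%E.
Proof.
move=> cpsi M0 bM e0; have e20 : 0 < e / 2 by rewrite divr_gt0.
have [Mp Mp0 psiM] := symbol_bounded cpsi.
pose K := [set z | closure O z /\ M + e / 2 <= normc (psi z)].
have KO z : K z -> O z.
  move=> [cz zM]; apply: contrapT => nOz.
  have : boundary O z by split=> // /interior_subset.
  by move=> /bM; rewrite leNgt => /negP; apply; apply: lt_le_trans zM; rewrite ltrDl.
have cK : closed K.
  move=> p /closure_normRP cp.
  have cOp : closure O p.
    apply/closure_normRP => d d0; have [z [/closure_normRP cz _] zp] := cp (d / 2) ltac:(by rewrite divr_gt0).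
    have [w Ow wz] := cz (d / 2) ltac:(by rewrite divr_gt0).
    exists w => //; rewrite -(subrK z w) -addrA (le_lt_trans (normRD _ _))// [d]splitr ltrD//.
  split => //; apply/ler_addgt0Pr => d d0.
  have [r r0 rP] := within_continuous_normR cpsi cOp d0.
  have [z [cz zM] zp] := cp r r0.
  apply: (le_trans zM); rewrite -(subrK (psi p) (psi z)) addrC (le_trans (le_normcD _ _))// lerD//.
  by apply/ltW; exact: rP.
have compK : compact K.
  by apply: (subclosed_compact cK compact_closure_domain) => z [].
have mK : measurable K.
  by rewrite -[K]setCK; apply: measurableC; apply: sub_sigma_algebra; exact: closed_openC.
have [mp1 mp2] := symbol_measurable cpsi.
pose psi1 z : R[i] := (\1_K z)%:C * psi z.
pose psi2 z : R[i] := (1 - (\1_K z)%:C) * psi z.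
have indK z : K z -> (\1_K z : R) = 1 by move=> Kz; rewrite indicE mem_set.
have indNK z : ~ K z -> (\1_K z : R) = 0 by move=> Kz; rewrite indicE memNset.
have mI : measurable_fun Omega (\1_K : Cn -> R) by exact: measurable_indic.
have b0 : bounded_symbol Omega psi Mp.
  by split => // z Oz; apply: psiM; exact: subset_closure.
have b1 : bounded_symbol Omega psi1 Mp.
  split.
  - rewrite (_ : (fun _ => _) = (fun z => \1_K z * Re (psi z))); first exact: measurable_funM.
    by apply/funext => z; rewrite /psi1 cReM /= mul0r subr0.
  - rewrite (_ : (fun _ => _) = (fun z => \1_K z * Im (psi z))); first exact: measurable_funM.
    by apply/funext => z; rewrite /psi1 cImM /= mul0r addr0.
  - move=> z Oz; rewrite /psi1 normcM normc_real.
    have [Kz|nKz] := pselect (K z).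
      by rewrite indK// normr1 mul1r psiM//; exact: subset_closure.
    by rewrite indNK// normr0 mul0r.
have b2 : bounded_symbol Omega psi2 (M + e / 2).
  split.
  - rewrite (_ : (fun _ => _) = (fun z => (1 - \1_K z) * Re (psi z))).
      by apply: measurable_funM => //; apply: measurable_funB => //.
    by apply/funext => z; rewrite /psi2 cReM /= subrr mul0r subr0.
  - rewrite (_ : (fun _ => _) = (fun z => (1 - \1_K z) * Im (psi z))).
      by apply: measurable_funM => //; apply: measurable_funB => //.
    by apply/funext => z; rewrite /psi2 cImM /= subrr mul0r addr0.
  - move=> z Oz; rewrite /psi2.
    have [Kz|nKz] := pselect (K z).
      by rewrite indK// subrr mul0r normc0 addr_ge0// ltW.
    rewrite indNK// subr0 mul1r leNgt; apply/negP => H; apply: nKz; split; first exact: subset_closure.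
    exact: ltW.
have M20 : 0 <= M + e / 2 by rewrite addr_ge0// ltW.
pose V := fine (mu Omega) + 1.
have V0 : 0 < V by rewrite ltr_wpDl// fine_ge0.
(* Chosen so that [Mp * delta * V <= e / 2]; by [norm2_le_cst] this bounds the norm of [psi1 * g]
   once [|g| <= delta] on [K]. *)
pose delta := e / 2 / ((Mp + 1) * V).
have MV : 0 < (Mp + 1) * V by rewrite mulr_gt0// ltr_wpDl.
have delta0 : 0 < delta by rewrite divr_gt0.
have H p : exists r : R, 0 < r /\ (O p -> forall w, normR (w - p) < r -> forall f : A2, normc (f w - f p) <= delta * normR f).
  have [Op|nOp] := pselect (O p); last by exists 1; split=> [|/nOp]; [exact: ltr01|case].
  have [r r0 rP] := bergman_equicontinuous Op delta0.
  by exists r; split=> [|_]; [exact: r0|exact: rP].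
have [r rP] := choice H.
have [|s [sK cov]] := @compact_finite_cover _ K (fun p => [set z | normR (z - p) < r p]) compK.
  by move=> p cp; split; [exact: open_normR_ball|rewrite /= subrr normR0; have [] := rP p].
have H' p : exists h : A2, O p -> forall f : A2, dot f h = f p.
  have [Op|nOp] := pselect (O p); last by exists 0 => /nOp[].
  by have [h hP] := evaluation_riesz Op; exists h.
have [ev evP] := choice H'.
(* Subtracting the projection onto [t] makes a function orthogonal to each [ev p], hence zero at
   every centre [p] of the finite cover of [K]. *)
have [t [ot eval0]] := gram_schmidt [seq ev p | p <- s].
pose T1 : A2 -> A2 := toeplitz psi1.
have T1lin : linear T1 := toeplitz_linear Mp0 b1.
(* This is [T1] composed with the projection onto [t], written so that the finite rank is
   visible. *)
pose S0 (f : A2) : A2 := \sum_(x <- t) dot f x *: T1 x.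
have S0lin : linear S0 by exact: (finite_rank_linear t T1).
pose Sl := GRing.isLinear.Build _ _ _ _ S0 S0lin.
pose S : {linear A2 -> A2} := HB.pack S0 Sl.
have cS : compact_operator S by apply: (@finite_rank_compact _ _ _ t T1).
have T1sum (f : A2) : T1 (span_proj t f) = S0 f.
  pose Tl := GRing.isLinear.Build _ _ _ _ T1 T1lin.
  pose T1' : {linear A2 -> A2} := HB.pack T1 Tl.
  rewrite /span_proj -[T1]/(T1' : A2 -> A2) linear_sum.
  by apply: eq_bigr => x _; rewrite linearZ.
apply: (@le_trans _ _ (operator_norm (fun x => toeplitz psi x - S x))).
  by apply: ereal_inf_lbound; exists S.
apply: ge_ereal_sup => _ [f /= f1 <-].
have fn : normR f <= 1 by rewrite -lecR -normRE.
rewrite lee_fin -[X in X <= _]/(normR (toeplitz psi f - S f)).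
pose g := f - span_proj t f.
have Ig := (symbol_mul Mp0 b1 (bergman_SI g)).
have If := (symbol_mul M20 b2 (bergman_SI f)).
(* In the first term the symbol is at most [M + e / 2]; in the second, [g] vanishes at the centres
   and is therefore small on [K], which supports [psi1]. *)
have E : toeplitz psi f - S f = bergman_proj Omega (fun z => psi2 z * f z) + bergman_proj Omega (fun z => psi1 z * g z).
  have -> : S f = T1 (span_proj t f) by rewrite T1sum.
  have Iq := (symbol_mul Mp0 b1 (bergman_SI (span_proj t f))).
  have I0 := (symbol_mul Mp0 b0 (bergman_SI f)).
  rewrite /T1 /toeplitz; apply/eqP; rewrite subr_eq -addrA -(bergman_projD Omega_bounded); [|by case: Ig|by case: Iq].
  rewrite -(bergman_projD Omega_bounded); [|by case: If|by apply: SI_D; [case: Ig|case: Iq]].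
  apply/eqP; congr bergman_proj; apply/funext => z.
  rewrite /psi1 /psi2 [bergman_fun g z](_ : _ = f z - span_proj t f z)//; ring.
rewrite E (le_trans (normRD _ _))// (_ : M + e = (M + e / 2) + e / 2); last by field.
apply: lerD.
  apply: (le_trans (bergman_proj_norm Omega_bounded If.1)); apply: (le_trans If.2).
  by rewrite -[leRHS]mulr1 ler_wpM2l.
apply: (le_trans (bergman_proj_norm Omega_bounded Ig.1)).
have gn : normR g <= 1 by apply: le_trans fn; exact: span_proj_contract.
have gK z : K z -> normc (g z) <= delta.
  move=> Kz; have [p ps /= zp] := cov z Kz.
  have Op := KO p (sK p ps).
  have gp0 : g p = 0 by rewrite -(evP p Op) eval0//; exact: map_f.
  have [_ /(_ Op z zp g)] := rP p; rewrite gp0 subr0 => /le_trans; apply.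
  by rewrite -[leRHS]mulr1 ler_wpM2l// ltW.
have : norm2 (fun z => psi1 z * g z) <= (Mp * delta) * V.
  apply: norm2_le_cst; [by rewrite mulr_ge0// ltW|exact: Ig.1|].
  move=> z Oz; have [Kz|nKz] := pselect (K z).
    rewrite normcM ler_pM ?normc_ge0//; last exact: gK.
    by have [_ _ h] := b1; exact: h.
  by rewrite /psi1 indNK// !mul0r normc0 mulr_ge0// ltW.
move=> /le_trans; apply; rewrite /delta.
rewrite (_ : Mp * _ * V = Mp / (Mp + 1) * (e / 2)); last first.
  have Vn : V != 0 by rewrite gt_eqF.
  have Mn : Mp + 1 != 0 by rewrite gt_eqF// ltr_wpDl.
  by field; rewrite ?Vn ?Mn.
by rewrite ler_piMl// ?(ltW e20)// ler_pdivrMr ?ltr_wpDl// mul1r lerDl.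
Qed.

End upper_bound.

(** * Supporting functionals and peak functions *)

Section convex_domain.
Variables (R : realType) (n : nat).
Local Notation Cn := 'rV[R[i]]_n.
Local Notation Re := complex.Re.

Lemma half_lt (r : R) : 0 < r -> r / 2 < r.
Proof. by move=> r0; rewrite ltr_pdivrMr// ltr_pMr// ltr1n. Qed.

Definition real_convex (A : set Cn) := forall x y (t : R), A x -> A y -> 0 <= t -> t <= 1 ->
  A (x + t%:C *: (y - x)).

Lemma convex_set_real_convex (A : set Cn) : convex_set A -> real_convex A.
Proof.
move=> cA x y t Ax Ay t0 t1.
have tC0 : 0 <= (t%:C : R[i]) by rewrite ler0c.
have tC1 : (t%:C : R[i]) <= 1 by rewrite -(rmorph1 (real_complex R)) lecR.
have := cA y x (Itv01 tC0 tC1) (mem_set Ay) (mem_set Ax); rewrite inE.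
congr A; rewrite /conv/= scalerBr scalerBl scale1r.
by rewrite [RHS]addrCA addrA.
Qed.

Lemma real_convex_closure (A : set Cn) : real_convex A -> real_convex (closure A).
Proof.
move=> cA x y t /closure_normRP cx /closure_normRP cy t0 t1; apply/closure_normRP => e e0.
have [x' Ax xx] := cx e e0; have [y' Ay yy] := cy e e0.
exists (x' + t%:C *: (y' - x')); first exact: cA.
have -> : x' + t%:C *: (y' - x') - (x + t%:C *: (y - x)) = (1 - t)%:C *: (x' - x) + t%:C *: (y' - y).
  have tC : (1 - t)%:C = 1 - t%:C :> R[i] by rewrite (rmorphB (real_complex R)).
  rewrite tC scalerBl scale1r opprD addrACA -scalerBr -[RHS]addrA [X in _ = _ + X]addrC -scalerBr.
  by congr (_ + _ *: _); rewrite !opprD !opprK addrACA.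
apply: (le_lt_trans (normRD _ _)); rewrite !normRZ !normc_real !ger0_norm ?subr_ge0//.
rewrite (_ : e = (1 - t) * e + t * e); last by ring.
have [->|tn] := eqVneq t 0; first by rewrite !mul0r !addr0 subr0 !mul1r.
by apply: ler_ltD; [rewrite ler_wpM2l ?subr_ge0// ltW|rewrite ltr_pM2l// lt_def tn].
Qed.

(** The weights may add up to less than [t]: the missing weight goes to [q] itself, that is, to the
    zero vector. *)
Lemma convex_combination (A : set Cn) (q : Cn) (s : seq (R * Cn)) (t : R) : real_convex A -> A q ->
  (forall x, x \in s -> 0 <= x.1 /\ A (q + x.2)) -> \sum_(x <- s) x.1 <= t -> 0 <= t ->
  exists2 a, A (q + a) & \sum_(x <- s) x.1%:C *: x.2 = t%:C *: a.
Proof.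
move=> cA Aq; elim: s t => [|[w g] s IH] t sA st t0.
  by exists 0; rewrite ?addr0// big_nil scaler0.
rewrite big_cons /= in st.
have [w0 Ag] := sA (w, g) (mem_head _ _).
have sA' x : x \in s -> 0 <= x.1 /\ A (q + x.2) by move=> xs; apply: sA; rewrite inE xs orbT.
have S0 : 0 <= \sum_(x <- s) x.1.
  by rewrite big_seq; apply: sumr_ge0 => x /sA'[].
have [||a Aa aE] := IH (t - w) sA'.
- by rewrite lerBrDl.
- by rewrite subr_ge0 (le_trans _ st)// lerDl.
rewrite big_cons /= aE.
have [tz|tn] := eqVneq t 0.
  exists 0; first by rewrite addr0.
  have -> : w = 0.
    by apply/eqP; rewrite eq_le w0 andbT -tz (le_trans _ st)// lerDl.
  by rewrite tz subrr !scale0r addr0.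
have tp : 0 < t by rewrite lt_def tn.
exists (a + (w / t)%:C *: (g - a)).
  rewrite addrA (_ : g - a = (q + g) - (q + a)); last by rewrite opprD addrACA subrr add0r.
  by apply: cA => //; [rewrite divr_ge0|rewrite ler_pdivrMr// mul1r (le_trans _ st)// lerDl].
apply/rowP => i; rewrite !mxE.
have -> : w%:C = (w / t)%:C * t%:C :> R[i] by rewrite -rmorphM/= divfK.
have -> : (t - w)%:C = t%:C - (w / t)%:C * t%:C :> R[i] by rewrite -rmorphM/= divfK// rmorphB.
by ring.
Qed.

(** The Euclidean square norm. The norm of [Cn] is the maximum norm, which comes from no inner
    product, whereas closest points must yield a supporting functional [hdot]. *)
Definition esq (u : Cn) : R := \sum_i normc (u ord0 i) ^+ 2.
Definition hdot (u v : Cn) : R[i] := \sum_i u ord0 i * (v ord0 i)^*.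

Lemma esq_ge0 u : 0 <= esq u. Proof. by apply: sumr_ge0 => i _; exact: sqr_ge0. Qed.

Lemma normR_esq u (e : R) : 0 < e -> esq u < e ^+ 2 -> normR u < e.
Proof.
move=> e0 ue; apply/normR_rV_lt => // i.
rewrite -(@ltr_pXn2r _ 2) ?nnegrE ?normc_ge0 ?(ltW e0)// (le_lt_trans _ ue)//.
by rewrite /esq (bigD1 i)//= lerDl sumr_ge0// => j _; exact: sqr_ge0.
Qed.

Lemma esq_le u : esq u <= n%:R * normR u ^+ 2.
Proof.
rewrite /esq -[n in n%:R]card_ord -sum1_card natr_sum mulr_suml; apply: ler_sum => i _.
by rewrite mul1r ler_pXn2r ?nnegrE ?normc_ge0 ?normR_ge0// normc_le_normR_rV.
Qed.

Lemma esq_eq0 u : esq u = 0 -> u = 0.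
Proof.
move=> u0; apply/eqP; rewrite -normR_eq0 eq_le normR_ge0 andbT; apply/ler_addgt0Pr => e e0.
by rewrite add0r ltW// normR_esq// u0 exprn_gt0.
Qed.

Lemma esq_gt0 u : u != 0 -> 0 < esq u.
Proof.
by move=> u0; rewrite lt_def esq_ge0 andbT; apply: contra u0 => /eqP/esq_eq0 ->.
Qed.

(** The divisor [n + 1] pays for the passage between the two norms: [esq (p - x) <= n * d ^ 2],
    which is less than [((n + 1) * d) ^ 2 = (e / 2) ^ 2]. *)
Lemma normR_closer (x p q : Cn) (e : R) : 0 < e -> normR (x - p) < e / 2 / (n%:R + 1) ->
  esq (q - x) <= esq (p - x) -> normR (q - p) < e.
Proof.
have n0 : 0 < n%:R + 1 :> R by rewrite ltr_wpDl.
set d := e / 2 / (n%:R + 1) => e0 xp qmin.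
have d0 : 0 < d by rewrite !divr_gt0.
rewrite -(subrK x q) -addrA (le_lt_trans (normRD _ _))//.
have xe : normR (x - p) < e / 2.
  by apply: lt_le_trans xp _; rewrite /d ler_pdivrMr// ler_peMr ?(divr_ge0 (ltW e0))// lerDr ler0n.
rewrite [e]splitr ltrD//; apply: normR_esq; first by rewrite divr_gt0.
apply: (le_lt_trans qmin); apply: (le_lt_trans (esq_le _)).
rewrite normRB; apply: (@le_lt_trans _ _ (n%:R * d ^+ 2)).
  by rewrite ler_wpM2l// ler_pXn2r ?nnegrE ?normR_ge0 ?(ltW d0)// ltW.
have -> : e / 2 = d * (n%:R + 1) by rewrite /d divfK// gt_eqF.
rewrite [ltRHS]exprMn [ltLHS]mulrC ltr_pM2l ?exprn_gt0//.
have := ler0n R n; nra.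
Qed.

Lemma hdotDl u v w : hdot (u + v) w = hdot u w + hdot v w.
Proof. by rewrite /hdot -big_split/=; apply: eq_bigr => i _; rewrite mxE mulrDl. Qed.
Lemma hdotZl a u w : hdot (a *: u) w = a * hdot u w.
Proof. by rewrite /hdot mulr_sumr; apply: eq_bigr => i _; rewrite mxE mulrA. Qed.
Lemma hdotuu u : hdot u u = (esq u)%:C.
Proof. by rewrite /hdot /esq rmorph_sum/=; apply: eq_bigr => i _; rewrite conj_normc. Qed.

Lemma esq_addZ u v (t : R) : esq (u + t%:C *: v) = esq u + 2 * t * Re (hdot v u) + t ^+ 2 * esq v.
Proof.
have ReS (F : 'I_n -> R[i]) : Re (\sum_i F i) = \sum_i Re (F i).
  by elim/big_ind2: _ => // a b c d <- <-; rewrite cReD.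
rewrite /hdot ReS /esq !mulr_sumr -!big_split/=.
apply: eq_bigr => i _; rewrite !mxE !sqr_normcE.
by case: (u ord0 i) => a b; case: (v ord0 i) => c d /=; ring.
Qed.

Lemma esq_continuous x : continuous (fun z : Cn => esq (z - x)).
Proof.
move=> z A /nbhs_ballP[e /= e0 eA]; apply/nbhs_normRP.
pose B := \sum_i (2 * normc ((z - x) ord0 i) + 1) + 1.
have B0 : 0 < B by rewrite ltr_wpDl// sumr_ge0// => i _; rewrite addr_ge0 ?mulr_ge0 ?normc_ge0.
exists (Num.min 1 (e / B)); first by rewrite lt_min ltr01 divr_gt0.
move=> w; rewrite lt_min => /andP[w1 we]; apply: eA; rewrite /ball/= distrC.
apply: (@le_lt_trans _ _ (normR (w - z) * B)); last by rewrite -ltr_pdivlMr.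
rewrite /esq -sumrB (le_trans (ler_norm_sum _ _ _))// /B mulrDr mulr_sumr mulr1 ler_wpDr ?normR_ge0//.
apply: ler_sum => i _.
have h := normc_le_normR_rV (w - z) i.
have d1 : normc ((w - x) ord0 i) - normc ((z - x) ord0 i) <= normR (w - z).
  by apply: le_trans (le_normcB _ _) (le_trans _ h); rewrite !mxE; rewrite (_ : _ - _ = w ord0 i - z ord0 i)//; ring.
have d2 : normc ((z - x) ord0 i) - normc ((w - x) ord0 i) <= normR (w - z).
  apply: le_trans (le_normcB _ _) (le_trans _ h); rewrite !mxE normcB.
  by rewrite (_ : _ - _ = w ord0 i - z ord0 i)//; ring.
have := normc_ge0 ((w - x) ord0 i); have := normc_ge0 ((z - x) ord0 i); have := normR_ge0 (w - z).
move: (normc ((w - x) ord0 i)) (normc ((z - x) ord0 i)) (normR (w - z)) w1 d1 d2 => a b d; clear => d1 h1 h2 d0 b0 a0.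
rewrite ler_norml; apply/andP; split; nra.
Qed.

End convex_domain.

(** * Supporting functionals at closest points *)

Section exposed_points.
Variables (R : realType) (n : nat) (Omega : domain R n).
Hypothesis Omega_bounded : bounded_set (domain_set Omega).
Hypothesis Omega_convex : convex_set (domain_set Omega).
Local Notation Cn := 'rV[R[i]]_n.
Local Notation Re := complex.Re.
Local Notation O := (domain_set Omega).

Let cO : real_convex O := convex_set_real_convex Omega_convex.
Let cclO : real_convex (closure O) := real_convex_closure cO.

Let oO p : O p -> exists2 e : R, 0 < e & forall z, normR (z - p) < e -> O z.
Proof. exact: (open_normRP O).1 (@domain_open _ _ Omega) p. Qed.

Lemma boundaryE p : boundary O p <-> closure O p /\ ~ O p.
Proof.
split=> [[cp ip]|[cp nOp]]; (split; [exact: cp|move=> Op]); first by apply: ip; apply/nbhs_normRP; exact: oO.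
by apply: nOp; exact: interior_subset Op.
Qed.

(** Push [p] away from a point [a] of the domain. Were the result in the closure, [p] would lie
    between a point [y] of the domain near it and a point [a'] of the domain near [a], and convexity
    would put [p] in the domain. *)
Lemma nearby_exterior p (e : R) : boundary O p -> 0 < e ->
  exists2 x, ~ closure O x & normR (x - p) < e.
Proof.
move=> /boundaryE[_ nOp] e0; have [a Oa] := @domain_neq0 _ _ Omega.
have [r r0 rO] := oO Oa.
have pa : 0 < normR (p - a) + 1 by rewrite ltr_wpDl ?normR_ge0.
pose s := e / (normR (p - a) + 1) / 2.
have s0 : 0 < s by rewrite !divr_gt0.
exists (p + s%:C *: (p - a)); last first.
  rewrite addrC addKr normRZ normc_real gtr0_norm// /s.
  apply: (@lt_le_trans _ _ (e / (normR (p - a) + 1) * (normR (p - a) + 1))); last by rewrite divfK ?gt_eqF//.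
  apply: (@le_lt_trans _ _ (e / (normR (p - a) + 1) / 2 * (normR (p - a) + 1))).
    by rewrite ler_wpM2l ?lerDl// ltW.
  by rewrite ltr_pM2r// ltr_pdivrMr// ltr_pMr ?ltr1n// divr_gt0.
move=> /closure_normRP cx.
have [y Oy yx] := cx (s * r) (mulr_gt0 s0 r0).
set x := p + s%:C *: (p - a) in yx.
(* Chosen so that [p] divides the segment from [y] to [a'] in the ratio [s : 1]. *)
pose a' := a + (s^-1)%:C *: (x - y).
have Oa' : O a'.
  apply: rO; rewrite /a' addrC addKr normRZ normc_real gtr0_norm ?invr_gt0// normRB.
  by rewrite mulrC ltr_pdivrMr// mulrC.
apply: nOp.
have s1 : 0 < 1 + s by rewrite addr_gt0.
have := cO Oy Oa' (t := s / (1 + s)); rewrite (_ : y + _ = p).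
  by apply; [rewrite divr_ge0// ltW|rewrite ler_pdivrMr// mul1r lerDr].
have sC : s%:C != 0 :> R[i] by rewrite (_ : 0 = 0%:C)// (inj_eq (@complexI R)) gt_eqF.
have s1C : 1 + s%:C != 0 :> R[i].
  by rewrite -(rmorph1 (real_complex R)) -rmorphD (_ : 0 = 0%:C)// (inj_eq (@complexI R)) gt_eqF.
rewrite /a' /x; apply/rowP => i; rewrite !mxE.
rewrite rmorphM/= !fmorphV/= rmorphD rmorph1.
by field; rewrite sC s1C.
Qed.

(* Closest points of the closure to points of the exterior are dense in the
   boundary. *)
Lemma supporting_functional p (e : R) : boundary O p -> 0 < e ->
  exists q u, [/\ boundary O q, normR (q - p) < e, u != 0 &
    forall z, closure O z -> Re (hdot (z - q) u) <= 0].
Proof.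
move=> bp e0; have [cp nOp] := (boundaryE p).1 bp.
have n0 : 0 < n%:R + 1 :> R by rewrite ltr_wpDl.
pose d := e / 2 / (n%:R + 1); have d0 : 0 < d by rewrite !divr_gt0.
have [x ncx xp] := nearby_exterior bp d0.
have [||q qO qmin] := @compact_EVT_min _ R (fun z : Cn => esq (z - x)) (closure O) _ (compact_closure_domain Omega_bounded).
- by exists p.
- by apply: continuous_subspaceT; exact: esq_continuous.
rewrite inE in qO.
have xq : x - q != 0 by apply/eqP => /subr0_eq xq; apply: ncx; rewrite xq.
have sup z : closure O z -> Re (hdot (z - q) (x - q)) <= 0.
  move=> cz.
  have H (t : R) : 0 < t -> t <= 1 -> 0 <= - (2 * Re (hdot (z - q) (x - q))) + t * esq (z - q).
    move=> t0 t1; have cy := cclO qO cz (ltW t0) t1.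
    have := qmin _ (mem_set cy).
    have -> : q + t%:C *: (z - q) - x = (q - x) + t%:C *: (z - q) by rewrite addrAC.
    rewrite esq_addZ -addrA lerDl.
    have -> : hdot (z - q) (q - x) = - hdot (z - q) (x - q).
      rewrite /hdot -sumrN; apply: eq_bigr => i _; rewrite !mxE -mulrN -rmorphN/=.
      by congr (_ * _ ^*); ring.
    rewrite cReN => h.
    by rewrite -(pmulr_rge0 _ t0); apply: le_trans h _; rewrite le_eqVlt; apply/orP; left; apply/eqP; ring.
  have E0 := esq_ge0 (z - q).
  rewrite leNgt; apply/negP => Hp.
  set a := Re _ in H Hp; set E := esq _ in H E0.
  have aE : 0 < a + E + 1 by lra.
  (* This [t] lies in the unit interval and satisfies [t * E < 2 * a], against the first-order
     minimality condition [H]. *)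
  have [t tE] : exists t, t * (a + E + 1) = a by exists (a / (a + E + 1)); rewrite divfK ?gt_eqF//.
  have t0 : 0 < t by rewrite -(pmulr_lgt0 _ aE) tE.
  have t1 : t <= 1 by nra.
  by have := H t t0 t1; nra.
exists q, (x - q); split; [|  |exact: xq|exact: sup].
- apply/boundaryE; split; [exact: qO|move=> Oq].
  have [r r0 rO] := oO Oq.
  have nx : 0 < normR (x - q) by rewrite normR_gt0.
  pose s := r / 2 / normR (x - q); have s0 : 0 < s by rewrite !divr_gt0.
  have Oz : O (q + s%:C *: (x - q)).
    apply: rO; rewrite addrC addKr normRZ normc_real (gtr0_norm s0) /s divfK; first exact: half_lt.
    by rewrite (gt_eqF nx).
  have := sup _ (subset_closure Oz); rewrite addrC addKr hdotZl hdotuu -rmorphM/=.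
  by rewrite leNgt /= (mulr_gt0 s0 (esq_gt0 xq)).
exact: (normR_closer e0 xp (qmin p (mem_set cp))).
Qed.

End exposed_points.

Section peak_polynomial.
Variables (R : realType) (n : nat).
Local Notation Cn := 'rV[R[i]]_n.
Local Notation Re := complex.Re.

Lemma open_Re_gt (F : Cn -> R[i]) (c : R) : (forall z, differentiable F z) ->
  open [set z | c < Re (F z)].
Proof.
move=> dF; apply/open_normRP => p /= cp.
have cF : {within setT, continuous F}.
  by apply: continuous_subspaceT => z; exact: differentiable_continuous.
have [|d d0 H] := @within_continuous_normR _ _ setT F cF p I (Re (F p) - c).
  by rewrite subr_gt0.
exists d => // z zp; have := H z I zp; have := Re_le_normc (F p - F z).
by rewrite cReB (normcB (F p)) => /ler_normlW; lra.
Qed.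

(** Near each point some [N >= 0] makes the real part of [Q - N l] positive: where [Re l = 0]
    because of [Q], elsewhere by the size of [N]. As [Re l <= 0], enlarging [N] does no harm, so
    over a finite cover the values of [N] are added and the smallest margin is kept. *)
Lemma compact_dominate (K : set Cn) (l Q : Cn -> R[i]) : compact K ->
  (forall z, differentiable l z) -> (forall z, differentiable Q z) ->
  (forall z, K z -> Re (l z) <= 0) -> (forall z, K z -> Re (l z) = 0 -> 0 < Re (Q z)) ->
  exists N c : R, 0 < c /\ forall z, K z -> Re (N%:C * l z - Q z) <= - c.
Proof.
move=> cK dl dQ l0 Q0.
have ReNl (N : R) z : Re (Q z - N%:C * l z) = Re (Q z) - N * Re (l z).
  by rewrite cReB cReM /= mul0r subr0.
have /choice[F hF] p : exists a : R * R, K p ->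
    [/\ 0 <= a.1, 0 < a.2 & a.2 < Re (Q p - a.1%:C * l p)].
  have [Kp|nKp] := pselect (K p); last by exists (0, 0).
  have [lp|lp] := eqVneq (Re (l p)) 0.
    exists (0, Re (Q p) / 2) => _ /=; have := Q0 p Kp lp.
    by rewrite ReNl mul0r subr0; split => //; lra.
  have lp0 : 0 < - Re (l p) by rewrite oppr_gt0 lt_neqAle lp l0.
  (* This [N] makes the real part equal to [Re Q + |Re Q| + 1], which is at least 1 and so exceeds
     the margin 1/2. *)
  exists ((`|Re (Q p)| + 1) / - Re (l p), 1 / 2) => _ /=; split.
  - by rewrite divr_ge0 ?ltW// ltr_wpDl.
  - by rewrite divr_gt0.
  - rewrite ReNl -mulrN divfK ?gt_eqF//.
    by have := ler_norm (- Re (Q p)); rewrite normrN; lra.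
have [|s [sK sc]] := @compact_finite_cover _ K (fun p => [set z | (F p).2 < Re (Q z - (F p).1%:C * l z)]) cK.
  move=> p Kp; split; last by have [] := hF p Kp.
  apply: open_Re_gt => z; apply: differentiableB; first exact: dQ.
  by apply: differentiableM; [exact: differentiable_cst|exact: dl].
have [N [c [N0 c0 H]]] : exists N c : R, [/\ 0 <= N, 0 < c & forall p, p \in s -> forall z,
    K z -> (F p).2 < Re (Q z - (F p).1%:C * l z) -> c <= Re (Q z) - N * Re (l z)].
  elim: s sK {sc} => [|p s IH] sK; first by exists 0, 1.
  have [|N [c [N0 c0 H]]] := IH; first by move=> r rs; apply: sK; rewrite inE rs orbT.
  have [F1 F2 _] := hF p (sK p (mem_head _ _)).
  exists (N + (F p).1), (Num.min c (F p).2); split; first exact: addr_ge0.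
    by rewrite lt_min c0.
  move=> r; rewrite inE => /predU1P[->|rs] z Kz; rewrite ge_min.
    rewrite ReNl => Fz; apply/orP; right.
    by have := mulr_ge0_le0 N0 (l0 z Kz); lra.
  move=> Fz; apply/orP; left; have := H r rs z Kz Fz.
  by have := mulr_ge0_le0 F1 (l0 z Kz); lra.
exists N, c; split => // z Kz; have [p ps Bp] := sc z Kz.
have := H p ps z Kz Bp; rewrite cReB cReM /= mul0r subr0; lra.
Qed.

Lemma differentiable_affine_form (q : Cn) (a : 'I_n -> R[i]) z :
  differentiable (fun z : Cn => \sum_i (z - q) ord0 i * a i) z.
Proof.
rewrite (_ : (fun _ => _) = \sum_i (fun z : Cn => (z - q) ord0 i * a i)); last first.
  by apply/funext => w; rewrite fct_sumE.
apply: differentiable_sum => i; apply: differentiableM; last exact: differentiable_cst.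
rewrite (_ : (fun _ => _) = (fun w : Cn => w ord0 i - q ord0 i)); last first.
  by apply/funext => w; rewrite !mxE.
by apply: differentiableB; [exact: differentiable_coord|exact: differentiable_cst].
Qed.

End peak_polynomial.

(** * Convex sets without disks are totally real *)

Section faces.
Variables (R : realType) (n : nat).
Local Notation Cn := 'rV[R[i]]_n.
Local Notation Re := complex.Re.
Local Notation Im := complex.Im.

(** An independent family of largest size spans [D] over the complex numbers. Its rows are taken
    from [D] itself, so that they can later enter convex combinations. *)
Lemma maximal_row_free (D : set Cn) : exists (k : nat) (E : 'M[R[i]]_(k, n)),
  [/\ row_free E, forall i, D (row i E) & forall g, D g -> (g <= E)%MS].
Proof.
pose P k := `[< exists E : 'M[R[i]]_(k, n), row_free E /\ forall i, D (row i E) >].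
have P0 : exists k, P k.
  exists 0%N; apply/asboolP; exists 0; split; last by case.
  by rewrite /row_free mxrank0.
have Pn k : P k -> (k <= n)%N.
  by move=> /asboolP[E [/eqP Ek _]]; rewrite -Ek rank_leq_col.
have [k /asboolP[E [Efree ED]] kmax] := ex_maxnP P0 Pn.
exists k, E; split => // g Dg; apply: contraT => gE.
suff /kmax : P (k + 1)%N by rewrite addn1 ltnn.
apply/asboolP; exists (col_mx E g); split; last first.
  move=> m; rewrite -[m]fintype.splitK; case: (fintype.split m) => j /=.
    by rewrite rowKu.
  rewrite rowKd (_ : row j g = g)//.
  by apply/rowP => l; rewrite mxE ord1.
have : (\rank E < \rank (col_mx E g))%N.
  apply: rank_ltmx; rewrite ltmxE -addsmxE addsmxSl/=.
  by apply: contra gE => h; apply: submx_trans h; rewrite -addsmxE addsmxSr.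
rewrite (eqP Efree) => lt.
by rewrite /row_free eqn_leq rank_leq_row/= (leq_trans _ lt)// addn1.
Qed.

(* If [g = (a + i b) E] with [b != 0], then [w = b E] and [i w = g - a E] are
   both real combinations of [g] and the rows of [E], so [A] contains a complex
   disk directed by [w]. *)
Lemma disk_in_convex (A : set Cn) (q g : Cn) k (E : 'M[R[i]]_(k, n)) (c : 'rV[R[i]]_k) (j0 : 'I_k) :
  real_convex A -> A q -> A (q + g) -> (forall i, A (q + row i E)) -> row_free E ->
  g = c *m E -> Im (c ord0 j0) != 0 -> has_analytic_disk A.
Proof.
move=> cA Aq Ag AE Efree gE cj0.
pose a j := Re (c ord0 j); pose b j := Im (c ord0 j).
pose w : Cn := \sum_j (b j)%:C *: row j E.
(* The points of the disk are combinations of [g] and the [k] rows with [k + 1] weights in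
   [[0, 2 * s0]]; this value makes their sum at most 1. *)
pose s0 : R := (2 * (k%:R + 1))^-1.
have k1 : 0 < k%:R + 1 :> R by rewrite ltr_wpDl.
have s00 : 0 < s0 by rewrite invr_gt0 mulr_gt0.
pose M := 1 + \sum_j (`|a j| + `|b j|).
have M0 : 0 < M by rewrite ltr_wpDr// sumr_ge0// => j _; rewrite addr_ge0.
(* At the centre [q + w0] all weights equal [s0]; [eta] is small enough that over the unit disk no
   weight changes by more than [s0]. *)
pose eta := s0 / M; have eta0 : 0 < eta by rewrite divr_gt0.
have etaM : eta * M = s0 by rewrite /eta divfK ?gt_eqF.
have Mj j : `|a j| + `|b j| <= M.
  rewrite /M (bigD1 j)//= addrCA lerDl addr_ge0// sumr_ge0// => i _; rewrite addr_ge0//.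
have M1 : 1 <= M by rewrite lerDl sumr_ge0// => j _; rewrite addr_ge0.
pose w0 : Cn := s0%:C *: g + \sum_j s0%:C *: row j E.
have wn0 : w != 0.
  have -> : w = (\row_j (b j)%:C) *m E.
    by rewrite mulmx_sum_row /w; apply: eq_bigr => j _; rewrite mxE.
  apply: contra cj0 => /eqP; rewrite -(mul0mx _ E) => /(row_free_inj Efree).
  by move=> /rowP/(_ j0); rewrite !mxE => -[bj]; apply/eqP.
have iw : g - \sum_j (a j)%:C *: row j E = 'i *: w.
  rewrite gE mulmx_sum_row -sumrB /w scaler_sumr; apply: eq_bigr => j _.
  rewrite scalerA -scalerBl; congr (_ *: _).
  by rewrite /a /b; case: (c ord0 j) => x y /=; apply/eqP; rewrite eq_complex /= !(mulr0, mul0r, mul1r, subr0, addr0, add0r, oppr0, sub0r) subrr !eqxx.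
exists (fun z : R[i] => q + w0 + (eta%:C * z) *: w); split.
- move=> z _; apply: differentiableD; first exact: differentiable_cst.
  apply: differentiableZl.
  by apply: differentiableM; [exact: differentiable_cst|exact: (ex_diff (is_diff_def := is_diff_id z))].
- exists 0, (2^-1); split; rewrite /unit_disk/=.
  + by rewrite normr0.
  + by rewrite ger0_norm ?invr_ge0// invf_lt1// ltr1n.
  + rewrite mulr0 scale0r addr0 => /eqP; rewrite eq_sym -subr_eq0 addrC addKr scaler_eq0 (negbTE wn0) orbF.
    rewrite mulf_eq0 invr_eq0 pnatr_eq0 orbF (_ : 0 = 0%:C)// (inj_eq (@complexI R)).
    by rewrite gt_eqF.
move=> _ [z /= z1 <-]; case: z z1 => x y z1.
have nz : normc (x +i* y) < 1 by rewrite -ltcR -norm_normc.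
have x1 : `|x| <= 1 by apply: le_trans (Re_le_normc (x +i* y)) (ltW nz).
have y1 : `|y| <= 1 by apply: le_trans (Im_le_normc (x +i* y)) (ltW nz).
(* The weight of row [j] at the parameter [x +i* y], from [iw]: the real part moves along [w], the
   imaginary part along [g] minus the combination with coefficients [a j]. *)
pose wt j := s0 + eta * (x * b j - y * a j).
pose s := (s0 + eta * y, g) :: [seq (wt j, row j E) | j <- enum 'I_k].
have wtb j : 0 <= wt j <= 2 * s0.
  have h : `|x * b j - y * a j| <= M.
    apply: le_trans (ler_normB _ _) (le_trans _ (Mj j)); rewrite !normrM addrC.
    by apply: lerD; rewrite ler_piMl.
  have : `|eta * (x * b j - y * a j)| <= s0.
    by rewrite normrM gtr0_norm// -etaM ler_pM2l.
  by rewrite /wt ler_norml => /andP[? ?]; apply/andP; split; lra.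
have s0b : 0 <= s0 + eta * y <= 2 * s0.
  have : `|eta * y| <= s0.
    by rewrite normrM gtr0_norm// -etaM ler_pM2l// (le_trans y1).
  by rewrite ler_norml => /andP[? ?]; apply/andP; split; lra.
have [|||v Av] := @convex_combination _ _ A q s 1 cA Aq.
- move=> p; rewrite inE => /predU1P[->|/mapP[j _ ->]] /=; split => //.
    by case/andP: s0b.
  by case/andP: (wtb j).
- rewrite /s big_cons big_map big_enum /=.
  apply: (@le_trans _ _ (2 * s0 + \sum_(j < k) 2 * s0)).
    by apply: lerD; [case/andP: s0b|apply: ler_sum => j _; case/andP: (wtb j)].
  rewrite sumr_const card_ord (_ : _ + _ = 1)// -(mulr_natr (2 * s0)) /s0.
  by field; rewrite gt_eqF.
- by [].
rewrite scale1r => vE; rewrite -addrA; suff -> : w0 + (eta%:C * (x +i* y)) *: w = v by [].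
rewrite -vE /s big_cons big_map big_enum /=.
have -> : (eta%:C * (x +i* y)) *: w = (eta * x)%:C *: w + (eta * y)%:C *: ('i *: w).
  rewrite scalerA -scalerDl; congr (_ *: _); apply/eqP; rewrite eq_complex /=.
  by apply/andP; split; apply/eqP; ring.
have S1 : (eta * x)%:C *: w = \sum_j (eta * x * b j)%:C *: row j E.
  by rewrite /w scaler_sumr; apply: eq_bigr => j _; rewrite scalerA -(rmorphM (real_complex R)).
have S2 : (eta * y)%:C *: \sum_j (a j)%:C *: row j E = \sum_j (eta * y * a j)%:C *: row j E.
  by rewrite scaler_sumr; apply: eq_bigr => j _; rewrite scalerA -(rmorphM (real_complex R)).
have S3 : \sum_j (wt j)%:C *: row j E = \sum_j s0%:C *: row j E +
    (\sum_j (eta * x * b j)%:C *: row j E - \sum_j (eta * y * a j)%:C *: row j E).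
  rewrite -sumrB -big_split /=; apply: eq_bigr => j _; rewrite -scalerBl -scalerDl.
  congr (_ *: _); rewrite /wt; apply/eqP; rewrite eq_complex /=.
  by apply/andP; split; apply/eqP; ring.
rewrite S3 -iw scalerBr S1 S2 /w0 (rmorphD (real_complex R)) scalerDl.
by rewrite [X in _ + X = _]addrCA addrACA.
Qed.

End faces.

(** * Peak points in the boundary *)

Section peak_functions.
Variables (R : realType) (n : nat) (Omega : domain R n).
Hypothesis Omega_bounded : bounded_set (domain_set Omega).
Hypothesis Omega_convex : convex_set (domain_set Omega).
Hypothesis no_disk : ~ has_analytic_disk (boundary (domain_set Omega)).
Local Notation Cn := 'rV[R[i]]_n.
Local Notation Re := complex.Re.
Local Notation Im := complex.Im.
Local Notation O := (domain_set Omega).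

Let oO p : O p -> exists2 e : R, 0 < e & forall z, normR (z - p) < e -> O z.
Proof. exact: (open_normRP O).1 (@domain_open _ _ Omega) p. Qed.

(** [G] may depend on [d], and its modulus is unrestricted inside the ball. This is weaker than
    having a peak function in the usual sense, and enough for concentration. *)
Definition peak_point (q : Cn) := forall d : R, 0 < d -> exists (G : Cn -> R[i]) (a : R),
  [/\ forall z, differentiable G z, G q = 1, 0 <= a, a < 1 &
      forall z, closure O z -> d <= normR (z - q) -> normc (G z) ^+ 2 <= a].

Definition face (q u : Cn) : set Cn := [set z | closure O z /\ Re (hdot (z - q) u) = 0].

Lemma face_convex q u : real_convex (face q u).
Proof.
move=> x y t [cx fx] [cy fy] t0 t1; split.
  exact: (real_convex_closure (convex_set_real_convex Omega_convex)).
have -> : x + t%:C *: (y - x) - q = (x - q) + t%:C *: ((y - q) - (x - q)).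
  by rewrite opprB addrA subrK addrAC.
have hB (a b c : Cn) : hdot (a - b) c = hdot a c - hdot b c.
  by rewrite -scaleN1r hdotDl hdotZl mulN1r.
by rewrite hdotDl hdotZl cReD cReM (hB (y - q)) cReB fx fy subrr mulr0 mul0r subr0 addr0.
Qed.

(** From a point of the face inside the open domain one could move in the direction [u] and make the
    supporting functional positive. *)
Lemma face_boundary q u : u != 0 ->
  (forall z, closure O z -> Re (hdot (z - q) u) <= 0) -> face q u `<=` boundary O.
Proof.
move=> u0 sup z [cz fz]; apply/boundaryE; split; first exact: cz.
move=> Oz; have [r r0 rO] := oO Oz.
have nu : 0 < normR u by rewrite normR_gt0.
have s0 : 0 < r / 2 / normR u by rewrite !divr_gt0.
have Oz' : O (z + (r / 2 / normR u)%:C *: u).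
  apply: rO; rewrite addrC addKr normRZ normc_real (gtr0_norm s0) divfK; first exact: half_lt.
  by rewrite (gt_eqF nu).
have := sup _ (subset_closure Oz'); rewrite addrAC hdotDl hdotZl hdotuu cReD fz add0r.
by rewrite -(rmorphM (real_complex R)) leNgt /= (mulr_gt0 s0 (esq_gt0 u0)).
Qed.

(** Coordinates are taken in a maximal independent family of vectors from the face. A nonreal
    coordinate would produce a disk in the face, hence in the boundary. They determine the point
    because the family spans the face. *)
Lemma real_coordinates q u : boundary O q -> u != 0 ->
  (forall z, closure O z -> Re (hdot (z - q) u) <= 0) ->
  exists (k : nat) (P : 'M[R[i]]_(n, k)), forall z, face q u z ->
    (forall j, Im (((z - q) *m P) ord0 j) = 0) /\ ((z - q) *m P = 0 -> z = q).
Proof.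
move=> bq u0 sup; have fq : face q u q.
  split; first exact: ((boundaryE Omega q).1 bq).1.
  by rewrite subrr /hdot big1// => i _; rewrite mxE mul0r.
have [k [E [Efree ED Emax]]] := maximal_row_free [set v | face q u (q + v)].
exists k, (pinvmx E) => z fz.
have zE : z - q = (z - q) *m pinvmx E *m E.
  by rewrite mulmxKpV// Emax//= addrC subrK.
split; last by move=> z0; apply/eqP; rewrite -subr_eq0 zE z0 mul0mx.
move=> j; apply: contrapT => /eqP cj; apply: no_disk.
have [|f [hf nf fim]] := disk_in_convex (@face_convex q u) fq _ ED Efree zE cj.
  by rewrite /= addrC subrK.
by exists f; split; [exact: hf|exact: nf|move=> w /fim; exact: face_boundary].
Qed.

Lemma peak_points_dense p (e : R) : boundary O p -> 0 < e ->
  exists q, [/\ boundary O q, normR (q - p) < e & peak_point q].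
Proof.
move=> bp e0; have [q [u [bq qp u0 sup]]] := supporting_functional Omega_bounded Omega_convex bp e0.
have [k [P HP]] := real_coordinates bq u0 sup.
exists q; split; [exact: bq|exact: qp|move=> d d0].
pose l z := hdot (z - q) u.
pose c z j := ((z - q) *m P) ord0 j.
pose Q z := \sum_j c z j ^+ 2.
have dl z : differentiable l z by exact: differentiable_affine_form.
have dQ z : differentiable Q z.
  rewrite (_ : Q = \sum_j (fun z : Cn => c z j ^+ 2)); last first.
    by apply/funext => w; rewrite fct_sumE.
  have dc j : differentiable (fun z : Cn => c z j) z.
    rewrite (_ : (fun _ => _) = (fun z : Cn => \sum_i (z - q) ord0 i * P i j)).
      exact: differentiable_affine_form.
    by apply/funext => w; rewrite /c mxE.
  by apply: differentiable_sum => j; apply: (@differentiableX _ _ (fun z : Cn => c z j) 1).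
have cpt := compact_closure_domain Omega_bounded.
pose K := [set z | closure O z /\ d <= normR (z - q)].
have cK : compact K.
  apply: (subclosed_compact _ cpt); last by move=> z [].
  rewrite (_ : K = closure O `&` ~` [set z | normR (z - q) < d]).
    by apply: closedI; [exact: closed_closure|apply: open_closedC; exact: open_normR_ball].
  by apply/seteqP; split => z /= [cz zd]; (split; first exact: cz); move: zd; rewrite leNgt => /negP.
have [N [b [b0 H]]] : exists N b : R, 0 < b /\ forall z, K z -> Re (N%:C * l z - Q z) <= - b.
  apply: (compact_dominate cK dl dQ) => [z [cz _]|z [cz zd] lz]; first exact: sup.
  have [cI c0] := HP z (conj cz lz).
  have cE j : c z j = (Re (c z j))%:C.
    by apply/eqP; rewrite eq_complex /= [Im _]cI !eqxx.
  have QE : Q z = (\sum_j Re (c z j) ^+ 2)%:C.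
    rewrite (rmorph_sum (real_complex R)); apply: eq_bigr => j _ /=.
    by rewrite [LHS](congr1 (fun x => x ^+ 2) (cE j)) -(rmorphXn (real_complex R)).
  rewrite QE /= lt_def sumr_ge0 ?andbT; last by move=> j _; exact: sqr_ge0.
  apply/negP; rewrite psumr_eq0; last by move=> j _; exact: sqr_ge0.
  move=> /allP cz0.
  suff zq : z = q by move: zd; rewrite zq subrr normR0 leNgt d0.
  apply: c0; apply/rowP => j; rewrite [LHS]cE mxE.
  have := cz0 j (mem_index_enum _); rewrite expf_eq0 /= => /eqP ->.
  by [].
pose phi z := N%:C * l z - Q z.
have dphi z : differentiable phi z.
  by apply: differentiableB; [apply: differentiableM; [exact: differentiable_cst|exact: dl]|exact: dQ].
have [M M0 HM] : exists2 M : R, 0 <= M & forall z, closure O z -> normc (phi z) <= M.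
  by apply: (symbol_bounded Omega_bounded); apply: continuous_subspaceT => z; exact: differentiable_continuous.
(* From [Re phi <= - b] and [|phi| <= B] follows [|1 + t phi| ^ 2 <= 1 - 2 t b + t ^ 2 B ^ 2]; the
   minimizing [t = b / B ^ 2] gives [1 - (b / B) ^ 2]. Adding [b] to [M] ensures [B > 0] and
   [b / B <= 1]. *)
pose B := M + b; have B0 : 0 < B by rewrite ltr_wpDl.
have bB : b / B <= 1 by rewrite ler_pdivrMr// mul1r lerDr.
pose t := b / B ^+ 2.
exists (fun z => 1 + t%:C * phi z), (1 - (b / B) ^+ 2); split.
- move=> z; apply: differentiableD; first exact: differentiable_cst.
  by apply: differentiableM; [exact: differentiable_cst|exact: dphi].
- have -> : phi q = 0.
    rewrite /phi /l /Q /c subrr mul0mx /hdot !big1 ?mulr0 ?subrr// => i _.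
      by rewrite mxE expr0n.
    by rewrite mxE mul0r.
  by rewrite mulr0 addr0.
- by rewrite subr_ge0 expr_le1// divr_ge0// ltW.
- by rewrite ltrBlDr ltrDl exprn_gt0// divr_gt0.
move=> z cz zd; have := H z (conj cz zd); rewrite -/(phi z) => Hz.
have : normc (phi z) ^+ 2 <= B ^+ 2.
  by rewrite ler_pXn2r ?nnegrE ?normc_ge0 ?(ltW B0)// (le_trans (HM z cz))// lerDl ltW.
move: (phi z) Hz => w Hz.
rewrite !sqr_normcE cReD cImD cReM cImM /= !mul0r subr0 ?addr0 ?add0r.
have tb : t * b = (b / B) ^+ 2 by rewrite /t expr_div_n mulrAC.
have tB : t ^+ 2 * B ^+ 2 = (b / B) ^+ 2.
  by rewrite /t; field; rewrite gt_eqF.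
have t0 : 0 < t by rewrite divr_gt0 ?exprn_gt0.
rewrite -tB in tb *; move: (Re w) (Im w) Hz => x y Hz xyB.
have : t ^+ 2 * (x ^+ 2 + y ^+ 2) <= t ^+ 2 * B ^+ 2 by rewrite ler_wpM2l ?sqr_ge0.
have : t * x <= - (t * b) by rewrite -mulrN ler_wpM2l// ltW.
by clear -tb; lra.
Qed.

End peak_functions.

(** * Lower bound *)

Section test_functions.
Variables (R : realType) (n : nat) (Omega : domain R n).
Hypothesis Omega_bounded : bounded_set (domain_set Omega).
Local Notation Cn := 'rV[R[i]]_n.
Local Notation mu := (@complex_lebesgue R n).
Local Notation SI := (square_integrable Omega).
Local Notation dot := (L2dot Omega).
Local Notation norm2 := (L2norm Omega).
Local Notation A2 := (bergman Omega).
Local Notation O := (domain_set Omega).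

Let md := @domain_measurable R n Omega.

(** Elements of the Bergman space are cut off to 0 outside [Omega], so the locality of
    differentiability is needed to restrict entire functions. *)
Lemma differentiable_near_eq (f g : Cn -> R[i]) p (r : R) : 0 < r ->
  (forall z, normR (z - p) < r -> f z = g z) -> differentiable f p -> differentiable g p.
Proof.
move=> r0 fg /diff_locallyP[cl /eqaddoP fo].
suff go : g \o shift p = cst (g p) + 'd f p +o_ 0 id.
  by apply/diff_locallyP; rewrite (diff_unique cl go).
apply/eqaddoP => e e0; have /nbhs_normRP[d d0 dP] := fo e e0.
apply/nbhs_normRP; exists (Num.min r d); first by rewrite lt_min r0.
move=> v; rewrite lt_min => /andP[vr vd]; have := dP v vd.
rewrite !fctE /= !fg ?subrr ?normR0//.
by rewrite addrK -(subr0 v).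
Qed.

Lemma bergman_of_entire (G : Cn -> R[i]) : (forall z, differentiable G z) ->
  exists f : A2, forall z, O z -> f z = G z.
Proof.
move=> dG; pose f z := if z \in O then G z else 0.
have fG z : O z -> f z = G z by move=> Oz; rewrite /f mem_set.
have df : holomorphic_on O f.
  move=> z Oz; have [r r0 rO] := (open_normRP O).1 (@domain_open _ _ Omega) z Oz.
  by apply: (differentiable_near_eq r0 _ (dG z)) => w /rO Ow; rewrite fG.
have cf z (Oz : O z) := differentiable_continuous (df z Oz).
have [m1 m2] := holomorphic_measurable cf.
have [M M0 HM] := @symbol_bounded _ _ Omega Omega_bounded G
  (continuous_subspaceT (fun z => differentiable_continuous (dG z))).
have fI : SI f.
  split => //; apply: (@le_lt_trans _ _ (\int[mu]_(z in Omega) (M ^+ 2)%:E)%E).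
    apply: ge0_le_integral => //.
    - by move=> z _; rewrite lee_fin sqr_ge0.
    - apply/measurable_EFinP; under eq_fun do rewrite sqr_normcE.
      by apply: measurable_funD; exact: measurable_funX.
    - move=> z Oz; rewrite lee_fin ler_pXn2r ?nnegrE ?normc_ge0// (fG z Oz).
      by apply: HM; exact: subset_closure.
  by rewrite integral_cst// lte_mul_pinfty ?lee_fin ?sqr_ge0//; exact: domain_measure_fin.
have fB : f \in bergman_pred Omega.
  rewrite inE; split; [exact: df|exact: fI|move=> z nOz].
  by rewrite /f memNset.
by exists (Bergman fB).
Qed.

Definition restr (A : set Cn) (u : Cn -> R[i]) z : R[i] := (\1_A z)%:C * u z.

Lemma restr_symbol A : measurable A -> bounded_symbol Omega (fun z => (\1_A z)%:C) 1.
Proof.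
move=> mA; split.
- exact: measurable_indic.
- exact: measurable_cst.
- by move=> z _; rewrite normc_real indicE; case: (z \in A); rewrite ?normr1 ?normr0.
Qed.

Lemma restr_SI A u : measurable A -> SI u -> SI (restr A u).
Proof. by move=> mA uI; have [] := symbol_mul ler01 (restr_symbol mA) uI. Qed.

Lemma restr_norm2 A u : measurable A -> SI u -> norm2 (restr A u) <= norm2 u.
Proof.
by move=> mA uI; have [_] := symbol_mul ler01 (restr_symbol mA) uI; rewrite mul1r.
Qed.

Lemma restrT A z u : A z -> restr A u z = u z.
Proof. by move=> Az; rewrite /restr indicE mem_set// mul1r. Qed.

Lemma restrF A z u : ~ A z -> restr A u z = 0.
Proof. by move=> Az; rewrite /restr indicE memNset// mul0r. Qed.

Lemma restr_le A B u : measurable A -> measurable B -> A `<=` B -> SI u ->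
  norm2 (restr A u) <= norm2 (restr B u).
Proof.
move=> mA mB AB uI; rewrite (_ : restr A u = restr A (restr B u)).
  exact/restr_norm2/restr_SI.
apply/funext => z; have [Az|nAz] := pselect (A z); last by rewrite !restrF.
by rewrite !restrT//; exact: AB.
Qed.

(** Near-orthogonality of functions living in complementary places. It is applied with [A] a small
    ball about [q], where [u] is small inside and [v] is small outside. *)
Lemma restr_dot A u v : measurable A -> SI u -> SI v ->
  normc (dot u v) <= norm2 (restr A u) * norm2 v + norm2 u * norm2 (restr (~` A) v).
Proof.
move=> mA uI vI; have mC := measurableC mA.
have -> : dot u v = dot (restr A u) v + dot u (restr (~` A) v).
  have -> : dot u (restr (~` A) v) = dot (restr (~` A) u) v.
    rewrite !dotE; congr complex_integral; apply/funext => z; rewrite /restr.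
    have -> (a : R) (b : R[i]) : (a%:C * b)^* = a%:C * b^*.
      by rewrite rmorphM; congr (_ * _); exact: conjc_real.
    by rewrite mulrCA mulrA.
  rewrite -dotDl; [|exact: restr_SI..|exact: vI].
  congr (L2dot Omega _ v); apply/funext => z; have [Az|nAz] := pselect (A z).
    by rewrite restrT// restrF ?addr0//; apply.
  by rewrite restrF// restrT// add0r.
rewrite (le_trans (le_normcD _ _))// lerD// cauchy_schwarz//; exact: restr_SI.
Qed.

Lemma norm2_sqr_le (u : Cn -> R[i]) (c : R) : 0 <= c -> SI u ->
  (forall z, O z -> normc (u z) ^+ 2 <= c) -> norm2 u ^+ 2 <= c * fine (mu Omega).
Proof.
move=> c0 uI uc; rewrite -lee_fin norm2_sqrE// EFinM fineK; last first.
  by rewrite ge0_fin_numE//; exact: domain_measure_fin.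
rewrite -integral_cst//; apply: ge0_le_integral => //.
- by move=> z _; rewrite lee_fin sqr_ge0.
- by apply/measurable_EFinP; apply: measurable_funX; exact: measurable_normc.
Qed.

Lemma norm2_sqr_ge (u : Cn -> R[i]) (c : R) (U : set Cn) : 0 <= c -> SI u -> measurable U ->
  U `<=` O -> (forall z, U z -> c <= normc (u z) ^+ 2) -> c * fine (mu U) <= norm2 u ^+ 2.
Proof.
move=> c0 uI mU UO uc; rewrite -lee_fin norm2_sqrE// EFinM fineK; last first.
  rewrite ge0_fin_numE//; apply: le_lt_trans (@domain_measure_fin _ _ Omega Omega_bounded).
  by apply: le_measure; rewrite ?inE.
have mn : measurable_fun Omega (fun z => (normc (u z) ^+ 2)%:E).
  by apply/measurable_EFinP; apply: measurable_funX; exact: measurable_normc.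
rewrite -integral_cst//; apply: (@le_trans _ _ (\int[mu]_(z in U) (normc (u z) ^+ 2)%:E)%E).
  by apply: ge0_le_integral => //; exact: measurable_funS mn.
apply: ge0_subset_integral => //.
by move=> z _; rewrite lee_fin sqr_ge0.
Qed.

End test_functions.

(** * Test functions concentrating at a boundary point *)

Section concentration.
Variables (R : realType) (n : nat) (Omega : domain R n).
Hypothesis Omega_bounded : bounded_set (domain_set Omega).
Local Notation Cn := 'rV[R[i]]_n.
Local Notation mu := (@complex_lebesgue R n).
Local Notation Re := complex.Re.
Local Notation SI := (square_integrable Omega).
Local Notation norm2 := (L2norm Omega).
Local Notation A2 := (bergman Omega).
Local Notation O := (domain_set Omega).

Let md := @domain_measurable R n Omega.

Lemma differentiable_exp (G : Cn -> R[i]) k z :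
  differentiable G z -> differentiable (fun z => G z ^+ k) z.
Proof.
move=> dG; elim: k => [|k IH]; first exact: differentiable_cst.
rewrite (_ : (fun _ => _) = (fun z => G z * G z ^+ k)); first exact: differentiableM.
by apply/funext => w; rewrite exprS.
Qed.

Definition nball (q : Cn) (d : R) : set Cn := [set z | normR (z - q) < d].

Lemma measurable_nball q d : measurable (nball q d).
Proof. by apply: sub_sigma_algebra; exact: open_normR_ball. Qed.

(** Dominated convergence along the radii [1 / (m + 1)]: a point of [Omega] differs from [q], so it
    eventually leaves these balls. *)
Lemma restr_nball_small (u : Cn -> R[i]) q (e : R) : SI u -> ~ O q -> 0 < e ->
  exists2 d : R, 0 < d & norm2 (restr (nball q d) u) <= e.
Proof.
move=> uI nOq e0.
pose dl (m : nat) : R := m.+1%:R^-1.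
pose F (m : nat) z : \bar R := (normc (restr (nball q (dl m)) u z) ^+ 2)%:E.
have rI m : SI (restr (nball q (dl m)) u) by apply: restr_SI => //; exact: measurable_nball.
have mF m : measurable_fun Omega (F m).
  by apply/measurable_EFinP; apply: measurable_funX; exact: measurable_normc.
have F0 z : O z -> F ^~ z @ \oo --> 0%E.
  move=> Oz; have zq : 0 < normR (z - q).
    by rewrite normR_gt0; apply/eqP => /subr0_eq zq; apply: nOq; rewrite -zq.
  have [k] := ltr_add_invr (y := 0) (x := normR (z - q)) zq.
  rewrite add0r => hk; apply: cvg_near_cst; exists k => // m /= km.
  rewrite /F restrF ?normc0 ?expr0n//= => zb; have := lt_trans hk zb; apply/negP; rewrite -leNgt.
  by rewrite /dl lef_pV2 ?posrE// ler_nat ltnS.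
have Fu : {ae mu, forall z m, O z -> (`|F m z| <= (normc (u z) ^+ 2)%:E)%E}.
  apply: aeW => z m Oz; rewrite gee0_abs ?lee_fin ?sqr_ge0//.
  rewrite ler_pXn2r ?nnegrE ?normc_ge0//.
  have [zb|zb] := pselect (nball q (dl m) z); first by rewrite restrT.
  by rewrite restrF// normc0 normc_ge0.
have [_ _] := @dominated_convergence _ _ _ mu _ md F (cst 0%E) (fun z => (normc (u z) ^+ 2)%:E)
  mF (measurable_cst _) (aeW _ F0) (sqr_normc_integrable uI) Fu.
rewrite integral0 => /fine_cvgP[_ /cvgrPdist_le/(_ _ (exprn_gt0 2 e0))[k _ H]].
exists (dl k); first by rewrite invr_gt0.
have := H k (leqnn _); rewrite /= sub0r normrN -norm2_sqrE//= ger0_norm ?sqr_ge0//.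
by rewrite ler_pXn2r ?nnegrE ?norm2_ge0 ?(ltW e0).
Qed.

(** [f] is a normalized power of [G]. Away from [q] the square modulus of the power is at most
    [a ^ k], while on an open set [U] of positive measure it is at least [b ^ k] with [b > a]; the
    quotient of the two masses tends to 0. *)
Lemma test_function q (d e : R) (G : Cn -> R[i]) (a : R) : closure O q ->
  (forall z, differentiable G z) -> G q = 1 -> 0 <= a -> a < 1 ->
  (forall z, closure O z -> d <= normR (z - q) -> normc (G z) ^+ 2 <= a) -> 0 < e ->
  exists f : A2, normR f = 1 /\ norm2 (restr (~` nball q d) f) <= e.
Proof.
move=> cq dG Gq a0 a1 Ga e0.
(* The midpoint of [a] and 1 satisfies [s ^ 2 - a = ((1 - a) / 2) ^ 2 > 0], and [Re G > s] holds
   near [q], where [G = 1]. *)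
pose s := (1 + a) / 2; have s1 : s < 1 by rewrite /s; lra.
have s0 : 0 < s by rewrite /s; lra.
pose b := s ^+ 2; have b0 : 0 < b by rewrite exprn_gt0.
have ab : a < b by rewrite /b /s; nra.
pose U := O `&` [set z | s < Re (G z)].
have oG : open [set z | s < Re (G z)] by exact: open_Re_gt.
have oU : open U by apply: openI oG; exact: (@domain_open _ _ Omega).
have U0 : U !=set0.
  have [|z [Oz zG]] := cq [set z | s < Re (G z)]; last by exists z.
  by apply: open_nbhs_nbhs; split; [exact: oG|rewrite /= Gq].
have UG z : U z -> b <= normc (G z) ^+ 2.
  move=> [_ /= sG]; rewrite ler_pXn2r ?nnegrE ?normc_ge0 ?(ltW s0)//.
  by apply: (le_trans (ltW sG)); exact: le_trans (ler_norm _) (Re_le_normc _).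
have mU : measurable U by exact: sub_sigma_algebra.
have UO : U `<=` O by move=> z [].
have v0 := complex_lebesgue_open_gt0 oU U0.
have muO : (mu Omega < +oo)%E by exact: domain_measure_fin.
have muU : (mu U < +oo)%E by apply: le_lt_trans muO; apply: le_measure; rewrite ?inE.
pose v := fine (mu U); pose V := fine (mu Omega).
have v0' : 0 < v by rewrite fine_gt0// v0.
have V0 : 0 <= V by exact: fine_ge0.
have r0 : 0 <= a / b by rewrite divr_ge0// ltW.
have ab1 : `|a / b| < 1 by rewrite ger0_norm// ltr_pdivrMr// mul1r.
have K0 : 0 < e ^+ 2 * v / (V + 1) by rewrite divr_gt0 ?mulr_gt0 ?exprn_gt0// ltr_wpDl.
have [k _ /(_ k (leqnn _))] := (cvgrPdist_le _ _).1 (cvg_expr ab1) _ K0.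
rewrite /= sub0r normrN ger0_norm ?exprn_ge0// => abk.
have [F FG] := @bergman_of_entire _ _ Omega Omega_bounded (fun z => G z ^+ k) (fun z => @differentiable_exp G k z (dG z)).
have nF z : O z -> normc (F z) ^+ 2 = (normc (G z) ^+ 2) ^+ k.
  move=> Oz; rewrite FG// exprAC; congr (_ ^+ 2).
  by apply: (@complexI R); rewrite -norm_normc normrX norm_normc (rmorphXn (real_complex R)).
have FI := bergman_SI F.
have low : b ^+ k * v <= norm2 F ^+ 2.
  apply: norm2_sqr_ge => //; first by rewrite exprn_ge0// ltW.
  by move=> z Uz; rewrite (nF z (UO z Uz)) lerXn2r ?nnegrE ?sqr_ge0 ?(ltW b0) ?UG.
have nF0 : 0 < norm2 F.
  have h : 0 < norm2 F ^+ 2.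
    by rewrite (lt_le_trans _ low)// mulr_gt0// exprn_gt0.
  by rewrite lt_def norm2_ge0 andbT -sqrf_eq0 gt_eqF.
exists ((norm2 F)^-1%:C *: F); split.
  by rewrite normRZ normc_real gtr0_norm ?invr_gt0// mulVf// gt_eqF.
have mC : measurable (~` nball q d) by apply: measurableC; exact: measurable_nball.
set f := _ *: F.
rewrite -(@ler_pXn2r _ 2) ?nnegrE ?norm2_ge0 ?(ltW e0)//.
have fI : SI (restr (~` nball q d) f) by apply: (restr_SI mC); exact: bergman_SI.
have c0 : 0 <= a ^+ k / norm2 F ^+ 2 by rewrite divr_ge0 ?exprn_ge0 ?norm2_ge0.
apply: (le_trans (norm2_sqr_le Omega_bounded c0 fI _)).
  move=> z Oz; have [zd|/contrapT zd] := pselect ((~` nball q d) z); last first.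
    by rewrite restrF ?normc0 ?expr0n//; apply.
  rewrite restrT// [bergman_fun f z](_ : _ = (norm2 F)^-1%:C * F z)//.
  rewrite normcM normc_real exprMn nF// normrV ?unitfE ?gt_eqF// gtr0_norm// exprVn.
  rewrite mulrC ler_pM2r ?invr_gt0 ?exprn_gt0//.
  rewrite lerXn2r ?nnegrE ?sqr_ge0//; apply: Ga; first exact: subset_closure.
  by rewrite leNgt; apply/negP.
rewrite -/V mulrAC ler_pdivrMr ?exprn_gt0//.
apply: (@le_trans _ _ (e ^+ 2 * (b ^+ k * v))); last by rewrite ler_wpM2l// sqr_ge0.
move: abk; rewrite ler_pdivlMr ?ltr_wpDl// expr_div_n mulrAC ler_pdivrMr ?exprn_gt0// => abk.
have -> : e ^+ 2 * (b ^+ k * v) = e ^+ 2 * v * b ^+ k by ring.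
by apply: le_trans abk; rewrite ler_wpM2l ?exprn_ge0// lerDl.
Qed.

End concentration.

Section lower_bound.
Variables (R : realType) (n : nat) (Omega : domain R n).
Hypothesis n_gt0 : (0 < n)%N.
Hypothesis Omega_bounded : bounded_set (domain_set Omega).
Local Notation Cn := 'rV[R[i]]_n.
Local Notation Re := complex.Re.
Local Notation Im := complex.Im.
Local Notation dot := (L2dot Omega).
Local Notation norm2 := (L2norm Omega).
Local Notation A2 := (bergman Omega).
Local Notation O := (domain_set Omega).

(** A point [q] of the closure farthest from the origin cannot be in the domain: moving along [q],
    or along any nonzero vector if [q = 0], increases the distance. Such a vector exists because
    [n > 0]. *)
Lemma boundary_neq0 : boundary O !=set0.
Proof.
have [a Oa] := @domain_neq0 _ _ Omega.
have [||q qO qmax] := @compact_EVT_max _ R (fun z : Cn => esq (z - 0)) (closure O) _ (compact_closure_domain Omega_bounded).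
- by exists a; exact: subset_closure.
- by apply: continuous_subspaceT; exact: esq_continuous.
rewrite inE in qO; exists q; apply/boundaryE; split; first exact: qO.
move=> Oq; have [r r0 rO] := (open_normRP O).1 (@domain_open _ _ Omega) q Oq.
have [u u0 uq] : exists2 u : Cn, u != 0 & 0 <= Re (hdot u q).
  have [->|q0] := eqVneq q 0; last first.
    by exists q; [exact: q0|rewrite hdotuu; exact: esq_ge0].
  exists (const_mx 1); last by rewrite /hdot big1// => i _; rewrite [X in _ * X^*]mxE (_ : 0^* = 0) ?mulr0//; exact: conjc0.
  apply/eqP => /rowP/(_ (Ordinal n_gt0)); rewrite !mxE => /eqP; apply/negP; exact: oner_neq0.
have nu : 0 < normR u by rewrite normR_gt0.
have s0 : 0 < r / 2 / normR u by rewrite !divr_gt0.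
have Oz' : O (q + (r / 2 / normR u)%:C *: u).
  apply: rO; rewrite addrC addKr normRZ normc_real (gtr0_norm s0) divfK; first exact: half_lt.
  by rewrite (gt_eqF nu).
have := qmax _ (mem_set (subset_closure Oz')).
rewrite !subr0 esq_addZ leNgt -addrA ltrDl => /negP; apply.
rewrite ltr_wpDl; [exact: isT|apply: mulr_ge0; [|exact: uq]|].
  by rewrite mulr_ge0 // ltW.
by rewrite mulr_gt0 ?exprn_gt0 ?esq_gt0.
Qed.

Lemma restr_nball_small_seq (s : seq A2) q (e : R) : ~ O q -> 0 < e ->
  exists2 d : R, 0 < d & forall h, h \in s -> norm2 (restr (nball q d) h) <= e.
Proof.
move=> nOq e0; elim: s => [|h s [d d0 sd]]; first by exists 1.
have [d' d'0 hd'] := restr_nball_small (bergman_SI h) nOq e0.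
exists (Num.min d d'); first by rewrite lt_min d0.
have sub c : Num.min d d' <= c -> nball q (Num.min d d') `<=` nball q c.
  by move=> dc z /= zd; apply: lt_le_trans zd dc.
move=> g; rewrite inE => /predU1P[->|/sd].
  apply: le_trans hd'; apply: restr_le; [exact: measurable_nball..| |exact: bergman_SI].
  by apply: sub; rewrite ge_min lexx orbT.
apply: le_trans; apply: restr_le; [exact: measurable_nball..| |exact: bergman_SI].
by apply: sub; rewrite ge_min lexx.
Qed.

(** For a unit vector [f], [psi q] is the inner product of [T_psi f - S f] with [f], plus that of
    [S f], minus that of [(psi - psi q) f]. When [f] concentrates at [q], the last two are small. *)
Lemma lower_bound (psi : Cn -> R[i]) (S : {linear A2 -> A2}) q (e : R) :
  {within closure O, continuous psi} -> compact_operator S -> boundary O q -> peak_point Omega q ->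
  0 < e -> exists2 f : A2, normR f <= 1 & normc (psi q) <= normR (toeplitz psi f - S f) + e.
Proof.
(* One fifth pays for replacing [S f] by a net point [h]; two pay for [dot h f], inside and outside
   the ball; two for [(psi - psi q) f], likewise. *)
move=> cpsi cS /boundaryE[cq nOq] pq e0; pose e1 := e / 5.
have e10 : 0 < e1 by rewrite divr_gt0.
have [M M0 psiM] := symbol_bounded Omega_bounded cpsi.
have [d1 d10 psid] := within_continuous_normR cpsi cq e10.
pose B := S @` [set x : A2 | `|x| <= 1].
have cB : compact (closure B) by rewrite -precompactE.
(* The net is fixed before [f], so that the radius of the ball can be adapted to all its members. *)
have [|s [sB cov]] := @compact_finite_cover _ (closure B) (fun p => [set g | normR (g - p) < e1]) cB.
  by move=> p cp; split; [exact: open_normR_ball|rewrite /= subrr normR0].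
have [d2 d20 sd] := restr_nball_small_seq s nOq e10.
pose d := Num.min d1 d2; have d0 : 0 < d by rewrite lt_min d10.
pose H := \sum_(h <- s) normR h.
have H0 : 0 <= H by apply: sumr_ge0 => h _; exact: normR_ge0.
have HM : 0 < H + M + M + 1 by rewrite ltr_wpDl ?addr_ge0.
(* The mass of [f] outside the ball is later multiplied by a norm of at most [H] or [M + M]; the
   result must not exceed [e1]. *)
pose e2 := e1 / (H + M + M + 1); have e20 : 0 < e2 by rewrite divr_gt0.
have [G [a [dG Gq a0 a1 Ga]]] := pq d d0.
have [f [f1 ff]] := test_function Omega_bounded cq dG Gq a0 a1 Ga e20.
exists f; first by rewrite f1.
have mN := measurable_nball q d; have fI := bergman_SI f.
have [mp1 mp2] := symbol_measurable cpsi.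
have bpsi : bounded_symbol Omega psi M.
  by split; [exact: mp1|exact: mp2|move=> z Oz; apply: psiM; exact: subset_closure].
have [pI _] := symbol_mul M0 bpsi fI.
pose p1 z := psi z - psi q.
have mp11 : measurable_fun Omega (fun z => Re (p1 z)).
  rewrite (_ : (fun _ => _) = (fun z => Re (psi z) - Re (psi q))).
    by apply: measurable_funB; [exact: mp1|exact: measurable_cst].
  by apply/funext => z; rewrite /p1 cReB.
have mp12 : measurable_fun Omega (fun z => Im (p1 z)).
  rewrite (_ : (fun _ => _) = (fun z => Im (psi z) - Im (psi q))).
    by apply: measurable_funB; [exact: mp2|exact: measurable_cst].
  by apply/funext => z; rewrite /p1 cImB.
have M20 : 0 <= M + M by rewrite addr_ge0.
have bp1 : bounded_symbol Omega p1 (M + M).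
  split; [exact: mp11|exact: mp12|move=> z Oz].
  rewrite (le_trans (le_normcD _ _))// normcN lerD//; apply: psiM; last exact: cq.
  exact: subset_closure.
have bp2 : bounded_symbol Omega (restr (nball q d) p1) e1.
  split.
  - rewrite (_ : (fun _ => _) = (fun z => \1_(nball q d) z * Re (p1 z))).
      by apply: measurable_funM; [exact: measurable_indic|exact: mp11].
    by apply/funext => z; rewrite /restr cReM /= mul0r subr0.
  - rewrite (_ : (fun _ => _) = (fun z => \1_(nball q d) z * Im (p1 z))).
      by apply: measurable_funM; [exact: measurable_indic|exact: mp12].
    by apply/funext => z; rewrite /restr cImM /= mul0r addr0.
  - move=> z Oz; have [zd|zd] := pselect (nball q d z); last first.
      by rewrite restrF ?normc0 ?ltW.
    rewrite restrT//; apply/ltW/psid; first exact: subset_closure.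
    by apply: lt_le_trans zd _; rewrite ge_min lexx.
have [uI uM] := symbol_mul M20 bp1 fI.
have [_ ue] := symbol_mul (ltW e10) bp2 fI.
have f1' : norm2 f = 1 by exact: f1.
rewrite f1' mulr1 in uM; rewrite f1' mulr1 in ue.
have He1 (x : R) : 0 <= x -> x <= H + M + M -> x * e2 <= e1.
  move=> x0 xH; rewrite /e2 mulrA ler_pdivrMr// mulrC ler_wpM2l ?(ltW e10)//.
  by rewrite (le_trans xH)// lerDl.
have far : norm2 (restr (~` nball q d) f) <= e2 by exact: ff.
have D1 : normc (dot (fun z => p1 z * f z) f) <= 2 * e1.
  apply: (le_trans (restr_dot mN uI fI)); rewrite f1' mulr1.
  have -> : restr (nball q d) (fun z => p1 z * f z) = (fun z => restr (nball q d) p1 z * f z).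
    by apply/funext => z; rewrite /restr mulrA.
  rewrite (_ : 2 * e1 = e1 + e1); last by ring.
  apply: lerD; first exact: ue.
  apply: le_trans (He1 (M + M) M20 _); last by rewrite -addrA lerDr.
  by apply: ler_pM => //; exact: norm2_ge0.
have [h hs hf] : exists2 h, h \in s & normR (S f - h) < e1.
  apply: cov; apply: subset_closure; exists f => //=.
  by rewrite normRE f1.
have hH : normR h <= H.
  rewrite /H (big_rem h hs) /= lerDl; apply: sumr_ge0 => g _; exact: normR_ge0.
have D2 : normc (dot h f) <= 2 * e1.
  apply: (le_trans (restr_dot mN (bergman_SI h) fI)); rewrite f1' mulr1.
  rewrite (_ : 2 * e1 = e1 + e1); last by ring.
  apply: lerD.
    apply: le_trans (sd h hs); apply: restr_le; [exact: measurable_nball..| |exact: bergman_SI].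
    by move=> z /= zd; apply: lt_le_trans zd _; rewrite /d ge_min lexx orbT.
  apply: le_trans (He1 (normR h) (normR_ge0 _) _); last by rewrite -addrA ler_wpDr.
  by apply: ler_pM => //; exact: norm2_ge0.
have D3 : normc (dot (S f - h) f) <= e1.
  apply: (le_trans (cauchy_schwarz (bergman_SI _) fI)); rewrite f1' mulr1; exact: ltW.
pose w := toeplitz psi f - S f.
have D4 : normc (dot w f) <= normR w.
  by apply: (le_trans (cauchy_schwarz (bergman_SI w) fI)); rewrite f1' mulr1.
have wE : psi q = dot w f + dot (S f - h) f + dot h f - dot (fun z => p1 z * f z) f.
  have -> : dot w f + dot (S f - h) f + dot h f = dot (fun z => psi z * f z) f.
    have -> : dot w f + dot (S f - h) f + dot h f = dot (w + (S f - h) + h) f.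
      by rewrite (bergman_dotD _ _ fI) (bergman_dotD _ _ fI).
    by rewrite /w -addrA !subrK bergman_projP.
  rewrite -dotBl//.
  rewrite (_ : (fun z => _ - _) = (fun z => psi q * f z)); last first.
    by apply/funext => z; rewrite /p1; ring.
  by rewrite dotZl// dotff f1' expr1n mulr1.
rewrite wE -/w; have e5 : e = 5 * e1 by rewrite /e1; field.
apply: (le_trans (le_normcD _ _)); rewrite normcN.
have := le_normcD (dot w f + dot (S f - h) f) (dot h f).
have := le_normcD (dot w f) (dot (S f - h) f).
move: D1 D2 D3 D4; rewrite e5.
move: (normc (dot w f)) (normc _) (normc _) (normc _) (normc _) (normc _) (e1); clear => *; lra.
Qed.

End lower_bound.

(** Positive dimension is assumed because in dimension 0 the domain is a single point with empty
    boundary: the supremum over it would be [-oo], while an essential norm is nonnegative. *)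
Theorem corollary4 (R : realType) (n : nat) (hn : (0 < n)%N)
    (Omega : domain R n) (psi : 'rV[R[i]]_n -> R[i])
    (Omega_bounded : bounded_set (domain_set Omega))
    (Omega_convex : convex_set (domain_set Omega))
    (Omega_smooth : has_smooth_boundary (domain_set Omega))
    (no_disk : ~ has_analytic_disk (boundary (domain_set Omega)))
    (psi_continuous : {within closure (domain_set Omega), continuous psi}) :
  essential_norm (toeplitz (Omega := Omega) psi) =
  sup_norm (boundary (domain_set Omega)) psi.
Proof.
have [M M0 psiM] := symbol_bounded Omega_bounded psi_continuous.
have [p0 bp0] := boundary_neq0 hn Omega_bounded.
have supP p : boundary (domain_set Omega) p ->
    ((normc (psi p))%:E <= sup_norm (boundary (domain_set Omega)) psi)%E.
  by move=> bp; apply: ereal_sup_ubound; exists p.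
(* A boundary point excludes [-oo], the bound of [psi] on the compact closure excludes [+oo]. *)
have sup_fin : sup_norm (boundary (domain_set Omega)) psi \is a fin_num.
  rewrite ge0_fin_numE; last by apply: le_trans (supP p0 bp0); rewrite lee_fin normc_ge0.
  apply: (@le_lt_trans _ _ M%:E); last exact: ltry.
  by apply: ge_ereal_sup => _ [p [cp _] <-]; rewrite lee_fin; exact: psiM.
apply/eqP; rewrite eq_le; apply/andP; split.
  rewrite -(fineK sup_fin); apply/lee_addgt0Pr => e e0; rewrite -EFinD.
  apply: essential_norm_le => //.
    by rewrite fine_ge0// (le_trans _ (supP p0 bp0))// lee_fin normc_ge0.
  by move=> p bp; rewrite -lee_fin fineK//; exact: supP.
apply: ge_ereal_sup => _ [p bp <-]; apply: le_ereal_inf_tmp => _ [S cS <-].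
apply/lee_addgt0Pr => e e0; have e20 : 0 < e / 2 by rewrite divr_gt0.
have [d d0 psid] := within_continuous_normR psi_continuous ((boundaryE Omega p).1 bp).1 e20.
(* [p] itself need not be a peak point: half of [e] pays for moving to a peak point [q] nearby, the
   other half for the lower bound at [q]. *)
have [q [bq qp pq]] := peak_points_dense Omega_bounded Omega_convex no_disk bp d0.
have [f f1 psiq] := lower_bound Omega_bounded psi_continuous cS bq pq e20.
apply: (@le_trans _ _ ((normR (toeplitz psi f - S f))%:E + e%:E)%E).
  have psiqp := psid q ((boundaryE Omega q).1 bq).1 qp.
  have := le_normcB (psi p) (psi q); rewrite normcB -EFinD lee_fin.
  move: psiq psiqp.
  move: (normc (psi p)) (normc (psi q)) (normc _) (normR _); clear => *; lra.
apply: leeD2r; apply: ereal_sup_ubound; exists f => //=.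
by rewrite normRE -(rmorph1 (real_complex R)) lecR.
Qed.
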